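(* Let $f\in\mathcal{A}_c(\mathbb{T})$ and let $g\in\mathcal{BV}(\mathbb{T})$. Then: (a) $f\ast g\in C^0(\mathbb{T})$; (b) $f\ast g=g\ast f$; (c) $\|f\ast g\|_\infty\le\|f\|_{\mathbb{T}}\|g\|_{\mathcal{BV}}$; (d) for $y\in\mathbb{R}$, $\tau_y(f\ast g)=(\tau_yf)\ast g=f\ast(\tau_yg)$; (e) if $h\in L^1(\mathbb{T})$ then $f\ast(g\ast h)=(f\ast g)\ast h\in C^0(\mathbb{T})$; (f) for each $f\in\mathcal{A}_c(\mathbb{T})$ define $\Phi_f:\mathcal{BV}(\mathbb{T})\to C^0(\mathbb{T})$ by $\Phi_f[g]=f\ast g$; then $\Phi_f$ is a bounded linear operator and $\|\Phi_f\|\le\|f\|_{\mathbb{T}}$. For each $g\in\mathcal{BV}(\mathbb{T})$ define $\Psi_g:\mathcal{A}_c(\mathbb{T})\to C^0(\mathbb{T})$ by $\Psi_g[f]=f\ast g$; then $\Psi_g$ is a bounded linear operator and $\|\Psi_g\|\le\|g\|_{\mathcal{BV}}$; (g) $\widehat{f\ast g}(n)=\hat f(n)\hat g(n)$ for all $n\in\mathbb{Z}$; (h) $\|f\ast g\|_{\mathbb{T}}\le\|f\|_{\mathbb{T}}\|g\|_1$. (i) Let $f,g\in L^1(\mathbb{T})$. Then $\|f\ast g\|_{\mathbb{T}}\le\|f\|_{\mathbb{T}}\|g\|_1\le\|f\|_1\|g\|_1$.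
   Context: ''Periodic'' means $2\pi$-periodic, and $\mathbb{T}$ is modelled by $[-\pi,\pi)$. $C^0(\mathbb{T})$ is the space of continuous periodic functions on $\mathbb{R}$ with the uniform norm $\|\cdot\|_\infty$. $L^1(\mathbb{T})$ is the space of periodic locally Lebesgue integrable functions, $\|g\|_1=\int_{-\pi}^{\pi}|g|$. $\mathcal{B}_c(\mathbb{T})$ is the set of continuous $F:\mathbb{R}\to\mathbb{R}$ with $F(-\pi)=0$ and $F(y+2n\pi)=F(y)+nF(\pi)$ for all $y\in[-\pi,\pi)$, $n\in\mathbb{Z}$. $\mathcal{A}_c(\mathbb{T})$ is the set of Schwartz distributions $f$ on $\mathbb{R}$ such that $f=F'$ (distributional derivative) for some $F\in\mathcal{B}_c(\mathbb{T})$; this $F$ is unique and is called the primitive of $f$. The continuous primitive integral is $\int_a^bf=F(b)-F(a)$. $L^1(\mathbb{T})$ is regarded as a subspace of $\mathcal{A}_c(\mathbb{T})$. The Alexiewicz norm is $\|f\|_{\mathbb{T}}=\sup_{|I|\le2\pi}\left|\int_If\right|$, supremum over intervals $I\subset\mathbb{R}$ of length at most $2\pi$; $\mathcal{A}_c(\mathbb{T})$ is a Banach space with this norm. $\mathcal{BV}(\mathbb{T})$ is the set of periodic functions $g:\mathbb{R}\to\mathbb{R}$ with $Vg=\sup\sum_i|g(s_i)-g(t_i)|<\infty$, the supremum over all families of disjoint open intervals $(s_i,t_i)\subset(-\pi,\pi)$; $\|g\|_{\mathcal{BV}}=\|g\|_\infty+Vg$. For $f\in\mathcal{A}_c(\mathbb{T})$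 with primitive $F$ and $g\in\mathcal{BV}(\mathbb{T})$, $\int_{-\pi}^{\pi}fg=F(\pi)g(\pi)-\int_{-\pi}^{\pi}F\,dg$ (Riemann--Stieltjes integral). For complex-valued objects real and imaginary parts are integrated separately. Convolution: for $f\in\mathcal{A}_c(\mathbb{T})$, $g\in\mathcal{BV}(\mathbb{T})$, $f\ast g(x)=\int_{-\pi}^{\pi}f(x-t)g(t)\,dt$, where $t\mapsto f(x-t)$ is the distribution $f\circ r_x$, $r_x(t)=x-t$ (i.e. the derivative of $t\mapsto-F(x-t)$), an element of $\mathcal{A}_c(\mathbb{T})$ and the integral is the continuous primitive integral of the product; $g\ast f(x)=\int_{-\pi}^{\pi}g(x-t)f(t)\,dt$. For two $L^1(\mathbb{T})$ functions it is the usual convolution $\int_{-\pi}^{\pi}f(x-t)g(t)\,dt$ (Lebesgue). Fourier coefficients: $\hat f(n)=\int_{-\pi}^{\pi}f(t)e^{-int}\,dt$. Translation: $\langle\tau_yf,\phi\rangle=\langle f,\tau_{-y}\phi\rangle$ for test functions $\phi$, with $\tau_y\phi(x)=\phi(x-y)$ for functions. *)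

(* Defs.v *)
From HB Require Import structures.
From mathcomp Require Import all_boot all_order all_algebra.
From mathcomp Require Import all_classical all_reals all_analysis.
From mathcomp.real_closed Require Import complex.
Import Order.TTheory GRing.Theory Num.Theory.
Import numFieldNormedType.Exports.

Set Implicit Arguments.
Unset Strict Implicit.
Unset Printing Implicit Defensive.

Local Open Scope classical_set_scope.
Local Open Scope ring_scope.

Section test_functions.
Context {R : realType}.
Implicit Types (phi psi : R -> R^o) (a s c : R) (n : nat).

Definition smooth phi := forall n x, derivable (derive1n n phi) x 1.

Definition compactly_supported phi := compact (closure [set x | phi x != 0]).

Lemma compactly_supportedP phi :
  compactly_supported phi <->
  exists2 K : set R, compact K & forall x, ~ K x -> phi x = 0.
Proof.
split=> [cphi|[K cK K0]].
  exists (closure [set x | phi x != 0]) => // x nx.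
  by apply/eqP/negPn/negP => phix; apply: nx; exact: subset_closure.
apply: (subclosed_compact _ cK); first exact: closed_closure.
rewrite (closure_id K).1; last exact: compact_closed.
apply: closure_subset => x /= /eqP phix.
by apply: contrapT => /K0.
Qed.

Lemma derive1nD n a phi psi : smooth phi -> smooth psi ->
  derive1n n (a *: phi + psi) = a *: derive1n n phi + derive1n n psi.
Proof.
move=> sphi spsi; elim: n => [//|n ih].
rewrite !derive1nS ih; apply/funext => x.
rewrite derive1E deriveD; [|exact/derivableZ/sphi|exact: spsi].
rewrite deriveZ; last exact: sphi.
by rewrite -!derive1E.
Qed.

Lemma is_derive_affine n s c phi x : smooth phi ->
  is_derive x (1 : R) (fun x : R => s ^+ n * derive1n n phi (s * x + c) : R^o)
    (s ^+ n.+1 * derive1n n.+1 phi (s * x + c)).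
Proof.
move=> sphi; pose l := fun x : R => s * x + c : R.
have dl : is_derive x (1 : R) (l : R -> R^o) s.
  rewrite /l; apply: is_derive_eq.
  by rewrite addr0 -[LHS]/(s * 1) mulr1.
have dphi : is_derive (l x) (1 : R) (derive1n n phi) (derive1n n.+1 phi (l x)).
  by apply: DeriveDef; [exact: sphi|rewrite derive1nS derive1E].
have dc := @is_derive1_comp _ (derive1n n phi) l x _ _ dphi dl.
have h : is_derive x (1 : R) (s ^+ n *: (derive1n n phi \o l : R -> R^o))
    (s ^+ n *: (derive1n n.+1 phi (l x) * s : R^o)).
  exact: is_deriveZ.
apply: (is_derive_eq h).
by rewrite -[LHS]/(_ * (_ * _)) [X in _ * X]mulrC mulrA exprSr.
Qed.

Lemma derive1n_affine n s c phi : smooth phi ->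
  derive1n n (fun x => phi (s * x + c) : R^o)
  = (fun x => s ^+ n * derive1n n phi (s * x + c)).
Proof.
move=> sphi; elim: n => [|n ih].
  by apply/funext => x; rewrite !derive1n0 expr0 mul1r.
rewrite derive1nS ih; apply/funext => x.
by rewrite derive1E; apply: derive_val; exact: is_derive_affine.
Qed.

Definition test_pred : {pred R -> R^o} :=
  [pred phi | `[< smooth phi /\ compactly_supported phi >]].

Lemma test_predP phi :
  reflect (smooth phi /\ compactly_supported phi) (phi \in test_pred).
Proof. exact: asboolP. Qed.

Lemma test_submod_closed : submod_closed test_pred.
Proof.
split.
  apply/test_predP; split.
    move=> n x; rewrite (_ : derive1n n (0 : R -> R^o) = cst 0).
      exact: derivable_cst.
    elim: n => // n ih; rewrite derive1nS ih.
    by apply/funext => y; rewrite derive1_cst.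
  by apply/compactly_supportedP; exists set0 => //; exact: compact0.
move=> a phi psi /test_predP[s1 c1] /test_predP[s2 c2].
apply/test_predP; split.
  move=> n x; rewrite derive1nD//.
  by apply: derivableD; [exact/derivableZ/s1|exact: s2].
move: c1 c2 => /compactly_supportedP[K cK K0] /compactly_supportedP[L cL L0].
apply/compactly_supportedP; exists (K `|` L); first exact: compactU.
move=> x /not_orP[nK nL].
by rewrite -[LHS]/(a *: phi x + psi x) K0// L0// scaler0 addr0.
Qed.

HB.instance Definition _ :=
  GRing.isSubmodClosed.Build R (R -> R^o) test_pred test_submod_closed.

Record test_function := TestFunction {
  test_fun :> R -> R^o;
  test_funP : test_fun \in test_pred }.

HB.instance Definition _ := [isSub for test_fun].
HB.instance Definition _ := [Choice of test_function by <:].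
HB.instance Definition _ := [SubChoice_isSubLmodule of test_function by <:].

Lemma test_deriv_subproof (phi : test_function) :
  derive1 phi \in test_pred.
Proof.
have /test_predP[sphi /compactly_supportedP[K cK K0]] := test_funP phi.
apply/test_predP; split.
  by move=> n x; rewrite -derive1Sn; exact: sphi.
apply/compactly_supportedP; exists K => // x nKx.
have oK : open (~` K) by apply: closed_openC; exact: compact_closed.
rewrite derive1E (@near_eq_derive _ _ _ _ (cst 0)) ?derive_cst//.
have := @open_nbhs_nbhs _ x (~` K) (conj oK nKx).
by apply: filterS => y /K0.
Qed.

Lemma test_affine_subproof s c (phi : test_function) : s != 0 ->
  (fun x => phi (s * x + c) : R^o) \in test_pred.
Proof.
move=> s0; have /test_predP[sphi /compactly_supportedP[K cK K0]] := test_funP phi.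
apply/test_predP; split.
  move=> n x; rewrite derive1n_affine//.
  by have [] := is_derive_affine n s c x sphi.
apply/compactly_supportedP.
exists ((fun x : R => s^-1 * (x - c)) @` K).
  apply: continuous_compact => //; apply: continuous_subspaceT => x.
  by apply: cvgMr; apply: cvgB; [exact: cvg_id|exact: cvg_cst].
move=> x nx; apply: K0 => Kx; apply: nx; exists (s * x + c) => //.
by rewrite addrK mulKf.
Qed.

Definition test_deriv (phi : test_function) : test_function :=
  TestFunction (test_deriv_subproof phi).

Lemma test_shift_subproof (y : R) (phi : test_function) :
  (fun x => phi (x - y) : R^o) \in test_pred.
Proof.
have := test_affine_subproof (- y) phi (oner_neq0 R).
by under [X in X \in _ -> _]eq_fun do rewrite mul1r.
Qed.

Definition test_shift (y : R) (phi : test_function) : test_function :=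
  TestFunction (test_shift_subproof y phi).

Lemma test_reflect_subproof (x : R) (phi : test_function) :
  (fun t => phi (x - t) : R^o) \in test_pred.
Proof.
have N10 : (-1 : R) != 0 by rewrite oppr_eq0 oner_neq0.
have := test_affine_subproof x phi N10.
by under [X in X \in _ -> _]eq_fun do rewrite mulN1r addrC.
Qed.

Definition test_reflect (x : R) (phi : test_function) : test_function :=
  TestFunction (test_reflect_subproof x phi).

(* Convergence to 0 in D(R): supports in a common compact set and uniform
   convergence of the derivatives of every order. *)
Definition test_cvg0 (u : nat -> test_function) :=
  (exists2 K : set R, compact K & forall n, closure [set x | u n x != 0] `<=` K)
  /\ forall k : nat, forall e : R, 0 < e ->
       \forall n \near \oo, forall x, `|derive1n k (u n) x| < e.

End test_functions.
Arguments test_function : clear implicits.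

Section distributions.
Context {R : realType}.
Local Notation mu := (@lebesgue_measure R).

Definition functional := test_function R -> R^o.

Definition is_distribution (T : functional) :=
  linear T /\
  forall u : nat -> test_function R, test_cvg0 u -> T (u n) @[n --> \oo] --> (0 : R).

Definition regular (F : R -> R) : functional :=
  fun phi => \int[mu]_(x in setT) (F x * phi x).

Definition dist_deriv (T : functional) : functional :=
  fun phi => - T (test_deriv phi).

Definition dist_shift (y : R) (T : functional) : functional :=
  fun phi => T (test_shift (- y) phi).

(* The distribution T o r_x with r_x t = x - t; r_x is an involution with
   Jacobian of absolute value 1. *)
Definition dist_reflect (x : R) (T : functional) : functional :=
  fun phi => T (test_reflect x phi).

Definition shift_fun (y : R) (u : R -> R) : R -> R := fun x => u (x - y).

End distributions.

Section function_spaces.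
Context {R : realType}.
Local Notation mu := (@lebesgue_measure R).
Implicit Types (F g u : R -> R).

Definition C0 : set (R -> R^o) :=
  [set u : R -> R^o | continuous u /\ periodic u (pi *+ 2)].

Definition uniform_norm (u : R -> R^o) : R := sup [set `|u x| | x in setT].

(* A function is Lebesgue measurable iff it agrees almost everywhere with a
   Borel function, whereas [locally_integrable] requires Borel measurability.
   The library's integral, a supremum over simple Borel functions below the
   integrand, still computes the Lebesgue integral of such a function. *)
Definition L1 : set (R -> R^o) :=
  [set u : R -> R^o | periodic u (pi *+ 2) /\
    exists2 v : R -> R, locally_integrable setT v &
                        {ae mu, forall x, u x = v x}].

Definition L1_norm (u : R -> R^o) : R := \int[mu]_(t in `[- pi, pi]) `|u t|.

(* Open intervals contained in ]-pi, pi[ may have -pi or pi as an endpoint, so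
   the variation over disjoint families of them is that of [-pi, pi]. *)
Definition BV : set (R -> R^o) :=
  [set g : R -> R^o | periodic g (pi *+ 2) /\ bounded_variation (- pi) pi g].

Definition BV_norm (g : R -> R^o) : R :=
  uniform_norm g + fine (total_variation (- pi) pi g).

Definition Bc : set (R -> R^o) :=
  [set F : R -> R^o | [/\ continuous F, F (- pi) = 0 &
    forall (y : R) (n : int), - pi <= y < pi ->
      F (y + n%:~R * (pi *+ 2)) = F y + n%:~R * F pi]].

Definition Ac : set (@functional R) :=
  [set f | is_distribution f /\
           exists2 F, Bc F & f = dist_deriv (regular F)].

End function_spaces.

Section integrals.
Context {R : realType}.
Local Notation mu := (@lebesgue_measure R).
Implicit Types (F g u v : R -> R) (f : @functional R).

(* [a :: s] is the partition and [xi i] the tag of its i-th subinterval. *)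
Definition is_Riemann_Stieltjes F g (a b : R) (I : R) :=
  forall e : R, 0 < e -> exists2 d : R, 0 < d &
    forall (s : seq R) (xi : nat -> R), itv_partition a b s ->
      (forall i, (i < size s)%N -> nth b s i - nth b (a :: s) i < d) ->
      (forall i, (i < size s)%N -> nth b (a :: s) i <= xi i <= nth b s i) ->
      `|\sum_(i < size s) F (xi i) * (g (nth b s i) - g (nth b (a :: s) i)) - I|
        < e.

Definition Riemann_Stieltjes F g (a b : R) : R :=
  xget 0 [set I | is_Riemann_Stieltjes F g a b I].

(* The primitive exists, and is unique, exactly for [f] in [Ac]. *)
Definition primitive f : R -> R^o :=
  xget (cst 0) [set F | Bc F /\ f = dist_deriv (regular F)].

Definition cp_integral f (a b : R) : R := primitive f b - primitive f a.

(* Integration by parts defines the integral of [f * g] over [-pi, pi]. *)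
Definition cp_integral_mul f g : R :=
  primitive f pi * g pi - Riemann_Stieltjes (primitive f) g (- pi) pi.

Definition alexiewicz f : R :=
  sup [set r | exists a b : R,
         [/\ a <= b, b - a <= pi *+ 2 & r = `|cp_integral f a b|]].

Definition dist_conv f g : R -> R^o :=
  fun x => cp_integral_mul (dist_reflect x f) g.

Definition conv_dist g f : R -> R^o :=
  fun x => cp_integral_mul f (fun t => g (x - t)).

(* For u and v in L1 the integral converges for almost every x only; the value
   at the other points is irrelevant. *)
Definition L1_conv u v : R -> R^o :=
  fun x => \int[mu]_(t in `[- pi, pi]) (u (x - t) * v t).

(* exp(-int) *)
Definition expNi (n : int) (t : R) : R[i] :=
  Complex (cos (n%:~R * t)) (- sin (n%:~R * t)).

Definition dist_fourier f (n : int) : R[i] :=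
  Complex (cp_integral_mul f (fun t => complex.Re (expNi n t)))
          (cp_integral_mul f (fun t => complex.Im (expNi n t))).

Definition fourier u (n : int) : R[i] :=
  Complex
    (\int[mu]_(t in `[- pi, pi]) complex.Re ((u t)%:C%C * expNi n t))
    (\int[mu]_(t in `[- pi, pi]) complex.Im ((u t)%:C%C * expNi n t)).

End integrals.

Section operators.
Context {R : realType} {X Y : lmodType R}.
Implicit Types (V : set X) (W : set Y) (A : X -> Y).

Definition bounded_linear_operator V (nV : X -> R) W (nW : Y -> R) A :=
  [/\ forall x, V x -> W (A x),
      forall (a : R) x y, V x -> V y -> A (a *: x + y) = a *: A x + A y &
      exists C : R, forall x, V x -> nW (A x) <= C * nV x].

Definition operator_norm V (nV : X -> R) (nW : Y -> R) A : R :=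
  sup [set nW (A x) | x in [set x | V x /\ nV x <= 1]].

End operators.

(* Main.v *)
Require Import Defs.
From HB Require Import structures.
From mathcomp Require Import all_boot all_order all_algebra.
From mathcomp Require Import all_classical all_reals all_analysis.
From mathcomp.real_closed Require Import complex.
From mathcomp Require Import measurable_realfun lra ring.
Import Order.TTheory GRing.Theory Num.Theory.
Import numFieldNormedType.Exports.
Local Open Scope classical_set_scope.
Local Open Scope ring_scope.

(** Let F be the primitive of f. The primitive of t |-> f (x - t) that vanishes at
- pi is F (x + pi) - F (x - t), so (f * g) x is the integral of g against it by parts
([dist_convE]), a quantity bounded by the uniform norm of the primitive times the
norm of g ([parts_integral_le]). This gives the uniform bound on f * g, its
continuity, its linearity in both arguments and its behaviour under translation
of f.

The remaining statements are identities or estimates known for functions. They are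
transported to distributions by density. The difference quotient
p x = (F (x + d) - F x) / d is continuous and periodic, and its primitive is
uniformly close to F for small d ([steklov_approximation]). Integration by parts
turns the Riemann-Stieltjes definition of p * g into the classical convolution
([rs_by_parts]), and this also proves that the Riemann-Stieltjes integrals of
continuous primitives exist, as uniform limits ([Riemann_StieltjesP]). Hence f * g
is uniformly close to p * g ([dist_conv_approx]), and commutativity, associativity
and the estimate of the Alexiewicz norm follow from changes of variables and
Fubini's theorem applied to p * g, with an error tending to 0.

The Fourier coefficients come from associativity: up to sign and constants they are
values at 0 of convolutions with cos (n .) and sin (n .), and convolving g with these
reproduces them with the coefficients of g as weights ([cos_coefficient]).

Two foundations are built first. Primitives of distributions are unique
([primitive_eq]), because a continuous function annihilated by all derivatives of
test functions is constant; this requires a smooth bump function. And elements of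
[L1] are replaced by periodic Borel functions ([L1_borel]), to which Fubini's
theorem applies ([Fubini_rectangle]). *)

Local Strategy opaque [integral].

(** * Translations and reflections preserve Lebesgue measure *)

Section measure_preserving.
Context {R : realType}.
Local Notation mu := (@lebesgue_measure R).

Definition preserves_lebesgue (phi : R -> R) :=
  measurable_fun setT phi /\
  forall A : set R, measurable A -> mu (phi @^-1` A) = mu A.

(** Lebesgue measure is determined by its values on half-open intervals. *)
Lemma preserves_lebesgueP (phi : R -> R) : measurable_fun setT phi ->
  (forall a b, mu (phi @^-1` `]a, b]) = mu `]a, b]%classic) ->
  preserves_lebesgue phi.
Proof.
move=> mphi H; split => // A mA; apply/esym.
pose phi' : measurableTypeR R -> measurableTypeR R := phi.
have mphi' : measurable_fun setT phi' by exact: mphi.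
pose m := pushforward mu phi'.
pose mphi_mixin := isMeasurableFun.Build _ _ _ _ _ mphi'.
pose mphi_pack : {mfun _ >-> _} := HB.pack phi' mphi_mixin.
have := @lebesgue_measure_unique R (pushforward mu mphi_pack).
by apply => // X [[a b] _ <-]; rewrite /pushforward/= -H.
Qed.

Lemma shift_preserves (c : R) : preserves_lebesgue (fun t => t + c).
Proof.
apply: preserves_lebesgueP; first by apply: measurable_funD.
move=> a b; rewrite (_ : _ @^-1` _ = `]a - c, b - c]%classic).
  rewrite !lebesgue_measure_itv/= !lte_fin ltrD2r; case: ifPn => // _.
  by rewrite -!EFinD opprB addrA subrK.
by apply/seteqP; split=> t /=; rewrite !in_itv/= ltrBlDr lerBrDr.
Qed.

Lemma reflect_preserves (c : R) : preserves_lebesgue (fun t => c - t).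
Proof.
apply: preserves_lebesgueP; first by apply: measurable_funB.
move=> a b; rewrite (_ : _ @^-1` _ = `[c - b, c - a[%classic).
  rewrite !lebesgue_measure_itv/= !lte_fin ltrD2l ltrN2; case: ifPn => // _.
  by rewrite -!EFinD; congr EFin; ring.
apply/seteqP; split=> t /=; rewrite !in_itv/=;
  move=> /andP[h1 h2]; apply/andP; split; lra.
Qed.

(** Positive and negative parts are transported separately, so that the identity
also covers divergent integrals. *)
Lemma preserves_integral (phi : R -> R) (D : set R) (f : R -> \bar R) :
  preserves_lebesgue phi -> measurable D -> measurable_fun setT f ->
  (\int[mu]_(x in phi @^-1` D) f (phi x) = \int[mu]_(x in D) f x)%E.
Proof.
move=> [mphi pphi] mD mf.
pose phi' : measurableTypeR R -> measurableTypeR R := phi.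
have mphi' : measurable_fun setT phi' by exact: mphi.
pose mphi_mixin := isMeasurableFun.Build _ _ _ _ _ mphi'.
pose mphi_pack : {mfun _ >-> _} := HB.pack phi' mphi_mixin.
have key (g : R -> \bar R) : measurable_fun setT g -> (forall x, 0 <= g x)%E ->
    (\int[mu]_(x in phi @^-1` D) g (phi x) = \int[mu]_(x in D) g x)%E.
  move=> mg g0.
  have <- := @ge0_integral_pushforward _ _ _ _ R phi' mphi' mu D g mD
    (measurable_funTS mg) (fun y _ => g0 y).
  apply: (@eq_measure_integral _ (measurableTypeR R) R D mu (pushforward mu mphi_pack)) => A mA _.
  exact: pphi.
rewrite integralE [RHS]integralE.
under eq_integral do rewrite (funepos_comp f phi)/=.
under [X in (_ - X)%E = _]eq_integral do rewrite (funeneg_comp f phi)/=.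
congr (_ - _)%E; apply: key => //.
- exact: measurable_funepos.
- exact: measurable_funeneg.
Qed.

Lemma preserves_ae (phi : R -> R) (P : R -> Prop) : preserves_lebesgue phi ->
  {ae mu, forall x, P x} -> {ae mu, forall x, P (phi x)}.
Proof.
move=> [mphi pphi] [N [mN N0 PN]]; exists (phi @^-1` N); split.
- by rewrite -[X in measurable X]setTI; exact: mphi.
- exact: etrans (pphi _ mN) N0.
- by move=> x /= nP; exact: PN.
Qed.

Lemma preserves_integrable (phi : R -> R) (D : set R) (u : R -> R) :
  preserves_lebesgue phi -> measurable D -> measurable_fun setT u ->
  mu.-integrable D (EFin \o u) ->
  mu.-integrable (phi @^-1` D) (EFin \o (u \o phi)).
Proof.
move=> pphi mD mu_ /integrableP[_ ui]; apply/integrableP; split.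
  apply/measurable_EFinP/measurable_funTS; apply: measurableT_comp => //.
  exact: pphi.1.
rewrite -(@preserves_integral phi D (fun x => `|(u x)%:E|%E)) // in ui.
by apply: measurableT_comp => //; exact/measurable_EFinP.
Qed.

End measure_preserving.

(** * Locally integrable functions and their integrals over segments *)

Section locally_integrable_functions.
Context {R : realType}.
Local Notation mu := (@lebesgue_measure R).
Implicit Types (u v : R -> R) (a b c M : R).

(** Measurability on the whole line together with integrability over all
segments: the segments can then be cut, translated and reflected freely. *)
Definition locint u := measurable_fun setT u /\
  forall a b, mu.-integrable `[a, b] (EFin \o u).

Definition bounded_on_line u := exists M, forall x, `|u x| <= M.

Lemma locint_measurable u : locint u -> measurable_fun setT u.
Proof. by case. Qed.

Lemma locint_integrable u a b : locint u -> mu.-integrable `[a, b] (EFin \o u).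
Proof. by case. Qed.

Lemma bounded_integrable u a b M : measurable_fun setT u ->
  (forall x, a <= x <= b -> `|u x| <= M) ->
  mu.-integrable `[a, b] (EFin \o u).
Proof.
move=> mu_ uM.
have fin : (mu `[a, b]%classic < +oo)%E.
  by rewrite lebesgue_measure_itv/=; case: ifPn => // _; rewrite -EFinB ltry.
apply: measurable_bounded_integrable => //.
- exact: measurable_funTS.
- exists M; split; first exact: num_real.
  move=> N MN x /=; rewrite in_itv/= => xab.
  exact: le_trans (uM x xab) (ltW MN).
Qed.

Lemma bounded_locint u : measurable_fun setT u -> bounded_on_line u -> locint u.
Proof.
move=> mu_ [M uM]; split => // a b.
by apply: (@bounded_integrable _ _ _ M) => // x _.
Qed.

Lemma continuous_locint u : continuous u -> locint u.
Proof.
move=> cu; split=> [|a b]; first exact: continuous_measurable_fun.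
apply: continuous_compact_integrable; first exact: segment_compact.
exact: continuous_subspaceT.
Qed.

Lemma locint_cst c : locint (fun=> c).
Proof. by apply: continuous_locint => x; exact: cvg_cst. Qed.

Lemma locintD u v : locint u -> locint v -> locint (fun x => u x + v x).
Proof.
move=> [mu_ iu] [mv iv]; split; first exact: measurable_funD.
by move=> a b; exact: (integrableD _ (iu a b) (iv a b)).
Qed.

Lemma locintN u : locint u -> locint (fun x => - u x).
Proof.
move=> [mu_ iu]; split; first exact: measurable_funN.
by move=> a b; exact: (integrableN (iu a b)).
Qed.

Lemma locintB u v : locint u -> locint v -> locint (fun x => u x - v x).
Proof. by move=> lu lv; apply: locintD => //; exact: locintN. Qed.

Lemma locint_norm u : locint u -> locint (fun x => `|u x|).
Proof.
move=> [mu_ iu]; split; first by apply: measurableT_comp.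
by move=> a b; apply: (integrable_abse (iu a b)).
Qed.

Lemma locintM u v : locint u -> measurable_fun setT v -> bounded_on_line v ->
  locint (fun x => u x * v x).
Proof.
move=> [mu_ iu] mv [M vM]; split; first exact: measurable_funM.
move=> a b; have bv : [bounded v x | x in `[a, b]%classic].
  exists M; split; first exact: num_real.
  by move=> N MN x _; exact: le_trans (vM x) (ltW MN).
exact: (integrableMl _ (iu a b) (measurable_funTS mv) bv).
Qed.

Lemma locintMl u v : locint u -> measurable_fun setT v -> bounded_on_line v ->
  locint (fun x => v x * u x).
Proof.
move=> lu mv bv; under eq_fun do rewrite mulrC; exact: locintM.
Qed.

Lemma locintZ c u : locint u -> locint (fun x => c * u x).
Proof. by move=> lu; apply: locintMl => //; exists `|c|. Qed.

Lemma preimage_shift a b c :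
  (fun t : R => t + c) @^-1` `[a + c, b + c] = `[a, b]%classic.
Proof. by apply/seteqP; split=> x /=; rewrite !in_itv/= !lerD2r. Qed.

Lemma preimage_reflect a b c :
  (fun t : R => c - t) @^-1` `[c - b, c - a] = `[a, b]%classic.
Proof.
by apply/seteqP; split=> x /=; rewrite !in_itv/= !lerD2l !lerN2 andbC.
Qed.

Lemma locint_shift u c : locint u -> locint (fun t => u (t + c)).
Proof.
move=> [mu_ iu]; split.
  by apply: (measurableT_comp mu_); exact: (shift_preserves c).1.
move=> a b; rewrite -(preimage_shift a b c).
exact: (@preserves_integrable _ _ _ u (shift_preserves c) _ mu_ (iu _ _)).
Qed.

Lemma locint_reflect u c : locint u -> locint (fun t => u (c - t)).
Proof.
move=> [mu_ iu]; split.
  by apply: (measurableT_comp mu_); exact: (reflect_preserves c).1.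
move=> a b; rewrite -(preimage_reflect a b c).
exact: (@preserves_integrable _ _ _ u (reflect_preserves c) _ mu_ (iu _ _)).
Qed.

Lemma Rintegral_shift u a b c : measurable_fun setT u ->
  \int[mu]_(t in `[a, b]) u (t + c) = \int[mu]_(t in `[a + c, b + c]) u t.
Proof.
move=> mu_; rewrite /Rintegral -(preimage_shift a b c).
rewrite -(@preserves_integral _ _ _ (EFin \o u) (shift_preserves c))//.
exact/measurable_EFinP.
Qed.

Lemma Rintegral_reflect u a b c : measurable_fun setT u ->
  \int[mu]_(t in `[a, b]) u (c - t) = \int[mu]_(t in `[c - b, c - a]) u t.
Proof.
move=> mu_; rewrite /Rintegral -(preimage_reflect a b c).
rewrite -(@preserves_integral _ _ _ (EFin \o u) (reflect_preserves c))//.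
exact/measurable_EFinP.
Qed.

(** The common endpoint b is a null set. *)
Lemma Rintegral_cat u a b c : locint u -> a <= b -> b <= c ->
  \int[mu]_(t in `[a, c]) u t =
  \int[mu]_(t in `[a, b]) u t + \int[mu]_(t in `[b, c]) u t.
Proof.
move=> lu ab bc.
rewrite -[X in X = _](subrK (\int[mu]_(t in `[a, b]) u t)).
rewrite Rintegral_itvB ?bnd_simp//; last exact: locint_integrable.
rewrite Rintegral_itv_obnd_cbnd; first by rewrite addrC.
apply: (@integrableS _ _ _ mu `[b, c]%classic) => //.
  by apply: subset_itvr; rewrite bnd_simp.
exact: locint_integrable.
Qed.

Lemma Rintegral_xx u a : \int[mu]_(t in `[a, a]) u t = 0.
Proof. by rewrite set_itv1 Rintegral_set1. Qed.

Lemma RintegralM_cst c a b : a <= b -> \int[mu]_(t in `[a, b]) c = c * (b - a).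
Proof.
move=> ab; rewrite Rintegral_cst//= lebesgue_measure_itv/= lte_fin.
by case: ltgtP ab => // -> _; rewrite subrr.
Qed.

Lemma locint_RintegralD u v a b : locint u -> locint v ->
  \int[mu]_(t in `[a, b]) (u t + v t) =
  \int[mu]_(t in `[a, b]) u t + \int[mu]_(t in `[a, b]) v t.
Proof. by move=> lu lv; apply: RintegralD => //; exact: locint_integrable. Qed.

Lemma locint_RintegralB u v a b : locint u -> locint v ->
  \int[mu]_(t in `[a, b]) (u t - v t) =
  \int[mu]_(t in `[a, b]) u t - \int[mu]_(t in `[a, b]) v t.
Proof. by move=> lu lv; apply: RintegralB => //; exact: locint_integrable. Qed.

Lemma locint_RintegralZ c u a b : locint u ->
  \int[mu]_(t in `[a, b]) (c * u t) = c * \int[mu]_(t in `[a, b]) u t.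
Proof. by move=> lu; apply: RintegralZl => //; exact: locint_integrable. Qed.

Lemma locint_RintegralZr c u a b : locint u ->
  \int[mu]_(t in `[a, b]) (u t * c) = \int[mu]_(t in `[a, b]) u t * c.
Proof. by move=> lu; apply: RintegralZr => //; exact: locint_integrable. Qed.

Lemma locint_le_Rintegral u v a b : locint u -> locint v ->
  (forall x, a <= x <= b -> u x <= v x) ->
  \int[mu]_(t in `[a, b]) u t <= \int[mu]_(t in `[a, b]) v t.
Proof.
move=> lu lv uv; apply: le_Rintegral; [by []|exact: locint_integrable|exact: locint_integrable|].
by move=> x /=; rewrite in_itv/=; exact: uv.
Qed.

Lemma locint_norm_Rintegral u a b : locint u ->
  `|\int[mu]_(t in `[a, b]) u t| <= \int[mu]_(t in `[a, b]) `|u t|.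
Proof. by move=> lu; apply: le_normr_Rintegral => //; exact: locint_integrable. Qed.

Lemma norm_Rintegral_le u v a b : locint u -> locint v ->
  (forall x, a <= x <= b -> `|u x| <= v x) ->
  `|\int[mu]_(t in `[a, b]) u t| <= \int[mu]_(t in `[a, b]) v t.
Proof.
move=> lu lv uv; apply: le_trans (locint_norm_Rintegral _ _ _ lu) _.
by apply: locint_le_Rintegral => //; exact: locint_norm.
Qed.

Lemma norm_Rintegral_le_cst u a b M : locint u -> a <= b ->
  (forall x, a <= x <= b -> `|u x| <= M) ->
  `|\int[mu]_(t in `[a, b]) u t| <= M * (b - a).
Proof.
move=> lu ab uM; rewrite -RintegralM_cst//.
by apply: norm_Rintegral_le => //; exact: locint_cst.
Qed.

Lemma le_Rintegral_sub u a b c d : locint u -> (forall x, 0 <= u x) ->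
  c <= a -> a <= b -> b <= d ->
  \int[mu]_(t in `[a, b]) u t <= \int[mu]_(t in `[c, d]) u t.
Proof.
move=> lu u0 ca ab bd; rewrite (@Rintegral_cat u c a d)//; last exact: le_trans bd.
rewrite (@Rintegral_cat u a b d)//.
have h (x y : R) : 0 <= \int[mu]_(t in `[x, y]) u t.
  by apply: Rintegral_ge0 => t _.
by rewrite -[leLHS]add0r lerD// lerDl.
Qed.

Lemma eq_Rintegral_itv u v a b : (forall x, a <= x <= b -> u x = v x) ->
  \int[mu]_(t in `[a, b]) u t = \int[mu]_(t in `[a, b]) v t.
Proof.
by move=> uv; apply: eq_Rintegral => x; rewrite inE/= in_itv/=; exact: uv.
Qed.

(** Translates between the extended real integrals, in which Tonelli's theorem
is phrased, and the real ones. *)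
Lemma locint_integralE u a b : locint u ->
  (\int[mu]_(t in `[a, b]) (u t)%:E = (\int[mu]_(t in `[a, b]) u t)%:E)%E.
Proof.
move=> lu; rewrite /Rintegral fineK//; apply: integrable_fin_num => //.
exact: locint_integrable.
Qed.

End locally_integrable_functions.

(** * Integrals of almost everywhere equal functions *)

Section almost_everywhere.
Context {R : realType}.
Local Notation mu := (@lebesgue_measure R).
Import HBNNSimple.

Lemma ae_imply (P Q : R -> Prop) : (forall x, P x -> Q x) ->
  {ae mu, forall x, P x} -> {ae mu, forall x, Q x}.
Proof.
move=> PQ [N [mN N0 nP]]; exists N; split=> // x /= nQ.
by apply: nP => /= /PQ.
Qed.

Lemma ae_and (P Q : R -> Prop) : {ae mu, forall x, P x} ->
  {ae mu, forall x, Q x} -> {ae mu, forall x, P x /\ Q x}.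
Proof.
move=> aP aQ.
exact: (@filterI _ _ (ae_filter_ringOfSetsType mu) _ _ aP aQ).
Qed.

(** An integral of a nonnegative function is a supremum over the simple functions
below it. Cutting such a function off on the null set N leaves its integral unchanged
and brings it from below f to below g. Nonmeasurable f and g are thus covered. *)
Lemma ge0_le_integral_ae (f g : R -> \bar R) (N : set R) :
  (forall x, 0 <= f x)%E -> (forall x, 0 <= g x)%E ->
  measurable N -> mu N = 0%E -> (forall x, ~ N x -> f x <= g x)%E ->
  (\int[mu]_x f x <= \int[mu]_x g x)%E.
Proof.
move=> f0 g0 mN N0 fg; rewrite !ge0_integralTE//.
apply: ge_ereal_sup => _ /= [h hf <-]; apply: ereal_sup_ubound.
have mNC := measurableC mN.
(* h cut off on N *)
exists (proj_nnsfun h mNC).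
  move=> x; rewrite /= mindicE.
  have [/set_mem xN|/negP xN] := boolP (x \in ~` N).
    by rewrite mulr1; apply: le_trans (fg _ xN).
  by rewrite mulr0.
have E (k : {nnsfun measurableTypeR R >-> R}) :
    sintegral mu k = (\int[mu]_x (k x)%:E)%E.
  by rewrite integral_nnsfun// patch_setT.
rewrite !E; apply: ge0_ae_eq_integral => //.
- exact/measurable_EFinP/measurable_funP.
- exact/measurable_EFinP/measurable_funP.
- by move=> ? _; rewrite lee_fin.
- by move=> ? _; rewrite lee_fin.
- exists N; split => // x /= /not_implyP[_]; apply: contra_notP => xN.
  by rewrite /= mindicE mem_set// mulr1.
Qed.

Lemma ge0_le_integral_any (D : set R) (f g : R -> \bar R) :
  (forall x, D x -> 0 <= f x)%E -> (forall x, D x -> f x <= g x)%E ->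
  (\int[mu]_(x in D) f x <= \int[mu]_(x in D) g x)%E.
Proof.
move=> f0 fg; rewrite integral_mkcond [leRHS]integral_mkcond.
have h x : (0 <= (f \_ D) x /\ (f \_ D) x <= (g \_ D) x)%E.
  rewrite !patchE; case: ifPn => [/set_mem Dx|_]; last by [].
  by split; [exact: f0|exact: fg].
apply: (@ge0_le_integral_ae _ _ set0) => // x.
- exact: (h x).1.
- exact: le_trans (h x).1 (h x).2.
- by move=> _; exact: (h x).2.
Qed.

Let ae_eq_integral_ge0 (f g : R -> \bar R) (N : set R) :
  (forall x, 0 <= f x)%E -> (forall x, 0 <= g x)%E ->
  measurable N -> mu N = 0%E -> (forall x, ~ N x -> f x = g x) ->
  (\int[mu]_x f x = \int[mu]_x g x)%E.
Proof.
move=> f0 g0 mN N0 fg; apply/eqP; rewrite eq_le.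
by rewrite !(ge0_le_integral_ae _ _ N)// => x xN; rewrite fg.
Qed.

(** The elements of [L1] are only almost everywhere equal to Borel functions; this
is what allows them to be replaced by Borel functions under the integral sign. *)
Lemma ae_eq_integral_any (D : set R) (f g : R -> \bar R) :
  {ae mu, forall x, f x = g x} ->
  (\int[mu]_(x in D) f x = \int[mu]_(x in D) g x)%E.
Proof.
move=> [N [mN N0 fgN]].
have fg x : ~ N x -> f x = g x by apply: contra_notP => fgx; exact: fgN.
rewrite integral_mkcond [RHS]integral_mkcond integralE [RHS]integralE.
congr (_ - _)%E; apply: (@ae_eq_integral_ge0 _ _ N) => // x xN.
  by rewrite !unlock /patch; case: ifP => // _; rewrite fg.
by rewrite !unlock /patch; case: ifP => // _; rewrite fg.
Qed.

Lemma ae_eq_Rintegral (D : set R) (u v : R -> R) :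
  {ae mu, forall x, u x = v x} ->
  \int[mu]_(x in D) u x = \int[mu]_(x in D) v x.
Proof.
move=> uv; congr fine; apply: ae_eq_integral_any.
by apply: ae_imply uv => x ->.
Qed.

End almost_everywhere.

(** * Integrals over a period *)

Section periodic_functions.
Context {R : realType}.
Local Notation mu := (@lebesgue_measure R).
Local Notation tau := (pi *+ 2 : R).
Implicit Types u v : R -> R.

Lemma tau_gt0 : 0 < tau.
Proof. by rewrite mulrn_wgt0 ?pi_gt0. Qed.

Lemma tauE : tau = pi + pi. Proof. by rewrite mulr2n. Qed.

(** The index of the period containing x, the period [-pi, pi[ having index 0. *)
Definition turn (x : R) : int := Num.floor ((x + pi) / tau).

Lemma turnP x : - pi <= x - (turn x)%:~R * tau < pi.
Proof.
have t0 := tau_gt0.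
have /andP[h1 h2] := floor_itv ((x + pi) / tau).
rewrite -/(turn x) ler_pdivlMr// ltr_pdivrMr// in h1 h2.
by move: h1 h2; rewrite intrD tauE; set n := (turn x)%:~R => h1 h2; apply/andP; split; lra.
Qed.

Lemma periodicz u : periodic u tau -> forall (n : int) x, u (x + n%:~R * tau) = u x.
Proof.
move=> pu [n|n] x.
  by rewrite -pmulrn [_ * tau]mulr_natl (periodicn pu n x).
rewrite NegzE mulrNz mulNr -pmulrn [_ * tau]mulr_natl.
by rewrite -(periodicn pu n.+1 (x - tau *+ n.+1)) subrK.
Qed.

Lemma periodic_turn u : periodic u tau ->
  forall x, u x = u (x - (turn x)%:~R * tau).
Proof. by move=> pu x; rewrite -mulNr -mulrNz periodicz. Qed.

Lemma periodic_shift u c : periodic u tau -> periodic (fun t => u (t + c)) tau.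
Proof. by move=> pu x; rewrite addrAC pu. Qed.

Lemma periodic_reflect u c : periodic u tau -> periodic (fun t => u (c - t)) tau.
Proof. by move=> pu x; rewrite -[LHS]pu; congr u; ring. Qed.

(** Translate the interval so that it starts in [-pi, pi[, cut it at pi, and move
the part beyond pi back by one period. *)
Lemma Rintegral_period u a : locint u -> periodic u tau ->
  \int[mu]_(t in `[a, a + tau]) u t = \int[mu]_(t in `[- pi, pi]) u t.
Proof.
move=> lu pu; have mu_ := locint_measurable _ lu.
pose z := (turn a)%:~R * tau.
have /andP[h1 h2] := turnP a; rewrite -/z in h1 h2.
have shiftz (n : int) x y : \int[mu]_(t in `[x + n%:~R * tau, y + n%:~R * tau]) u t =
    \int[mu]_(t in `[x, y]) u t.
  rewrite -(Rintegral_shift _ _ _ _ mu_); apply: eq_Rintegral_itv => t _.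
  by rewrite periodicz.
have t0 := tau_gt0.
have e : a = (a - z) + z by rewrite subrK.
rewrite {1 2}e [_ + z + tau]addrAC shiftz.
set b := a - z in h1 h2 *.
rewrite (@Rintegral_cat _ u b pi) ?(ltW h2)//; last by rewrite tauE; lra.
rewrite (@Rintegral_cat _ u (- pi) b pi) ?(ltW h2)// [RHS]addrC; congr (_ + _).
have := shiftz 1 (- pi) b; rewrite mul1r => <-.
have -> : - pi + tau = pi by rewrite tauE addKr.
by [].
Qed.

Lemma Rintegral_reflect_period u c : locint u -> periodic u tau ->
  \int[mu]_(t in `[- pi, pi]) u (c - t) = \int[mu]_(t in `[- pi, pi]) u t.
Proof.
move=> lu pu; rewrite (Rintegral_reflect _ _ _ _ (locint_measurable _ lu)) opprK.
rewrite -[RHS](Rintegral_period _ (c - pi) lu pu).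
by have -> : c - pi + tau = c + pi by rewrite tauE; ring.
Qed.

Lemma Rintegral_shift_period u c : locint u -> periodic u tau ->
  \int[mu]_(t in `[- pi, pi]) u (t + c) = \int[mu]_(t in `[- pi, pi]) u t.
Proof.
move=> lu pu; rewrite (Rintegral_shift _ _ _ _ (locint_measurable _ lu)).
rewrite -[RHS](Rintegral_period _ (- pi + c) lu pu).
have -> : - pi + c + tau = pi + c by rewrite tauE; ring.
by [].
Qed.

(** A Borel representative of a class in [L1] need not be periodic everywhere; the
one that copies its values on [-pi, pi[ to all the other periods is. *)
Lemma L1_borel (u : R -> R^o) : L1 u -> exists v : R -> R,
  [/\ locint v, periodic v tau & {ae mu, forall x, u x = v x}].
Proof.
move=> [pu [w [mw _ lw] uw]].
pose r (x : R) := x - (turn x)%:~R * tau.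
have t0 := tau_gt0.
have mr : measurable_fun setT r.
  apply: measurable_funB => //; apply: measurable_funM => //.
  apply: nondecreasing_measurable => // x y xy.
  rewrite ler_int; apply: le_floor; rewrite ler_pM2r ?invr_gt0//.
  by rewrite lerD2r.
have uwr : {ae mu, forall x, u x = w (r x)}.
  (* two natural numbers encode a translation by an integer number of periods *)
  pose P (k l : nat) (x : R) := u (x + (l%:R * tau - k%:R * tau)) =
                                w (x + (l%:R * tau - k%:R * tau)).
  have Pn k l : mu.-negligible (~` [set x | P k l x]).
    exact: (@preserves_ae _ _ (fun x => u x = w x) (shift_preserves _) uw).
  have := negligible_bigcup (fun k => negligible_bigcup (Pn k)).
  apply: negligibleS => x /= nx.
  have [k [l rE]] : exists k l : nat, r x = x + (l%:R * tau - k%:R * tau).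
    rewrite /r; case: (turn x) => k; [exists k, 0%N|exists 0%N, k.+1].
      by rewrite -pmulrn mul0r sub0r.
    by rewrite mul0r subr0 NegzE mulrNz mulNr opprK -pmulrn.
  exists k => //; exists l => //= uwx; apply: nx.
  by rewrite (periodic_turn _ pu x) -/(r x) rE.
exists (w \o r); split.
- have mv : measurable_fun setT (w \o r) by exact: measurableT_comp.
  split=> // a b; apply/integrableP; split; first exact/measurable_EFinP/measurable_funTS.
  have := lw `[a, b]%classic (fun _ _ => I) (@segment_compact _ a b).
  rewrite (_ : (\int[mu]_(x in _) _ = \int[mu]_(x in `[a, b]) `|((w \o r) x)%:E|)%E)//.
  apply: ae_eq_integral_any; apply: ae_imply (ae_and _ _ uw uwr) => x [h1 h2] /=.
  by rewrite -h1 -h2.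
- move=> x /=; congr w; rewrite /r /turn.
  have -> : (x + tau + pi) / tau = (x + pi) / tau + 1.
    by rewrite addrAC mulrDl divff// gt_eqF.
  by rewrite floorDrz// floor1 intrD; ring.
- exact: uwr.
Qed.

End periodic_functions.

(** * Fubini's theorem on rectangles *)

Section fubini_on_rectangles.
Context {R : realType}.
Local Notation mu := (@lebesgue_measure R).
Local Notation mR := (measurableTypeR R).

Lemma integrable_locint (u : R -> R) :
  (forall a b, mu.-integrable `[a, b] (EFin \o u)) -> locint u.
Proof.
move=> iu; split => //.
have := @measurable_fun_bigcup _ _ mR R (fun n : nat => `[- n%:R, n%:R]%classic) u.
move=> /(_ (fun i => measurable_itv _))[_] H.
rewrite (_ : setT = \bigcup_(n : nat) `[- n%:R, n%:R]%classic); last first.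
  apply/seteqP; split=> // x _.
  exists (Num.truncn `|x|).+1 => //=; rewrite in_itv/=.
  by rewrite -ler_norml ltW// truncnS_gt.
by apply: H => n; move: (measurable_int mu (iu (- n%:R) n%:R)) => /measurable_EFinP.
Qed.

(** An integrable extended real function is finite almost everywhere, so passing to
its real values affects neither integrability nor the integral. It applies to
the inner integrals of Fubini's theorem, which may diverge on a null set. *)
Lemma integrable_fine (D : set R) (F : R -> \bar R) : measurable D ->
  mu.-integrable D F -> mu.-integrable D (EFin \o (fine \o F)) /\
  (\int[mu]_(x in D) (fine (F x))%:E = \int[mu]_(x in D) F x)%E.
Proof.
move=> mD iF; have mF := measurable_int mu iF.
have mf : measurable_fun D (EFin \o (fine \o F)).
  by apply/measurable_EFinP; apply: measurableT_comp.
split; last first.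
  apply: ae_eq_integral => //.
  have [N [mN N0 FN]] := integrable_ae (mD : @measurable _ mR D) iF.
  exists N; split => // x /= /not_implyP[Dx FxE]; apply: FN => /= H.
  by apply: FxE; rewrite fineK// H.
apply: le_integrable iF => // x _ /=.
by case: (F x) => [r| |]//=; rewrite normr0 leey.
Qed.

(** Fubini's theorem for K cut off outside the rectangle. The domination by G
bounds the iterated integral of |K|, hence makes K integrable. *)
Lemma Fubini_rectangle (K : R * R -> R) (G : R -> R) (a b c d : R) :
  measurable_fun [set: mR * mR] (K : mR * mR -> R) ->
  mu.-integrable `[c, d] (EFin \o G) ->
  (forall y, c <= y <= d ->
    (\int[mu]_(x in `[a, b]) `|K (x, y)|%:E <= (G y)%:E)%E) ->
  mu.-integrable `[a, b] (EFin \o fun x => \int[mu]_(y in `[c, d]) K (x, y)) /\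
  \int[mu]_(x in `[a, b]) (\int[mu]_(y in `[c, d]) K (x, y)) =
  \int[mu]_(y in `[c, d]) (\int[mu]_(x in `[a, b]) K (x, y)).
Proof.
move=> mK iG KG.
pose I : R -> R := \1_(`[a, b]%classic).
pose J : R -> R := \1_(`[c, d]%classic).
pose H (z : mR * mR) : \bar R := (K z * I z.1 * J z.2)%:E.
have mH : measurable_fun setT H.
  apply/measurable_EFinP/measurable_funM; [apply: measurable_funM => //|].
  - by apply: measurableT_comp => //; exact: measurable_indic.
  - by apply: measurableT_comp => //; exact: measurable_indic.
have HE1 (L : R * R -> R) x : (\int[mu]_y (L (x, y) * I x * J y)%:E =
    (I x)%:E * \int[mu]_(y in `[c, d]) (L (x, y))%:E)%E.
  rewrite [in RHS]integral_mkcond /I indicE; case: (x \in _).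
    rewrite mul1e; apply: eq_integral => y _.
    by rewrite mulr1 /J indicE patchE; case: ifP; rewrite ?mulr1 ?mulr0.
  by rewrite mul0e; under eq_integral do rewrite mulr0 mul0r; rewrite integral0.
have HE2 (L : R * R -> R) y : (\int[mu]_x (L (x, y) * I x * J y)%:E =
    (J y)%:E * \int[mu]_(x in `[a, b]) (L (x, y))%:E)%E.
  rewrite [in RHS]integral_mkcond /J indicE; case: (y \in _).
    rewrite mul1e; apply: eq_integral => x _.
    by rewrite mulr1 /I indicE patchE; case: ifP; rewrite ?mulr1 ?mulr0.
  by rewrite mul0e; under eq_integral do rewrite mulr0; rewrite integral0.
have ind (A : set R) (F : R -> \bar R) :
    (\int[mu]_x ((\1_A x : R)%:E * F x) = \int[mu]_(x in A) F x)%E.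
  rewrite [RHS]integral_mkcond; apply: eq_integral => x _.
  by rewrite indicE patchE; case: ifP; rewrite ?mul1e ?mul0e.
have I0 x : 0 <= I x by rewrite /I indicE.
have J0 x : 0 <= J x by rewrite /J indicE.
have iH : (mu \x mu)%E.-integrable setT H.
  apply/(integrable21ltyP _ _ mH).
  have -> : (\int[mu]_y \int[mu]_x `|H (x, y)| =
      \int[mu]_y ((J y)%:E * \int[mu]_(x in `[a, b]) `|K (x, y)|%:E))%E.
    apply: eq_integral => y _; rewrite -(HE2 (fun z => `|K z|)).
    apply: eq_integral => x _; rewrite /H/= !normrM.
    by rewrite (ger0_norm (I0 x)) (ger0_norm (J0 y)).
  apply: (@le_lt_trans _ _ (\int[mu]_(y in `[c, d]) `|G y|%:E)%E); last first.
    by have /integrableP[] := iG.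
  rewrite -[leRHS]ind; apply: (@ge0_le_integral_ae _ _ _ set0) => //.
  - move=> y; apply: mule_ge0; first by rewrite lee_fin.
    by apply: integral_ge0 => x _; rewrite lee_fin.
  - move=> y _; rewrite /J indicE.
    have [/set_mem/=|_] := boolP (y \in _); last by rewrite !mul0e.
    rewrite in_itv/= !mul1e => ycd; apply: le_trans (KG y ycd) _.
    by rewrite lee_fin ler_norm.
have [i1 e1] := integrable_fine _ _ (@measurableT _ mR) (integrable_fubini_F iH).
have iG' : mu.-integrable setT (fubini_G mu H).
  apply/integrableP; split; first by move: (measurable_fubini_G iH).
  apply: le_lt_trans ((integrable21ltyP _ _ mH).1 iH).
  apply: (@ge0_le_integral_ae _ _ _ set0) => //.
    by move=> y; apply: integral_ge0 => x _; exact: abse_ge0.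
  move=> y _; apply: (@le_abse_integral _ mR R mu setT (fun x => H (x, y)) measurableT).
  exact: measurable_fun_pair1 mH.
have [i2 e2] := integrable_fine _ _ (@measurableT _ mR) iG'.
have F1 x : `[a, b]%classic x ->
    \int[mu]_(y in `[c, d]) K (x, y) = fine (fubini_F mu H x).
  by move=> xab; rewrite /fubini_F (HE1 K) /I indicE mem_set// mul1e.
have F2 y : `[c, d]%classic y ->
    \int[mu]_(x in `[a, b]) K (x, y) = fine (fubini_G mu H y).
  by move=> xab; rewrite /fubini_G (HE2 K) /J indicE mem_set// mul1e.
split.
  apply: (@eq_integrable _ _ _ mu _ _ (EFin \o (fine \o fubini_F mu H))) => //.
    by move=> x /set_mem xab /=; rewrite F1.
  by apply: (@integrableS _ _ _ mu setT).
have -> : \int[mu]_(x in `[a, b]) (\int[mu]_(y in `[c, d]) K (x, y)) =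
    \int[mu]_x fine (fubini_F mu H x).
  rewrite Rintegral_mkcond; apply: eq_Rintegral => x _; rewrite patchE.
  case: ifPn => [/set_mem/F1->//|xab]; rewrite /fubini_F (HE1 K) /I indicE.
  by rewrite (negbTE xab) mul0e.
have -> : \int[mu]_(y in `[c, d]) (\int[mu]_(x in `[a, b]) K (x, y)) =
    \int[mu]_y fine (fubini_G mu H y).
  rewrite Rintegral_mkcond; apply: eq_Rintegral => y _; rewrite patchE.
  case: ifPn => [/set_mem/F2->//|ycd]; rewrite /fubini_G (HE2 K) /J indicE.
  by rewrite (negbTE ycd) mul0e.
by rewrite /Rintegral e1 e2 (Fubini iH).
Qed.

End fubini_on_rectangles.

(** * A smooth bump function *)

Section smooth_bump.
Context {R : realType}.
Implicit Types (u v : R -> R^o) (x : R).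

Inductive lin_span (S : (R -> R^o) -> Prop) : (R -> R^o) -> Prop :=
| lin_span_base u : S u -> lin_span S u
| lin_span_comb (a : R) u v : lin_span S u -> lin_span S v ->
    lin_span S (fun x => a * u x + v x).

(** All derivatives are obtained by iterating the single step in the hypothesis,
which extends from S to its linear span. *)
Lemma smooth_span (S : (R -> R^o) -> Prop) :
  (forall u, S u -> exists2 u' : R -> R^o, lin_span S u' &
    forall x, is_derive x (1 : R) u (u' x)) ->
  forall u, lin_span S u -> smooth u.
Proof.
move=> Sd.
have step u : lin_span S u -> exists2 u' : R -> R^o, lin_span S u' &
    forall x, is_derive x (1 : R) u (u' x).
  elim=> [{}u /Sd//|a {}u v _ [u' Su' du] _ [v' Sv' dv]].
  exists (fun x => a * u' x + v' x); first exact: lin_span_comb.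
  move=> x; have h1 := @is_deriveZ _ _ _ u a x 1 _ (du x).
  exact: (@is_deriveD _ _ _ _ _ x 1 _ _ h1 (dv x)).
have all n u : lin_span S u -> lin_span S (derive1n n u).
  move=> Su; elim: n => [//|n /step[u' Su' du]]; rewrite derive1nS.
  rewrite (_ : derive1 _ = u')//; apply/funext => x.
  by rewrite derive1E; apply: derive_val; exact: du.
move=> u Su n x; have [u' _ du] := step _ (all n u Su).
by case: (du x).
Qed.

Lemma smooth_derivable u x : smooth u -> is_derive x (1 : R) u (derive1 u x).
Proof. by move=> su; apply: DeriveDef; [exact: (su 0%N)|rewrite derive1E]. Qed.

Lemma smooth_derive1 u : smooth u -> smooth (derive1 u).
Proof. by move=> su n x; rewrite -derive1Sn; exact: su. Qed.

Lemma smooth_primitive u : (forall x, derivable u x (1 : R)) ->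
  smooth (derive1 u) -> smooth u.
Proof. by move=> du su [//|n] x; rewrite derive1Sn; exact: su. Qed.

Lemma smooth_affine (s c : R) u : smooth u -> smooth (fun x => u (s * x + c)).
Proof.
move=> su n x; rewrite derive1n_affine//.
by have [] := is_derive_affine n s c x su.
Qed.

(** The products of two smooth functions have, by Leibniz' rule, derivatives in
their own span. *)
Lemma smoothM u v : smooth u -> smooth v -> smooth (fun x => u x * v x : R^o).
Proof.
move=> su sv; pose S (w : R -> R^o) := exists (p q : R -> R^o),
  [/\ smooth p, smooth q & w = (fun x => p x * q x)].
apply: (@smooth_span S); last by apply: lin_span_base; exists u, v.
move=> _ [p [q [sp sq ->]]].
exists (fun x => 1 * (p x * derive1 q x) + (q x * derive1 p x)).
  apply: lin_span_comb; apply: lin_span_base.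
    by exists p, (derive1 q); split; [by []|exact: smooth_derive1|by []].
  by exists q, (derive1 p); split; [by []|exact: smooth_derive1|by []].
move=> x; rewrite mul1r.
exact: (@is_deriveM _ _ p q x 1 _ _ (smooth_derivable p x sp) (smooth_derivable q x sq)).
Qed.

(** The function x^(-k) exp(-1/x), extended by 0 to the left of the origin. The
span of these functions is stable under differentiation. *)
Definition flat (k : nat) : R -> R :=
  fun x => if 0 < x then x^-1 ^+ k * expR (- x^-1) else 0.

Lemma flat_ge0 k x : 0 <= flat k x.
Proof.
rewrite /flat; case: ifPn => // x0.
by rewrite mulr_ge0 ?expR_ge0// exprn_ge0// invr_ge0 ltW.
Qed.

(** The exponential series gives y^(k+1) / (k+1)! <= exp y, used at y = 1/x. *)
Lemma flat_le k x : flat k x <= k.+1`!%:R * `|x|.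
Proof.
rewrite /flat; case: ifPn => [x0|_]; last by rewrite mulr_ge0.
have y0 : 0 < x^-1 by rewrite invr_gt0.
have := expR_ge1Dxn k (ltW y0); set y := x^-1 in y0 *.
have f0 : 0 < k.+1`!%:R :> R by rewrite ltr0n fact_gt0.
have -> : `|x| = y^-1 by rewrite gtr0_norm ?invrK.
move=> h; rewrite expRN ler_pdivrMr ?expR_gt0// mulrAC ler_pdivlMr//.
rewrite -exprSr -ler_pdivrMl// mulrC.
by apply: le_trans h; rewrite lerDr.
Qed.

(** At 0 the difference quotient of [flat k] is [flat k.+1], which tends to 0 by
[flat_le]. *)
Lemma flat_is_derive k x :
  is_derive x (1 : R) (flat k : R -> R^o)
    (- k%:R * flat k.+1 x + flat k.+2 x : R).
Proof.
have [x0|x0|->] := ltgtP x 0.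
- have -> : - k%:R * flat k.+1 x + flat k.+2 x = 0.
    by rewrite /flat ltNge ltW//= mulr0 addr0.
  have C : is_derive x (1 : R) (cst 0 : R -> R^o) 0 by exact: is_derive_cst.
  apply: (near_eq_is_derive _ C).
  near=> z; rewrite /flat ifF//; apply/negbTE; rewrite -leNgt ltW//.
  by near: z; exact: lt_nbhsl.
- rewrite {2 3}/flat x0.
  apply: (@near_eq_is_derive _ _ _
    ((fun y : R => y ^+ k * expR (- y) : R^o) \o (fun z : R => z^-1))).
    near=> z; rewrite /flat ifT//=.
    by near: z; exact: lt_nbhsr.
  have d1 : is_derive x (1 : R) (fun z : R => z^-1 : R^o) (- x ^- 2).
    have := @is_deriveV _ id x 1 1 (lt0r_neq0 x0) (is_derive_id _ _).
    by move=> h; apply: (is_derive_eq h); rewrite -[LHS]/(_ * 1) mulr1.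
  have d2 (y : R) : is_derive y (1 : R) (fun y : R => y ^+ k * expR (- y) : R^o)
      (y ^+ k * - expR (- y) + expR (- y) * (k%:R * y ^+ k.-1) : R).
    have dX : is_derive y (1 : R) (fun y : R => y ^+ k : R^o) (k%:R * y ^+ k.-1 : R).
      by apply: DeriveDef; [exact: exprn_derivable|rewrite exp_derive scaler1].
    have dE : is_derive y (1 : R) (fun y : R => expR (- y) : R^o) (- expR (- y) : R).
      have dN : is_derive y (1 : R) (fun y : R => - y : R^o) (- 1 : R).
        exact: is_deriveN.
      have h := is_derive1_comp (is_derive_expR (- y)) dN.
      by apply: (is_derive_eq h); rewrite -[LHS]/(_ * -1) mulrN1.
    exact: (@is_deriveM _ _ (fun y : R => y ^+ k : R^o) (fun y : R => expR (- y) : R^o)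
              y 1 _ _ dX dE).
  have e (y : R) : (y ^+ k * - expR (- y) + expR (- y) * (k%:R * y ^+ k.-1)) * - (y ^+ 2) =
      - k%:R * (y ^+ k.+1 * expR (- y)) + y ^+ k.+2 * expR (- y).
    by case: k {d2} => [|k] /=; rewrite ?exprS; ring.
  have h := is_derive1_comp (d2 x^-1) d1; apply: (is_derive_eq h).
  by rewrite -e [in RHS](exprVn x 2).
- have flat0 n : flat n 0 = 0 by rewrite /flat ltxx.
  rewrite !flat0 mulr0 addr0.
  apply/is_derive1_caratheodory; exists (flat k.+1); split; last exact: flat0.
  + move=> z; rewrite flat0 !subr0 /flat; case: ifPn => z0; last by rewrite mul0r.
    by rewrite exprSr mulrAC divfK// gt_eqF.
  + apply/cvgrPdist_le => e e0; near=> z.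
    rewrite flat0 sub0r normrN ger0_norm; last exact: flat_ge0.
    apply: le_trans (flat_le _ _) _.
    rewrite -ler_pdivlMl ?ltr0n ?fact_gt0//.
    near: z; apply: (@cvgr0_norm_le _ _ _ (nbhs (0 : R)) _ (id : R -> R)) => //.
    by rewrite mulr_gt0// invr_gt0 ltr0n fact_gt0.
Unshelve. all: by end_near. Qed.

Lemma flat_smooth k : smooth (flat k : R -> R^o).
Proof.
apply: (@smooth_span (fun u => exists k, u = flat k :> (R -> R))); last first.
  by apply: lin_span_base; exists k.
move=> _ [{}k ->]; exists (fun x => (- k%:R) * flat k.+1 x + flat k.+2 x).
  by apply: lin_span_comb; apply: lin_span_base; [exists k.+1|exists k.+2].
exact: flat_is_derive.
Qed.

Definition smooth_bump : R -> R := fun x => flat 0 x * flat 0 (1 - x).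

Lemma smooth_bump_smooth : smooth (smooth_bump : R -> R^o).
Proof.
apply: smoothM; first exact: flat_smooth.
have := smooth_affine (-1) 1 _ (flat_smooth 0).
by under eq_fun do rewrite mulN1r addrC.
Qed.

Lemma smooth_bump_ge0 x : 0 <= smooth_bump x.
Proof. by rewrite mulr_ge0 ?flat_ge0. Qed.

Lemma smooth_bump_gt0 x : 0 < x < 1 -> 0 < smooth_bump x.
Proof.
move=> /andP[x0 x1]; rewrite /smooth_bump /flat x0 subr_gt0 x1 !expr0 !mul1r.
by rewrite mulr_gt0 ?expR_gt0.
Qed.

Lemma smooth_bump_eq0 x : ~~ (0 < x < 1) -> smooth_bump x = 0.
Proof.
rewrite negb_and -!leNgt /smooth_bump /flat subr_gt0 => /orP[x0|x1].
  by rewrite ltNge x0 /= mul0r.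
by rewrite [X in _ * (if X then _ else _)]ltNge x1 /= mulr0.
Qed.

End smooth_bump.

(** * Integration by parts against test functions *)

Section integrals_against_test_functions.
Context {R : realType}.
Local Notation mu := (@lebesgue_measure R).
Implicit Types (phi : test_function R) (F G u : R -> R).

Lemma Rintegral_support (D : set R) u a b : `[a, b] `<=` D ->
  (forall x, ~~ (a <= x <= b) -> u x = 0) ->
  \int[mu]_(x in D) u x = \int[mu]_(x in `[a, b]) u x.
Proof.
move=> abD u0; rewrite Rintegral_mkcond [RHS]Rintegral_mkcond.
apply: eq_Rintegral => x _; rewrite !patchE.
have [/set_mem xab|xab] := boolP (x \in `[a, b]%classic).
  by rewrite mem_set//; exact: abD.
rewrite (u0 x) ?if_same//; apply: contra xab => xab.
by rewrite mem_setE in_itv.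
Qed.

Lemma Rintegral_eq0 (D : set R) u : (forall x, D x -> u x = 0) ->
  \int[mu]_(x in D) u x = 0.
Proof.
move=> u0; rewrite /Rintegral integral0_eq// => x Dx.
by rewrite u0.
Qed.

Lemma Rintegral_cut_r u a b s : a <= s <= b ->
  \int[mu]_(x in `[a, b]) (if x <= s then u x else 0) =
  \int[mu]_(x in `[a, s]) u x.
Proof.
move=> /andP[as_ sb]; rewrite [LHS]Rintegral_mkcond [RHS]Rintegral_mkcond.
apply: eq_Rintegral => x _; rewrite !patchE !mem_setE !in_itv/=.
have [xs|sx] := leP x s; last by rewrite andbF if_same.
by rewrite (le_trans xs sb) andbT.
Qed.

Lemma Rintegral_cut_l u a b s : a <= s <= b ->
  \int[mu]_(x in `[a, b]) (if s <= x then u x else 0) =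
  \int[mu]_(x in `[s, b]) u x.
Proof.
move=> /andP[as_ sb]; rewrite [LHS]Rintegral_mkcond [RHS]Rintegral_mkcond.
apply: eq_Rintegral => x _; rewrite !patchE !mem_setE !in_itv/=.
have [xs|sx] := leP s x; last by rewrite if_same.
by rewrite (le_trans as_ xs).
Qed.

Lemma continuous_bounded_itv u a b : continuous u ->
  exists M, forall x, a <= x <= b -> `|u x| <= M.
Proof.
move=> cu; have := @segment_compact R a b.
move=> /(continuous_compact (continuous_subspaceT cu))/compact_bounded.
move=> [M [Mr uM]]; exists (M + 1) => x xab.
by apply: (uM (M + 1)); [rewrite ltrDl|exists x => //=; rewrite in_itv].
Qed.

Lemma test_smooth phi : smooth phi.
Proof. by have /test_predP[] := test_funP phi. Qed.

Lemma test_continuous phi : continuous phi.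
Proof.
move=> x; apply: differentiable_continuous; apply/derivable1_diffP.
exact: (test_smooth phi 0%N).
Qed.

Lemma test_support0 phi :
  exists2 M : R, 0 < M & forall x, ~~ (- M <= x <= M) -> phi x = 0.
Proof.
have /test_predP[_ /compactly_supportedP[K cK K0]] := test_funP phi.
have [M [Mr KM]] := compact_bounded cK.
exists (`|M| + 1); first by rewrite ltr_wpDl.
move=> x xM; apply: K0 => Kx; move/negP: xM; apply; rewrite -ler_norml.
by apply: (KM (`|M| + 1)) => //; rewrite ltr_pwDr// ler_norm.
Qed.

Lemma test_support phi : exists2 M : R, 0 < M &
  forall x, ~~ (- M < x < M) -> phi x = 0 /\ test_deriv phi x = 0.
Proof.
have [M M0 hM] := test_support0 phi; have [N N0 hN] := test_support0 (test_deriv phi).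
have h x : ~~ (- (M + N) < x < M + N) -> ~~ (- M <= x <= M) /\ ~~ (- N <= x <= N).
  rewrite -!ler_norml -ltr_norml -leNgt => h.
  by rewrite -!ltNge; split; apply: lt_le_trans h; rewrite ?ltrDl ?ltrDr.
by exists (M + N); [exact: addr_gt0|move=> x /h[/hM -> /hN ->]].
Qed.

Lemma test_bounded phi : bounded_on_line phi.
Proof.
have [M _ phi0] := test_support0 phi.
have [N phiN] := continuous_bounded_itv phi (- M) M (@test_continuous phi).
exists `|N| => x; have [xM|/phi0->] := boolP (- M <= x <= M).
  exact: le_trans (phiN x xM) (ler_norm _).
by rewrite normr0.
Qed.

Lemma test_measurable phi : measurable_fun setT phi.
Proof. apply: continuous_measurable_fun; exact: test_continuous. Qed.

Lemma test_locintM phi u : locint u -> locint (fun x => u x * phi x).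
Proof.
by move=> lu; apply: locintM => //; [exact: test_measurable|exact: test_bounded].
Qed.

Lemma test_FTC2 phi a b : a <= b ->
  \int[mu]_(x in `[a, b]) test_deriv phi x = phi b - phi a.
Proof.
rewrite le_eqVlt => /predU1P[->|ab]; first by rewrite Rintegral_xx subrr.
rewrite /Rintegral (@continuous_FTC2 _ _ phi)//.
- by apply: continuous_subspaceT; exact: test_continuous.
- split.
  + by move=> x _; exact: (test_smooth phi 0%N).
  + by apply: cvg_at_right_filter; exact: test_continuous.
  + by apply: cvg_at_left_filter; exact: test_continuous.
Qed.

Lemma dist_derivE F phi M : (forall x, ~~ (- M < x < M) -> test_deriv phi x = 0) ->
  dist_deriv (regular F) phi = - \int[mu]_(x in `[- M, M]) (F x * test_deriv phi x).
Proof.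
move=> phi0; rewrite /dist_deriv /regular (Rintegral_support _ _ (- M) M)// => x xM.
rewrite phi0 ?mulr0//; apply: contra xM => /andP[h1 h2].
by rewrite !ltW.
Qed.

(** Write phi(x) as the integral of - phi' over [x, M], where M bounds the support
of phi, and exchange the order of integration. *)
Lemma regular_deriv u U : locint u -> continuous U ->
  (forall a b, a <= b -> U b - U a = \int[mu]_(t in `[a, b]) u t) ->
  regular u = dist_deriv (regular U).
Proof.
move=> lu cU UE; apply/funext => phi.
have [M M0 phi0] := test_support phi.
rewrite (@dist_derivE _ _ M); last by move=> x /phi0[].
rewrite /regular (Rintegral_support _ _ (- M) M)//; last first.
  move=> x xM; rewrite (phi0 x _).1 ?mulr0//; apply: contra xM => /andP[h1 h2].
  by rewrite !ltW.
have phiM : phi M = 0 by apply: (phi0 _ _).1; rewrite ltxx andbF.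
have phiNM : phi (- M) = 0 by apply: (phi0 _ _).1; rewrite ltxx.
have MM : - M <= M by rewrite ge0_cp// ltW.
set dphi := test_deriv phi.
pose K (z : R * R) := if z.1 <= z.2 then u z.1 * dphi z.2 else 0.
have lu' := locint_norm _ lu.
have [B dphiB] := test_bounded dphi.
have [] := @Fubini_rectangle R K (fun s => B * \int[mu]_(x in `[- M, M]) `|u x|)
  (- M) M (- M) M.
- apply: measurable_fun_ifT => //; last first.
    apply: measurable_funM.
      exact: (measurableT_comp (locint_measurable _ lu)).
    exact: (measurableT_comp (test_measurable dphi)).
  exact: measurable_fun_ler.
- exact: locint_integrable (locint_cst _).
- move=> s _; rewrite -locint_RintegralZ// -locint_integralE; last exact: locintZ.
  apply: ge0_le_integral_any => x _; first by rewrite lee_fin.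
  rewrite lee_fin /K/=; case: ifP => _.
    by rewrite normrM mulrC ler_wpM2r//; exact: dphiB.
  by rewrite normr0 mulr_ge0// (le_trans _ (dphiB 0)).
move=> _; rewrite /K/= => swap.
have ldphi : locint dphi by exact: continuous_locint (@test_continuous dphi).
apply: oppr_inj; rewrite opprK; apply: etrans (etrans swap _).
- rewrite -mulN1r; apply: etrans (esym (locint_RintegralZ _ _ _ _ _)) _.
    exact: test_locintM.
  apply: eq_Rintegral_itv => x xM.
  rewrite (Rintegral_cut_l (fun s => u x * dphi s) _ _ _ xM).
  rewrite (locint_RintegralZ (u x) dphi _ _ ldphi) (test_FTC2 _ _ _ (andP xM).2).
  by rewrite phiM sub0r mulN1r mulrN.
- transitivity (\int[mu]_(s in `[- M, M]) (U s * dphi s - U (- M) * dphi s)).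
    apply: eq_Rintegral_itv => s sM.
    rewrite (Rintegral_cut_r (fun x => u x * dphi s) _ _ _ sM).
    by rewrite (locint_RintegralZr (dphi s) u _ _ lu) -(UE _ _ (andP sM).1) mulrBl.
  apply: etrans (locint_RintegralB _ _ _ _ _ _) _.
  - by apply: test_locintM; exact: continuous_locint.
  - exact: locintZ.
  rewrite (locint_RintegralZ (U (- M)) dphi _ _ ldphi) (test_FTC2 _ _ _ MM).
  by rewrite phiM phiNM subrr mulr0 subr0.
Qed.

End integrals_against_test_functions.

(** * Uniqueness of continuous primitives of distributions *)

Section primitive_uniqueness.
Context {R : realType}.
Local Notation mu := (@lebesgue_measure R).
Implicit Types (phi eta : test_function R) (F G u : R -> R).

Lemma bump_test : (smooth_bump : R -> R^o) \in test_pred.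
Proof.
apply/test_predP; split; first exact: smooth_bump_smooth.
apply/compactly_supportedP; exists `[0, 1]%classic; first exact: segment_compact.
move=> x /= x01; apply: smooth_bump_eq0; apply/negP => /andP[x0 x1]; apply: x01.
by rewrite in_itv/= !ltW.
Qed.

Lemma scaled_bump (e : R) : 0 < e -> exists2 eta : test_function R,
  forall x, 0 <= eta x &
  (forall x, ~~ (0 < x < e) -> eta x = 0) /\ (forall x, 0 < x < e -> 0 < eta x).
Proof.
move=> e0; have en0 : e^-1 != 0 by rewrite invr_eq0 gt_eqF.
exists (TestFunction (test_affine_subproof 0 (TestFunction bump_test) en0)) => [x|].
  exact: smooth_bump_ge0.
have E x : (0 < e^-1 * x + 0 < 1) = (0 < x < e).
  by rewrite addr0 pmulr_rgt0 ?invr_gt0// ltr_pdivrMl// mulr1.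
split=> x; rewrite -E; [exact: smooth_bump_eq0|exact: smooth_bump_gt0].
Qed.

Lemma smooth_shift_test eta (c : R) : smooth (fun x => eta (x - c)).
Proof. by have /test_predP[] := test_shift_subproof c eta. Qed.

(** The integral of eta over ]-oo, x] is constant for large x, so that two of its
translates differ by a function of compact support. *)
Lemma test_primitive_difference eta (a b : R) :
  exists Phi : test_function R, forall x,
    test_deriv Phi x = eta (x - a) - eta (x - b).
Proof.
have [M M0 eta0'] := test_support eta.
have eta0 x : ~~ (- M < x < M) -> eta x = 0 by move=> /eta0'[].
pose B : R -> R := fun x => \int[mu]_(t in `]-oo, x]) eta t.
have leta : locint eta by exact: continuous_locint (@test_continuous _ eta).
have ieta y : mu.-integrable `]-oo, y] (EFin \o eta).
  apply: (@integrableS _ _ _ mu setT) => //.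
  have /integrable_mkcond : mu.-integrable `[- M, M] (EFin \o eta).
    exact: locint_integrable.
  move=> /(_ (measurable_itv _)); apply: eq_integrable => // x _.
  rewrite patchE mem_setE in_itv/=; case: ifPn => // xM.
  rewrite /= eta0//; apply: contra xM => /andP[h1 h2]; by rewrite !ltW.
have dB x : is_derive x (1 : R) (B : R -> R^o) (eta x).
  have xx : x < x + 1 by rewrite ltrDl.
  have [dB BE] := continuous_FTC1 xx (ieta _) (ltNyr x) (@test_continuous _ eta x).
  by apply: DeriveDef; [exact: dB|rewrite -derive1E; exact: BE].
have Blo x : x <= - M -> B x = 0.
  move=> xM; apply: Rintegral_eq0 => t /=; rewrite in_itv/= => tx.
  by apply: eta0; rewrite negb_and -leNgt (le_trans tx xM).
have Bhi x : M <= x -> B x = \int[mu]_(t in `[- M, M]) eta t.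
  move=> Mx; apply: Rintegral_support => t /=.
    by rewrite !in_itv/= => /andP[_ tM]; exact: le_trans Mx.
  move=> tM; apply: eta0; apply: contra tM => /andP[h1 h2]; by rewrite !ltW.
have dBc c x : is_derive x (1 : R) (fun x => B (x - c) : R^o) (eta (x - c)).
  have d1 : is_derive x (1 : R) (fun x : R => x - c : R^o) 1.
    by apply: is_derive_eq; rewrite subr0.
  have h := @is_derive1_comp _ B (fun x => x - c) x _ _ (dB (x - c)) d1.
  by apply: (is_derive_eq h); rewrite -[LHS]/(_ * 1) mulr1.
pose P : R -> R^o := fun x => B (x - a) - B (x - b).
have dP x : is_derive x (1 : R) P (eta (x - a) - eta (x - b)).
  exact: (@is_deriveB _ _ _ _ _ x 1 _ _ (dBc a x) (dBc b x)).
have P' : derive1 P = (fun x => eta (x - a) - eta (x - b)).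
  by apply/funext => x; rewrite derive1E; exact: derive_val.
have tP : P \in test_pred.
  apply/test_predP; split.
    apply: smooth_primitive; first by move=> x; have [] := dP x.
    rewrite P'; apply: (@smooth_span _ (@smooth R)).
      move=> u su; exists (derive1 u); first exact/lin_span_base/smooth_derive1.
      by move=> x; exact: smooth_derivable.
    have -> : (fun x => eta (x - a) - eta (x - b)) =
        (fun x => -1 * eta (x - b) + eta (x - a)).
      by apply/funext => x; rewrite mulN1r addrC.
    by apply: lin_span_comb; apply: lin_span_base; exact: smooth_shift_test.
  apply/compactly_supportedP; exists `[- (M + `|a| + `|b|), M + `|a| + `|b|]%classic.
    exact: segment_compact.
  move=> x /=; rewrite in_itv/= => /negP; rewrite negb_and -!ltNge => xM; rewrite /P.
  have := ler_norm a; have := ler_norm b; have := ler_norm (- a); have := ler_norm (- b).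
  rewrite !normrN => h1 h2 h3 h4; case/orP: xM => xM.
    by rewrite !Blo ?subrr//; lra.
  by rewrite !Bhi ?subrr//; lra.
by exists (TestFunction tP) => x; rewrite /= P'.
Qed.

(** If H a > H b, take for eta a bump so narrow that H (x + a) - H (x + b) stays
bounded below on its support, and test against the primitive of
eta (x - a) - eta (x - b): the result is positive. *)
Lemma continuous_dist_constant (H : R -> R) : continuous H ->
  (forall phi, \int[mu]_(x in setT) (H x * test_deriv phi x) = 0) ->
  forall a b, H a = H b.
Proof.
move=> cH H0.
suff le a b : H a <= H b by move=> a b; apply/eqP; rewrite eq_le !le.
rewrite leNgt; apply/negP => ba.
pose K x := H (x + a) - H (x + b).
pose d := K 0 / 2.
have d0 : 0 < d by rewrite divr_gt0// /K !add0r subr_gt0.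
have cK : continuous K.
  move=> x; apply: cvgB; apply: continuous_comp; do ?exact: cH.
    by apply: cvgD; [exact: cvg_id|exact: cvg_cst].
  by apply: cvgD; [exact: cvg_id|exact: cvg_cst].
have [e e0 Ke] : exists2 e, 0 < e & forall x, 0 <= x <= e -> d <= K x.
  have /cvgrPdist_le/(_ d d0) := cK 0.
  move=> /nbhs_ballP[r /= r0 Kr]; exists (r / 2); first by rewrite divr_gt0.
  move=> x /andP[x0 xr]; have : `|K 0 - K x| <= d.
    by apply: Kr; rewrite /ball/= sub0r normrN ger0_norm//; lra.
  rewrite ler_norml => /andP[_]; rewrite /d; lra.
have [eta eta_ge0 [eta0 eta_gt0]] := scaled_bump e e0.
have [Phi PhiE] := test_primitive_difference eta a b.
have := H0 Phi.
pose N := e + `|a| + `|b|.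
have leta : locint eta by exact: continuous_locint (@test_continuous _ eta).
have lH : locint H by exact: continuous_locint.
have suppc (c : R) : - N <= c -> c + e <= N ->
    \int[mu]_(x in `[- N, N]) (H x * eta (x - c)) =
    \int[mu]_(x in `[0, e]) (H (x + c) * eta x).
  move=> Nc cN; rewrite (Rintegral_support _ _ c (c + e)); last 2 first.
  - move=> x /=; rewrite !in_itv/= => /andP[h1 h2].
    by rewrite (le_trans Nc h1) (le_trans h2 cN).
  - move=> x xc; rewrite eta0 ?mulr0//; apply: contra xc => /andP[h1 h2].
    by rewrite -subr_ge0 ltW//= -lerBlDl ltW.
  transitivity (\int[mu]_(x in `[0, e]) (H (x + c) * eta (x + c - c))).
    rewrite -[X in `[X, _]](add0r c) [c + e]addrC.
    rewrite -(Rintegral_shift (fun x => H x * eta (x - c)))//.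
    by apply: locint_measurable; exact: test_locintM (test_shift c eta) _ lH.
  by apply: eq_Rintegral => x _; rewrite addrK.
have := ler_norm a; have := ler_norm b; have := ler_norm (- a); have := ler_norm (- b).
rewrite !normrN => h1 h2 h3 h4.
rewrite (Rintegral_support _ _ (- N) N)//; last first.
  move=> x xN; rewrite PhiE !eta0 ?subrr ?mulr0//; apply: contra xN => /andP[u1 u2];
    rewrite /N; apply/andP; split; lra.
under eq_Rintegral do rewrite PhiE mulrBr.
rewrite locint_RintegralB; last 2 first.
- exact: test_locintM (test_shift a eta) _ lH.
- exact: test_locintM (test_shift b eta) _ lH.
rewrite !suppc; [|rewrite /N; lra..].
rewrite -locint_RintegralB; last 2 first.
- by apply: test_locintM; exact: locint_shift.
- by apply: test_locintM; exact: locint_shift.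
under eq_Rintegral do rewrite -mulrBl.
have lK : locint (fun x => K x * eta x) by apply: test_locintM; exact: continuous_locint.
(* on [e / 3, e / 2], inside the support, the bump is bounded below *)
have [m m0 etam] : exists2 m, 0 < m & forall x, e / 3 <= x <= e / 2 -> m <= eta x.
  have ce : {within `[e / 3, e / 2], continuous eta}.
    by apply: continuous_subspaceT; exact: test_continuous.
  have e32 : e / 3 <= e / 2 by lra.
  have [c] := EVT_min e32 ce; rewrite in_itv/= => /andP[c1 c2] cmin.
  exists (eta c) => [|x xe]; last by apply: cmin; rewrite in_itv.
  by apply: eta_gt0; apply/andP; split; lra.
suff : 0 < \int[mu]_(x in `[0, e]) (K x * eta x).
  by rewrite /K => /gt_eqF/eqP h /h.
apply: (@lt_le_trans _ _ (\int[mu]_(x in `[e / 3, e / 2]) (d * m))).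
  rewrite RintegralM_cst; last by lra.
  by apply: mulr_gt0; [exact: mulr_gt0|lra].
apply: (@le_trans _ _ (\int[mu]_(x in `[e / 3, e / 2]) (d * eta x))).
  apply: locint_le_Rintegral; first exact: locint_cst.
    exact: locintZ.
  by move=> x xe; rewrite ler_pM2l// etam.
apply: (@le_trans _ _ (\int[mu]_(x in `[0, e]) (d * eta x))).
  apply: le_Rintegral_sub; [exact: locintZ| |lra..].
  by move=> x; rewrite mulr_ge0// ltW.
apply: locint_le_Rintegral => //; first exact: locintZ.
by move=> x xe; rewrite ler_wpM2r// Ke.
Qed.

End primitive_uniqueness.

(** * Quasi-periodic primitives and their Steklov averages *)

Section quasi_periodic_primitives.
Context {R : realType}.
Local Notation mu := (@lebesgue_measure R).
Local Notation tau := (pi *+ 2 : R).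
Implicit Types (F G u : R -> R).

Lemma Bc_continuous F : Bc F -> continuous F.
Proof. by case. Qed.

Lemma Bc_Npi F : Bc F -> F (- pi) = 0.
Proof. by case. Qed.

Lemma Bc_turn F (n : int) x : Bc F ->
  F (x + n%:~R * tau) = F x + n%:~R * F pi.
Proof.
move=> [_ _ FE]; have xE := turnP x; set k := turn x in xE.
have -> : x = (x - k%:~R * tau) + k%:~R * tau by rewrite subrK.
set y := x - _ in xE *.
rewrite -addrA -mulrDl -intrD !FE// intrD mulrDl; lra.
Qed.

Lemma Bc_increment_period F x y (n : int) : Bc F ->
  F (x + n%:~R * tau) - F (y + n%:~R * tau) = F x - F y.
Proof. by move=> BF; rewrite !Bc_turn//; lra. Qed.

Lemma Bc_tau F x : Bc F -> F (x + tau) = F x + F pi.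
Proof. by move=> BF; have := Bc_turn F 1 x BF; rewrite !mul1r. Qed.

Lemma Bc_intro F : continuous F -> F (- pi) = 0 ->
  (forall x, F (x + tau) = F x + F pi) -> Bc F.
Proof.
move=> cF F0 FE; split=> // y [n|n] _.
- rewrite -pmulrn; elim: n => [|n ih]; first by rewrite !mul0r !addr0.
  by rewrite -natr1 !mulrDl !mul1r addrA FE ih addrA.
- have FN x : F (x - tau) = F x - F pi.
    by rewrite -[in RHS](subrK tau x) FE addrK.
  rewrite NegzE mulrNz -pmulrn !mulNr; elim: n.+1 => [|k ih].
    by rewrite !mul0r !oppr0 !addr0.
  have -> : y + - (k.+1%:R * tau) = y + - (k%:R * tau) - tau by rewrite -natr1; ring.
  by rewrite FN ih -natr1; ring.
Qed.

(** The theorem of Heine and Cantor on one period; the increments of F repeat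
themselves on the others. *)
Lemma quasi_periodic_uniformly_continuous F (e : R) : continuous F ->
  (forall x y (n : int), F (x + n%:~R * tau) - F (y + n%:~R * tau) = F x - F y) ->
  0 < e -> exists2 d : R, 0 < d & forall x h, 0 <= h <= d -> `|F (x + h) - F x| <= e.
Proof.
move=> cF qF e0.
have := @segment_compact R (- pi) pi => /compact_near_coveringP.
move=> /(_ R (nbhs (0 : R)) (fun h x => `|F (x + h) - F x| <= e)).
have H : forall x : R, `[- pi, pi]%classic x ->
    \forall x' \near x & h \near (0 : R), `|F (x' + h) - F x'| <= e.
  move=> x _.
  have c1 : F (z.1 + z.2) @[z --> (x, 0 : R)] --> F x.
    rewrite -[X in _ --> F X]addr0; apply: cvg_comp; last exact: cF.
    by apply: cvgD; [exact: cvg_fst|exact: cvg_snd].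
  have c2 : F z.1 @[z --> (x, 0 : R)] --> F x.
    by apply: cvg_comp; last exact: cF; exact: cvg_fst.
  have c0 : (F (z.1 + z.2) - F z.1) @[z --> (x, 0 : R)] --> (0 : R).
    by rewrite -[X in _ --> X](subrr (F x)); exact: cvgB.
  have /cvgrPdist_le/(_ e e0) := c0.
  by apply: filterS => z /=; rewrite sub0r normrN.
move=> /(_ _ H) /nbhs_ballP[d /= d0 Hd]; exists (d / 2); first by rewrite divr_gt0.
move=> x h /andP[h0 hd].
have xt := turnP x; set n := turn x in xt; rewrite -(qF _ _ (- n)).
rewrite mulrNz mulNr addrAC; apply: Hd.
  by rewrite /ball/= sub0r normrN ger0_norm//; lra.
by rewrite /= in_itv/=; case/andP: xt => -> /ltW ->.
Qed.

End quasi_periodic_primitives.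

Section primitives.
Context {R : realType}.
Local Notation mu := (@lebesgue_measure R).
Local Notation tau := (pi *+ 2 : R).
Implicit Types (F G u : R -> R) (f : @functional R).

(** The primitive of u that vanishes at - pi. *)
Definition int_from (u : R -> R) (x : R) : R :=
  if - pi <= x then \int[mu]_(t in `[- pi, x]) u t
  else - \int[mu]_(t in `[x, - pi]) u t.

Lemma int_fromB u a b : locint u -> a <= b ->
  int_from u b - int_from u a = \int[mu]_(t in `[a, b]) u t.
Proof.
move=> lu ab; rewrite /int_from; have [pb|bp] := leP (- pi) b.
  have [pa|ap] := leP (- pi) a.
    by rewrite (Rintegral_cat u _ a b)// addrC addKr.
  by rewrite opprK addrC -Rintegral_cat// ltW.
rewrite ifF; last by apply/negbTE; rewrite -ltNge (le_lt_trans ab).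
rewrite opprK addrC (Rintegral_cat u a b (- pi)) ?addrK//.
exact: ltW.
Qed.

Lemma int_from_continuous u : locint u -> continuous (int_from u).
Proof.
move=> lu x; set a := x - 1; set b := x + 1.
have ab : a <= b by rewrite /a /b; lra.
have := @parameterized_integral_continuous R a b u ab (locint_integrable _ a b lu).
move=> cP.
have xab : x \in `]a, b[ by rewrite in_itv/= /a /b; apply/andP; split; lra.
have cx : {for x, continuous (parameterized_integral mu a ^~ u)}.
  have := continuous_subspaceW (@subset_itv_oo_cc _ _ a b) cP.
  rewrite continuous_open_subspace; last exact: interval_open.
  by apply; rewrite inE.
have cx' : {for x, continuous (fun y => int_from u a + parameterized_integral mu a y u)}.
  by apply: cvgD; [exact: cvg_cst|exact: cx].
have xE : int_from u a + parameterized_integral mu a x u = int_from u x.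
  by rewrite /parameterized_integral -int_fromB ?subrKC// /a; lra.
rewrite /continuous_at -xE; apply: cvg_trans cx'; apply: near_eq_cvg; near=> y.
rewrite /parameterized_integral -int_fromB ?subrKC//.
by apply: ltW; near: y; apply: lt_nbhsr; rewrite /a; lra.
Unshelve. all: by end_near. Qed.

Lemma int_from_Bc u : locint u -> periodic u tau -> Bc (int_from u).
Proof.
move=> lu pu; apply: Bc_intro; first exact: int_from_continuous.
  by rewrite /int_from lexx Rintegral_xx.
move=> x; have := int_fromB u x (x + tau) lu.
rewrite lerDl ltW ?tau_gt0// => /(_ isT) /eqP.
rewrite subr_eq Rintegral_period// addrC => /eqP ->.
by rewrite /int_from ge0_cp ?pi_ge0// addrC.
Qed.

(** Averaging F over [x, x + d] changes it by little when d is small, and the average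
is a primitive of p(x) = (F (x + d) - F x) / d. Continuous functions p are thus
dense among the distributions with a primitive in [Bc]. *)
Lemma steklov_approximation F (e : R) : Bc F -> 0 < e ->
  exists p : R -> R, [/\ continuous p, periodic p tau &
    forall a b, a <= b -> `|F b - F a - \int[mu]_(t in `[a, b]) p t| <= e].
Proof.
move=> BF e0; have cF := Bc_continuous _ BF; have lF := continuous_locint _ cF.
have e20 : 0 < e / 2 by rewrite divr_gt0.
have [d d0 dF] := quasi_periodic_uniformly_continuous _ (e / 2) cF
  (fun x y n => Bc_increment_period F x y n BF) e20.
exists (fun x => d^-1 * (F (x + d) - F x)); split.
- move=> x; apply: cvgM; first exact: cvg_cst.
  apply: cvgB; last exact: cF.
  by apply: cvg_comp; last exact: cF; apply: cvgD; [exact: cvg_id|exact: cvg_cst].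
- by move=> x; rewrite addrAC !Bc_tau//; congr (_ * _); lra.
move=> a b ab.
have lFd : locint (fun t => F (t + d)) by exact: locint_shift.
have -> : \int[mu]_(t in `[a, b]) (d^-1 * (F (t + d) - F t)) =
    d^-1 * \int[mu]_(t in `[b, b + d]) F t - d^-1 * \int[mu]_(t in `[a, a + d]) F t.
  rewrite (locint_RintegralZ d^-1 (fun t => F (t + d) - F t)); last exact: locintB.
  rewrite -mulrBr; congr (_ * _).
  apply: etrans (locint_RintegralB _ _ _ _ lFd lF) _.
  rewrite (Rintegral_shift _ _ _ _ (locint_measurable _ lF)).
  rewrite -!int_fromB// ?lerDl ?lerD2r ?(ltW d0)//.
  set A := int_from F (b + d); set B := int_from F (a + d).
  set C := int_from F a; set D := int_from F b; lra.
have key x : `|F x - d^-1 * \int[mu]_(t in `[x, x + d]) F t| <= e / 2.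
  have -> : F x - d^-1 * \int[mu]_(t in `[x, x + d]) F t =
      d^-1 * \int[mu]_(t in `[x, x + d]) (F x - F t).
    rewrite (locint_RintegralB (fun=> F x) F _ _ (locint_cst _) lF).
    rewrite RintegralM_cst ?lerDl ?(ltW d0)// (addrC x) addrK mulrBr.
    by rewrite mulrCA mulVf ?mulr1// gt_eqF.
  rewrite normrM ger0_norm ?invr_ge0 ?(ltW d0)// ler_pdivrMl// mulrC.
  have xd : x <= x + d by rewrite lerDl ltW.
  have := @norm_Rintegral_le_cst R (fun t => F x - F t) x (x + d) (e / 2).
  rewrite (addrC x d) addrK addrC => h; apply: h => //.
    by apply: locintB => //; exact: locint_cst.
  move=> t /andP[xt td]; rewrite distrC.
  have -> : t = x + (t - x) by rewrite subrKC.
  by apply: dF; apply/andP; split; lra.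
have := key a; have := key b; rewrite !ler_norml.
set A := d^-1 * _; set B := d^-1 * _.
by move=> /andP[h1 h2] /andP[h3 h4]; apply/andP; split; lra.
Qed.

End primitives.

(** * Primitives of distributions and the Alexiewicz norm *)

Section primitives_of_distributions.
Context {R : realType}.
Local Notation mu := (@lebesgue_measure R).
Local Notation tau := (pi *+ 2 : R).
Implicit Types (F G u : R -> R) (f : @functional R) (phi : test_function R).

Lemma dist_deriv_comb (c : R) F G : continuous F -> continuous G ->
  dist_deriv (regular (fun t => c * F t + G t)) =
  c *: dist_deriv (regular F) + dist_deriv (regular G).
Proof.
move=> cF cG; apply/funext => phi.
have [M M0 phi0] := test_support phi.
have d0 x : ~~ (- M < x < M) -> test_deriv phi x = 0 by move=> /phi0[].
rewrite [LHS](dist_derivE _ _ _ d0) [RHS]/(_ + _)/=.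
have lF : locint (fun x => F x * test_deriv phi x).
  by apply: test_locintM; exact: continuous_locint.
have lG : locint (fun x => G x * test_deriv phi x).
  by apply: test_locintM; exact: continuous_locint.
transitivity (- (c * \int[mu]_(x in `[- M, M]) (F x * test_deriv phi x) +
    \int[mu]_(x in `[- M, M]) (G x * test_deriv phi x))); last first.
  rewrite opprD -mulrN -(dist_derivE _ _ _ d0) -(dist_derivE _ _ _ d0).
  by [].
congr (- _); rewrite -(locint_RintegralZ _ _ _ _ lF).
rewrite -(locint_RintegralD _ _ _ _ (locintZ c _ lF) lG).
by apply: eq_Rintegral => x _; rewrite mulrDl mulrA.
Qed.

Lemma dist_deriv_cst (c : R) : dist_deriv (regular (fun=> c)) = 0.
Proof.
apply/funext => phi; have [M M0 phi0] := test_support phi.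
have d0 x : ~~ (- M < x < M) -> test_deriv phi x = 0 by move=> /phi0[].
rewrite (dist_derivE _ _ _ d0).
rewrite (locint_RintegralZ c (test_deriv phi)); last first.
  exact: continuous_locint (@test_continuous _ _).
rewrite test_FTC2; last by rewrite ge0_cp// ltW.
by rewrite !(phi0 _ _).1 ?ltxx ?andbF// subrr mulr0 oppr0.
Qed.

Lemma dist_deriv_translate (c : R) F : continuous F ->
  dist_deriv (regular (fun t => F t + c)) = dist_deriv (regular F).
Proof.
move=> cF; have := @dist_deriv_comb 1 F (fun=> c) cF (fun x => cvg_cst _).
rewrite scale1r dist_deriv_cst addr0 => <-.
by congr (dist_deriv (regular _)); apply/funext => t; rewrite mul1r.
Qed.

Lemma Rintegral_setT_preserves (u : R -> R) (h : R -> R) :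
  preserves_lebesgue h -> measurable_fun setT u ->
  \int[mu]_(x in setT) u (h x) = \int[mu]_(x in setT) u x.
Proof.
move=> ph mu_; congr fine.
apply: (@preserves_integral _ h setT (EFin \o u) ph measurableT).
exact/measurable_EFinP.
Qed.

Lemma test_deriv_affine phi (psi : test_function R) (s c : R) : (forall x, psi x = phi (s * x + c)) ->
  forall x, test_deriv psi x = s * test_deriv phi (s * x + c).
Proof.
move=> E x; rewrite /test_deriv/=.
have -> : test_fun psi = (fun x => phi (s * x + c)) by apply/funext.
rewrite derive1E.
have := is_derive_affine 0 s c x (test_smooth phi).
rewrite !derive1n0 derive1n1 expr0 expr1.
under eq_fun do rewrite mul1r.
by move=> h; rewrite derive_val.
Qed.

Lemma test_deriv_shift phi (c x : R) :
  test_deriv (test_shift c phi) x = test_deriv phi (x - c).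
Proof.
rewrite (@test_deriv_affine phi (test_shift c phi) 1 (- c)) ?mul1r//.
by move=> y; rewrite mul1r.
Qed.

Lemma test_deriv_reflect phi (c x : R) :
  test_deriv (test_reflect c phi) x = - test_deriv phi (c - x).
Proof.
rewrite (@test_deriv_affine phi (test_reflect c phi) (-1) c) ?mulN1r 1?addrC//.
by move=> y; rewrite mulN1r addrC.
Qed.

Lemma dist_shift_deriv (y : R) F : continuous F ->
  dist_shift y (dist_deriv (regular F)) =
  dist_deriv (regular (fun t => F (t - y))).
Proof.
move=> cF; apply/funext => phi; rewrite /dist_shift /dist_deriv /regular.
apply: (congr1 (fun z : R => - z)).
transitivity (\int[mu]_(x in setT) (F x * test_deriv phi (x + y))).
  by apply: eq_Rintegral => x _; rewrite test_deriv_shift opprK.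
rewrite -(Rintegral_setT_preserves _ _ (shift_preserves (- y))).
  by apply: eq_Rintegral => x _; rewrite subrK.
apply: measurable_funM; first exact: continuous_measurable_fun.
apply: (measurableT_comp (test_measurable (test_deriv phi))).
exact: (shift_preserves y).1.
Qed.

Lemma dist_reflect_deriv (x : R) F : continuous F ->
  dist_reflect x (dist_deriv (regular F)) =
  dist_deriv (regular (fun t => - F (x - t))).
Proof.
move=> cF; apply/funext => phi; rewrite /dist_reflect /dist_deriv /regular.
apply: (congr1 (fun z : R => - z)).
transitivity (\int[mu]_(s in setT) (F s * - test_deriv phi (x - s))).
  by apply: eq_Rintegral => s _; rewrite test_deriv_reflect.
rewrite -(Rintegral_setT_preserves _ _ (reflect_preserves x)).
  by apply: eq_Rintegral => s _; rewrite subKr mulrN mulNr.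
apply: measurable_funM; first exact: continuous_measurable_fun.
apply: measurable_funN; apply: (measurableT_comp (test_measurable (test_deriv phi))).
exact: (reflect_preserves x).1.
Qed.

(** The difference of two primitives is annihilated by all derivatives of test
functions, hence constant, and it vanishes at - pi. *)
Lemma primitive_eq f F : Bc F -> f = dist_deriv (regular F) -> primitive f = F.
Proof.
move=> BF fF; have [BG fG] : Bc (primitive f) /\ f = dist_deriv (regular (primitive f)).
  by apply: (@xgetPex _ (cst 0) [set F | Bc F /\ f = dist_deriv (regular F)]); exists F.
set G := primitive f in BG fG *.
pose H x := -1 * F x + G x.
have cF := Bc_continuous _ BF; have cG := Bc_continuous _ BG.
have H0 phi : \int[mu]_(x in setT) (H x * test_deriv phi x) = 0.
  have : dist_deriv (regular H) phi = 0.
    rewrite /H (dist_deriv_comb (-1) _ _ cF cG) -fF -fG.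
    by rewrite scaleN1r addNr.
  by rewrite /dist_deriv /regular => /eqP; rewrite oppr_eq0 => /eqP.
have cH : continuous H.
  by move=> x; apply: cvgD; [apply: cvgM; [exact: cvg_cst|exact: cF]|exact: cG].
apply/funext => x; have := continuous_dist_constant _ cH H0 x (- pi).
rewrite /H (Bc_Npi _ BF) (Bc_Npi _ BG) mulr0 addr0 mulN1r addrC.
by move/eqP; rewrite subr_eq0 => /eqP.
Qed.

(** Stability of this property under translations and linear combinations is read
off from the primitives. *)
Definition has_primitive f := exists2 F, Bc F & f = dist_deriv (regular F).

Lemma Ac_has_primitive f : Ac f -> has_primitive f.
Proof. by case. Qed.

Lemma primitiveP f : has_primitive f ->
  Bc (primitive f) /\ f = dist_deriv (regular (primitive f)).
Proof.
move=> [F BF fF].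
by apply: (@xgetPex _ (cst 0) [set F | Bc F /\ f = dist_deriv (regular F)]); exists F.
Qed.

Lemma Bc_primitive f : has_primitive f -> Bc (primitive f).
Proof. by case/primitiveP. Qed.

(** The primitive, vanishing at - pi, of the distribution with t replaced by x - t. *)
Lemma Bc_reflect F (x : R) : Bc F -> Bc (fun t => - F (x - t) + F (x + pi)).
Proof.
move=> BF; apply: Bc_intro; last 2 first.
- by rewrite opprK addNr.
- move=> t; have -> : x - (t + tau) = x - t + (-1)%:~R * tau by rewrite mulN1r; ring.
  rewrite Bc_turn// mulN1r.
  have := Bc_tau F (x - pi) BF.
  have -> : x - pi + tau = x + pi by rewrite tauE; ring.
  by move=> ->; ring.
move=> t; apply: cvgD; last exact: cvg_cst.
apply: cvgN; apply: cvg_comp; last exact: (Bc_continuous _ BF).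
by apply: cvgB; [exact: cvg_cst|exact: cvg_id].
Qed.

Lemma primitive_reflect f (x : R) : has_primitive f ->
  primitive (dist_reflect x f) =
  (fun t => - primitive f (x - t) + primitive f (x + pi)).
Proof.
move=> /primitiveP[BF fE]; set F := primitive f in BF fE *.
apply: primitive_eq; first exact: Bc_reflect.
rewrite [in LHS]fE dist_reflect_deriv; last exact: Bc_continuous.
rewrite (dist_deriv_translate (F (x + pi)) (fun t => - F (x - t)))// => t.
apply: cvgN; apply: cvg_comp; last exact: (Bc_continuous _ BF).
by apply: cvgB; [exact: cvg_cst|exact: cvg_id].
Qed.

Lemma Bc_shift F (y : R) : Bc F -> Bc (fun t => F (t - y) - F (- pi - y)).
Proof.
move=> BF; apply: Bc_intro; last 2 first.
- by rewrite subrr.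
- move=> t; rewrite addrAC Bc_tau//.
  have -> : pi - y = - pi - y + tau by rewrite tauE; ring.
  by rewrite Bc_tau//; ring.
move=> t; apply: cvgD; last exact: cvg_cst.
apply: cvg_comp; last exact: (Bc_continuous _ BF).
by apply: cvgB; [exact: cvg_id|exact: cvg_cst].
Qed.

Lemma shift_primitive f (y : R) : has_primitive f ->
  Bc (fun t => primitive f (t - y) - primitive f (- pi - y)) /\
  dist_shift y f =
  dist_deriv (regular (fun t => primitive f (t - y) - primitive f (- pi - y))).
Proof.
move=> /primitiveP[BF fE]; set F := primitive f in BF fE *.
split; first exact: Bc_shift.
rewrite [in LHS]fE dist_shift_deriv; last exact: Bc_continuous.
rewrite (dist_deriv_translate (- F (- pi - y)) (fun t => F (t - y)))// => t.
apply: cvg_comp; last exact: (Bc_continuous _ BF).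
by apply: cvgB; [exact: cvg_id|exact: cvg_cst].
Qed.

Lemma Bc_comb F G (c : R) : Bc F -> Bc G -> Bc (fun t => c * F t + G t).
Proof.
move=> BF BG; apply: Bc_intro.
- move=> t; apply: cvgD; last exact: (Bc_continuous _ BG).
  by apply: cvgM; [exact: cvg_cst|exact: (Bc_continuous _ BF)].
- by rewrite !Bc_Npi// mulr0 addr0.
- by move=> x; rewrite !Bc_tau//; ring.
Qed.

Lemma comb_primitive f f' (c : R) : has_primitive f -> has_primitive f' ->
  Bc (fun t => c * primitive f t + primitive f' t) /\
  c *: f + f' = dist_deriv (regular (fun t => c * primitive f t + primitive f' t)).
Proof.
move=> /primitiveP[BF fE] /primitiveP[BF' fE'].
split; first exact: Bc_comb.
by rewrite dist_deriv_comb -?fE -?fE'//; exact: Bc_continuous.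
Qed.

Lemma primitive_regular u : locint u -> periodic u tau ->
  primitive (regular u) = int_from u.
Proof.
move=> lu pu; apply: primitive_eq; first exact: int_from_Bc.
apply: regular_deriv => //; first exact: int_from_continuous.
by move=> a b ab; rewrite int_fromB.
Qed.

(** The increments of F over intervals of length at most a period are bounded,
because those starting in [-pi, pi[ already give all of them. *)
Lemma alexiewicz_ub f a b : Bc (primitive f) -> a <= b -> b - a <= tau ->
  `|primitive f b - primitive f a| <= alexiewicz f.
Proof.
move=> BF ab abt; set F := primitive f in BF *.
have [M FM] := continuous_bounded_itv F (- pi) (pi + tau) (Bc_continuous _ BF).
have t0 := @tau_gt0 R.
apply: ub_le_sup; last by exists a, b.
exists (M + M) => _ [x [y [xy xyt ->]]]; rewrite /cp_integral -/F.
have xt := turnP x; set n := turn x in xt.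
rewrite -(Bc_increment_period F y x (- n) BF) mulrNz mulNr.
move: xt; set z := n%:~R * tau => /andP[h1 h2].
apply: le_trans (ler_normB _ _) _.
by apply: lerD; apply: FM; apply/andP; split; lra.
Qed.

Lemma alexiewicz_le f (M : R) :
  (forall a b, a <= b -> b - a <= tau -> `|primitive f b - primitive f a| <= M) ->
  alexiewicz f <= M.
Proof.
move=> H; apply: ge_sup; last by move=> _ [a [b [ab abt ->]]]; exact: H.
exists 0, 0, 0; split => //; first by rewrite subrr ltW// tau_gt0.
by rewrite /cp_integral subrr normr0.
Qed.

Lemma alexiewicz_ge0 f : Bc (primitive f) -> 0 <= alexiewicz f.
Proof.
move=> BF; apply: le_trans (alexiewicz_ub f 0 0 BF _ _) => //.
by rewrite subrr ltW// tau_gt0.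
Qed.

End primitives_of_distributions.

(** * Riemann-Stieltjes integrals *)

Section riemann_stieltjes.
Context {R : realType}.
Local Notation mu := (@lebesgue_measure R).
Implicit Types (F G K g h k v p : R -> R) (a b : R) (s : seq R).

(** The total variation of g from a on is such a v. The relation, unlike the total
variation itself, is easily transported along translations, reflections and
convolutions. *)
Definition dominates v g a b := forall x y, a <= x -> x <= y -> y <= b ->
  `|g y - g x| <= v y - v x.

Definition rs_sum F g a b s (xi : nat -> R) :=
  \sum_(i < size s) F (xi i) * (g (nth b s i) - g (nth b (a :: s) i)).

Lemma partition_points a b s (i : nat) : itv_partition a b s -> (i < size s)%N ->
  [/\ a <= nth b (a :: s) i, nth b (a :: s) i < nth b s i & nth b s i <= b].
Proof.
move=> abs si; have [/(pathP b)/(_ _ si) lt_i _] := abs.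
split=> //; first by apply: itv_partition_nth_ge => //; exact: ltnW.
exact: (@itv_partition_nth_le _ _ a b s i.+1 _ abs).
Qed.

Lemma partition_telescope (f : R -> R) a b s : itv_partition a b s ->
  \sum_(i < size s) (f (nth b s i) - f (nth b (a :: s) i)) = f b - f a.
Proof.
move=> abs; rewrite -(big_mkord xpredT (fun i => f (nth b s i) - f (nth b (a :: s) i))).
have := @telescope_sumr _ 0 (size s) (f \o nth b (a :: s)).
rewrite /= -[nth b _ _]/(nth b (a :: s) (size s)).
by rewrite (itv_partition_nth_size _ abs) => /(_ isT).
Qed.

Lemma fine_partition a b (d : R) : a < b -> 0 < d -> exists2 s, itv_partition a b s &
  forall i, (i < size s)%N -> nth b s i - nth b (a :: s) i < d.
Proof.
move=> ab d0; pose n := (Num.truncn ((b - a) / d)).+1.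
have n0 : 0 < n%:R :> R by rewrite ltr0n.
have nd : (b - a) / n%:R < d.
  rewrite ltr_pdivrMr// mulrC -ltr_pdivrMr//; exact: truncnS_gt.
pose t (i : nat) := a + (b - a) / n%:R * i%:R.
have tS i : t i.+1 - t i = (b - a) / n%:R by rewrite /t -natr1; ring.
have tE i : (i <= n)%N -> nth b (a :: mkseq (fun i => t i.+1) n) i = t i.
  case: i => [_|i ni] /=; first by rewrite /t mulr0 addr0.
  by rewrite nth_mkseq.
exists (mkseq (fun i => t i.+1) n); last first.
  move=> i; rewrite size_mkseq => ni; rewrite nth_mkseq// tE ?tS//; exact: ltnW.
split.
  apply/(pathP b) => i; rewrite size_mkseq => ni.
  rewrite tE ?(ltnW ni)// nth_mkseq// -subr_gt0 tS divr_gt0// subr_gt0//.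
rewrite (last_nth b) size_mkseq tE//.
by apply/eqP; rewrite /t divfK; [rewrite subrKC|rewrite gt_eqF].
Qed.

Lemma rs_unique F g a b (I J : R) : a < b ->
  is_Riemann_Stieltjes F g a b I -> is_Riemann_Stieltjes F g a b J -> I = J.
Proof.
move=> ab HI HJ; apply/eqP; rewrite -subr_eq0 -normr_eq0.
apply/eqP; apply/le_anti; rewrite normr_ge0 andbT.
apply/ler_addgt0Pr => e e0; rewrite add0r.
have e2 : 0 < e / 2 by rewrite divr_gt0.
have [d1 d10 H1] := HI _ e2; have [d2 d20 H2] := HJ _ e2.
have d0 : 0 < Num.min d1 d2 by rewrite lt_min d10.
have [s abs sd] := fine_partition a b _ ab d0.
pose xi i := nth b s i.
have tag i : (i < size s)%N -> nth b (a :: s) i <= xi i <= nth b s i.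
  by move=> /(partition_points _ _ _ _ abs)[_ /ltW h _]; rewrite h lexx.
have m1 i : (i < size s)%N -> nth b s i - nth b (a :: s) i < d1.
  by move=> /sd; rewrite lt_min => /andP[].
have m2 i : (i < size s)%N -> nth b s i - nth b (a :: s) i < d2.
  by move=> /sd; rewrite lt_min => /andP[].
have := H1 s xi abs m1 tag; have := H2 s xi abs m2 tag.
rewrite -/(rs_sum F g a b s xi); set S := rs_sum _ _ _ _ _ _ => h2 h1.
have -> : I - J = (S - J) - (S - I) by ring.
by apply: le_trans (ler_normB _ _) _; rewrite (splitr e) lerD// ltW.
Qed.

Lemma rs_sum_le v F g a b s xi (M : R) : dominates v g a b -> itv_partition a b s ->
  (forall i, (i < size s)%N -> nth b (a :: s) i <= xi i <= nth b s i) ->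
  (forall x, a <= x <= b -> `|F x| <= M) ->
  `|rs_sum F g a b s xi| <= M * (v b - v a).
Proof.
move=> vg abs tag FM; rewrite -(partition_telescope _ _ _ _ abs) mulr_sumr.
apply: le_trans (ler_norm_sum _ _ _) _; apply: ler_sum => -[i /= si] _.
have [h1 h2 h3] := partition_points _ _ _ _ abs si.
have /andP[t1 t2] := tag i si.
rewrite normrM; apply: ler_pM => //; last exact: vg (ltW h2) h3.
by apply: FM; rewrite (le_trans h1 t1) (le_trans t2 h3).
Qed.

Lemma rs_sum_comb (c : R) F G g a b s xi :
  rs_sum (fun x => c * F x + G x) g a b s xi =
  c * rs_sum F g a b s xi + rs_sum G g a b s xi.
Proof.
rewrite /rs_sum mulr_sumr -big_split/=; apply: eq_bigr => i _.
by rewrite mulrDl mulrA.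
Qed.

Lemma rs_sum_comb_r (c : R) F g h a b s xi :
  rs_sum F (fun x => c * g x + h x) a b s xi =
  c * rs_sum F g a b s xi + rs_sum F h a b s xi.
Proof.
rewrite /rs_sum mulr_sumr -big_split/=; apply: eq_bigr => i _; ring.
Qed.

Lemma rs_le v F g a b (I M : R) : a < b -> dominates v g a b ->
  is_Riemann_Stieltjes F g a b I ->
  (forall x, a <= x <= b -> `|F x| <= M) -> `|I| <= M * (v b - v a).
Proof.
move=> ab vg HI FM; apply/ler_addgt0Pr => e e0.
have [d d0 H] := HI e e0; have [s abs sd] := fine_partition a b d ab d0.
pose xi i := nth b s i.
have tag i : (i < size s)%N -> nth b (a :: s) i <= xi i <= nth b s i.
  by move=> /(partition_points _ _ _ _ abs)[_ /ltW h _]; rewrite h lexx.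
have := H s xi abs sd tag; rewrite -/(rs_sum F g a b s xi) => /ltW.
have := rs_sum_le v F g a b s xi M vg abs tag FM; set S := rs_sum _ _ _ _ _ _ => h1 h2.
have -> : I = S - (S - I) by ring.
by apply: le_trans (ler_normB _ _) _; exact: lerD.
Qed.

(** Linearity of the sums passes to the limit. Integrand and integrator may both
vary, so that linearity in either of them follows. *)
Lemma rs_linear (c : R) F G K g h k a b (I J : R) :
  (forall s xi, rs_sum K k a b s xi = c * rs_sum F g a b s xi + rs_sum G h a b s xi) ->
  is_Riemann_Stieltjes F g a b I -> is_Riemann_Stieltjes G h a b J ->
  is_Riemann_Stieltjes K k a b (c * I + J).
Proof.
move=> sumE HI HJ e e0; have e2 : 0 < e / 2 by rewrite divr_gt0.
have c0 : 0 < `|c| + 1 by rewrite ltr_wpDl.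
have ec : 0 < e / 2 / (`|c| + 1) by rewrite divr_gt0.
have [d1 d10 H1] := HI _ ec; have [d2 d20 H2] := HJ _ e2.
exists (Num.min d1 d2); first by rewrite lt_min d10.
move=> s xi abs sd tag.
have m1 i : (i < size s)%N -> nth b s i - nth b (a :: s) i < d1.
  by move=> /sd; rewrite lt_min => /andP[].
have m2 i : (i < size s)%N -> nth b s i - nth b (a :: s) i < d2.
  by move=> /sd; rewrite lt_min => /andP[].
have := H1 s xi abs m1 tag; have := H2 s xi abs m2 tag.
rewrite -/(rs_sum F g a b s xi) -/(rs_sum G h a b s xi).
rewrite -/(rs_sum K k a b s xi) sumE.
set S := rs_sum F g _ _ _ _; set T := rs_sum G h _ _ _ _ => h2.
rewrite ltr_pdivlMr// => h1.
have -> : c * S + T - (c * I + J) = c * (S - I) + (T - J) by ring.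
apply: le_lt_trans (ler_normD _ _) _; rewrite (splitr e); apply: ler_ltD => //.
apply: le_trans (ltW h1); rewrite normrM mulrC ler_wpM2l//.
by rewrite lerDl.
Qed.

Lemma rs_comb (c : R) F G g a b (I J : R) : is_Riemann_Stieltjes F g a b I ->
  is_Riemann_Stieltjes G g a b J ->
  is_Riemann_Stieltjes (fun x => c * F x + G x) g a b (c * I + J).
Proof. by apply: rs_linear => s xi; exact: rs_sum_comb. Qed.

Lemma rs_comb_r (c : R) F g h a b (I J : R) : is_Riemann_Stieltjes F g a b I ->
  is_Riemann_Stieltjes F h a b J ->
  is_Riemann_Stieltjes F (fun x => c * g x + h x) a b (c * I + J).
Proof. by apply: rs_linear => s xi; exact: rs_sum_comb_r. Qed.

(** A pair of e and J as in the hypothesis confines the integral sought to the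
interval [J - e V, J + e V], where V = v b - v a. Any two of these intervals
meet, so the supremum of their left endpoints lies in all of them. *)
Lemma rs_uniform_limit v F g a b : a < b -> dominates v g a b ->
  (forall e, 0 < e -> exists G J, (forall x, a <= x <= b -> `|F x - G x| <= e) /\
     is_Riemann_Stieltjes G g a b J) ->
  exists I, is_Riemann_Stieltjes F g a b I.
Proof.
move=> ab vg FG; pose V := v b - v a.
have V0 : 0 <= V by apply: le_trans (vg a b _ _ _) => //; exact: ltW.
pose A (e J : R) := 0 < e /\ exists2 G, (forall x, a <= x <= b -> `|F x - G x| <= e) &
     is_Riemann_Stieltjes G g a b J.
have AA e J e' J' : A e J -> A e' J' -> J - e * V <= J' + e' * V.
  move=> [e0 [G FG1 GJ]] [e'0 [G' FG' GJ']].
  have D : is_Riemann_Stieltjes (fun x => -1 * G' x + G x) g a b (-1 * J' + J).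
    exact: rs_comb.
  have := @rs_le v _ g a b _ (e + e') ab vg D.
  have h x : a <= x <= b -> `|-1 * G' x + G x| <= e + e'.
    move=> xab; have -> : -1 * G' x + G x = (F x - G' x) - (F x - G x) by ring.
    apply: le_trans (ler_normB _ _) _; rewrite addrC.
    by apply: lerD; [exact: FG1|exact: FG'].
  move=> /(_ h); rewrite -/V mulrDl ler_norml => /andP[_].
  set x := e * V; set y := e' * V; lra.
pose S : set R := [set r | exists e J, A e J /\ r = J - e * V].
have SA e J : A e J -> `|sup S - J| <= e * V.
  move=> AeJ.
  have l1 : J - e * V <= sup S.
    apply: ub_le_sup; last by exists e, J.
    by exists (J + e * V) => _ [e' [J' [A' ->]]]; exact: AA.
  have l2 : sup S <= J + e * V.
    apply: ge_sup; first by exists (J - e * V), e, J.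
    by move=> _ [e' [J' [A' ->]]]; exact: AA.
  move: l1 l2; rewrite ler_norml; set x := e * V; set y := sup S.
  by move=> l1 l2; apply/andP; split; lra.
exists (sup S) => e e0.
(* a third of e for each of: the sums of F and G, those of G and J, J and the
   supremum *)
have c0 : 0 < 3 * (V + 1) by rewrite mulr_gt0// ltr_wpDl.
have e'0 : 0 < e / (3 * (V + 1)) by rewrite divr_gt0.
have [G [J [FGe GJ]]] := FG _ e'0.
set e' := e / _ in e'0 FGe.
have SJ : `|sup S - J| <= e' * V by apply: SA; split => //; exists G.
have e'V : e' * V < e / 3.
  have -> : e / 3 = e' * (V + 1).
    rewrite /e' invfM -!mulrA mulVf ?mulr1//.
    by rewrite gt_eqF// ltr_wpDl.
  by rewrite ltr_pM2l// ltrDl.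
have e3 : 0 < e / 3 by rewrite divr_gt0.
have [d d0 H] := GJ _ e3; exists d => // s xi abs sd tag.
have := H s xi abs sd tag.
rewrite -/(rs_sum F g a b s xi) -/(rs_sum G g a b s xi) => h1.
have h2 : `|rs_sum F g a b s xi - rs_sum G g a b s xi| <= e' * V.
  have -> : rs_sum F g a b s xi - rs_sum G g a b s xi =
      rs_sum (fun x => -1 * G x + F x) g a b s xi.
    by rewrite rs_sum_comb mulN1r addrC.
  apply: rs_sum_le => // x xab; rewrite mulN1r addrC; exact: FGe.
move: SJ h1 h2; set X := rs_sum F _ _ _ _ _; set Y := rs_sum G _ _ _ _ _ => h1 h2 h3.
have -> : X - sup S = (X - Y) + ((Y - J) - (sup S - J)) by ring.
apply: le_lt_trans (ler_normD _ _) _.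
have := ler_normB (Y - J) (sup S - J); lra.
Qed.

Lemma Riemann_StieltjesE F g a b I : a < b ->
  is_Riemann_Stieltjes F g a b I -> Riemann_Stieltjes F g a b = I.
Proof.
move=> ab HI; apply: (rs_unique F g a b _ _ ab) => //.
by apply: (@xgetPex _ 0 [set I | is_Riemann_Stieltjes F g a b I]); exists I.
Qed.

(** On a cell [x, y] with tag z, the sum and the right-hand side differ by
(F z - F x) (g y - g x) minus the integral of p (g y - g) over the cell. Both terms
are at most M times the mesh times the increment of v. *)
Lemma rs_by_parts v F g p a b (M : R) : a < b -> dominates v g a b ->
  locint g -> locint p -> locint (fun x => p x * g x) ->
  (forall x, `|p x| <= M) ->
  (forall x y, a <= x -> x <= y -> y <= b ->
     F y - F x = \int[mu]_(t in `[x, y]) p t) ->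
  is_Riemann_Stieltjes F g a b
    (F b * g b - F a * g a - \int[mu]_(t in `[a, b]) (p t * g t)).
Proof.
move=> ab vg lg lp lpg pM FE; pose V := v b - v a.
have V0 : 0 <= V by apply: le_trans (vg a b _ _ _) => //; exact: ltW.
have M0 : 0 <= M by exact: le_trans (pM 0).
move=> e e0; pose c := 2 * M * V + 1.
have c0 : 0 < c by rewrite ltr_wpDl// !mulr_ge0.
exists (e / c); first by rewrite divr_gt0.
move=> s xi abs sd tag; set d := e / c in sd.
have d0 : 0 < d by rewrite divr_gt0.
pose Phi x := F x * g x - \int[mu]_(t in `[a, x]) (p t * g t).
have -> : F b * g b - F a * g a - \int[mu]_(t in `[a, b]) (p t * g t) =
    \sum_(i < size s) (Phi (nth b s i) - Phi (nth b (a :: s) i)).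
  by rewrite (partition_telescope _ _ _ _ abs) /Phi Rintegral_xx; ring.
rewrite -sumrB; apply: le_lt_trans (ler_norm_sum _ _ _) _.
apply: (@le_lt_trans _ _ (\sum_(i < size s)
    (2 * M * d) * (v (nth b s i) - v (nth b (a :: s) i)))); last first.
  rewrite -mulr_sumr (partition_telescope _ _ _ _ abs) -/V.
  have -> : 2 * M * d * V = d * (2 * M * V) by ring.
  have -> : e = d * c by rewrite /d divfK// gt_eqF.
  by rewrite ltr_pM2l// /c ltrDl.
apply: ler_sum => -[i /= si] _.
have [h1 h2 h3] := partition_points _ _ _ _ abs si.
have /andP[t1 t2] := tag i si; have {}sd := sd i si.
move: h1 h2 h3 t1 t2 sd; set y := nth b s i; set x := nth b (a :: s) i.
set z := xi i => ax xy yb xz zy yxd.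
have PhiE : Phi y - Phi x =
    F y * g y - F x * g x - \int[mu]_(t in `[x, y]) (p t * g t).
  rewrite /Phi (Rintegral_cat (fun t => p t * g t) a x y lpg ax (ltW xy)).
  set A := \int[mu]_(t in `[a, x]) _; set B := \int[mu]_(t in `[x, y]) _; ring.
have lpc : locint (fun t => p t * g y).
  by under eq_fun do rewrite mulrC; exact: locintZ.
have E : F z * (g y - g x) - (Phi y - Phi x) =
    (F z - F x) * (g y - g x) - \int[mu]_(t in `[x, y]) (p t * g y - p t * g t).
  rewrite PhiE (locint_RintegralB (fun t => p t * g y) (fun t => p t * g t) _ _ lpc lpg).
  rewrite (locint_RintegralZr (g y) p _ _ lp) -(FE x y ax (ltW xy) yb).
  set B := \int[mu]_(t in `[x, y]) _; ring.
rewrite E; apply: le_trans (ler_normB _ _) _.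
have vxy := vg x y ax (ltW xy) yb.
have w0 : 0 <= v y - v x by exact: le_trans vxy.
have -> : 2 * M * d * (v y - v x) = M * d * (v y - v x) + M * d * (v y - v x) by ring.
apply: lerD.
  rewrite normrM; apply: ler_pM => //.
  rewrite (FE x z ax xz (le_trans zy yb)).
  apply: le_trans (norm_Rintegral_le_cst p x z M lp xz (fun t _ => pM t)) _.
  by apply: ler_wpM2l => //; lra.
apply: (@le_trans _ _ (M * (v y - v x) * (y - x))).
  apply: norm_Rintegral_le_cst; [exact: locintB|exact: ltW|].
  move=> t /andP[xt ty]; rewrite -mulrBr normrM; apply: ler_pM => //.
  apply: le_trans (vg t y (le_trans ax xt) ty yb) _; rewrite lerD2l lerN2.
  have := vg x t ax xt (le_trans ty yb).
  by move=> /(le_trans (normr_ge0 _)); rewrite subr_ge0.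
rewrite mulrAC; apply: ler_wpM2r => //; apply: ler_wpM2l => //; exact: ltW.
Qed.

End riemann_stieltjes.

(** * Functions of bounded variation *)

Section bounded_variation.
Context {R : realType}.
Local Notation mu := (@lebesgue_measure R).
Local Notation tau := (pi *+ 2 : R).
Implicit Types (F G g h v p : R -> R) (a b : R) (s : seq R).

Lemma dominates_bounded_variation v g a b : a <= b -> dominates v g a b ->
  bounded_variation a b g /\ fine (total_variation a b g) <= v b - v a.
Proof.
move=> ab vg.
have le r : variations a b g r -> r <= v b - v a.
  move=> [s abs <-]; rewrite /variation.
  rewrite -(partition_telescope _ _ _ _ abs) -(big_mkord xpredT
    (fun i => v (nth b s i) - v (nth b (a :: s) i))).
  apply: ler_sum_nat => i /andP[_ si].
  have [h1 h2 h3] := partition_points _ _ _ _ abs si.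
  exact: vg (ltW h2) h3.
have bv : bounded_variation a b g by exists (v b - v a).
split=> //; rewrite -lee_fin fineK; last exact/bounded_variationP.
by apply: ge_ereal_sup => _ [r Hr <-]; rewrite lee_fin; exact: le.
Qed.

Lemma total_variation_dominates g a b : bounded_variation a b g ->
  dominates (fun x => fine (total_variation a x g)) g a b.
Proof.
move=> bv x y ax xy yb.
have ay := le_trans ax xy; have xb := le_trans xy yb.
have fx : total_variation a x g \is a fin_num.
  by apply/bounded_variationP => //; exact: bounded_variationl bv.
have bvy : bounded_variation a y g by exact: bounded_variationl bv.
have fxy : total_variation x y g \is a fin_num.
  by apply/bounded_variationP => //; exact: bounded_variationr bvy.
rewrite (total_variationD _ ax xy) fineD// [leRHS]addrC addKr -lee_fin fineK//.
exact: total_variation_ge.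
Qed.

(** Total variation is additive, so finiteness on both parts suffices. *)
Lemma bounded_variation_cat g a b c : a <= b -> b <= c ->
  bounded_variation a b g -> bounded_variation b c g -> bounded_variation a c g.
Proof.
move=> ab bc /(bounded_variationP _ ab) h1 /(bounded_variationP _ bc) h2.
apply/(bounded_variationP _ (le_trans ab bc)).
by rewrite (total_variationD _ ab bc) fin_numD h1.
Qed.

Lemma bounded_variation_shift g a b c : a <= b -> bounded_variation a b g ->
  bounded_variation (a + c) (b + c) (fun t => g (t - c)).
Proof.
move=> ab bv; have vg := total_variation_dominates g a b bv.
set v := fun x => fine _ in vg.
apply: (dominates_bounded_variation (fun t => v (t - c)) _ _ _ _ _).1.
  by rewrite lerD2r.
by move=> x y h1 h2 h3; apply: vg; lra.
Qed.

(** Bounded variation on one period propagates to all of them by translation, and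
to finite unions of them by concatenation. *)
Lemma BV_bounded_variation (g : R -> R) a b : BV g -> a <= b -> bounded_variation a b g.
Proof.
move=> [pg bv] ab; have t0 := @tau_gt0 R; have pi0 := @pi_ge0 R.
have Npp : - pi <= pi :> R by rewrite ge0_cp.
have key (n : nat) : bounded_variation (- pi - n%:R * tau) (pi + n%:R * tau) g.
  elim: n => [|n ih]; first by rewrite mul0r subr0 addr0.
  have n0 : 0 <= n%:R * tau by rewrite mulr_ge0// ltW.
  have shiftE c : c = (Posz n.+1)%:~R * tau \/ c = - ((Posz n.+1)%:~R * tau) ->
      (fun t => g (t - c)) = g.
    move=> [->|->]; apply/funext => t; last by rewrite opprK periodicz.
    by rewrite -mulNr -mulrNz periodicz.
  have E : n.+1%:R * tau = n%:R * tau + tau by rewrite -natr1 mulrDl mul1r.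
  have R1 := bounded_variation_shift g (- pi) pi (n.+1%:R * tau) Npp bv.
  rewrite (shiftE (n.+1%:R * tau)) in R1; last by left.
  have R2 := bounded_variation_shift g (- pi) pi (- (n.+1%:R * tau)) Npp bv.
  rewrite (shiftE (- (n.+1%:R * tau))) in R2; last by right.
  move: R1 R2 ih; rewrite E; set z := n%:R * tau in n0 *; rewrite !tauE.
  move=> R1 R2 ih.
  apply: (@bounded_variation_cat _ _ (pi + z)); [lra..| |].
    apply: (@bounded_variation_cat _ _ (- pi - z)); [lra..| |exact: ih].
    by have -> : - pi - z = pi - (z + (pi + pi)) by ring.
  by have -> : pi + z = - pi + (z + (pi + pi)) by ring.
pose n := (Num.truncn (`|a| + `|b|)).+1.
have hn : `|a| + `|b| < n%:R by exact: truncnS_gt.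
have tau1 : 1 <= tau.
  by rewrite mulr2n; have := @pi_ge2 R; lra.
have hz : `|a| + `|b| <= n%:R * tau.
  by apply: (le_trans (ltW hn)); rewrite ler_pMr// ltr0n.
have := ler_norm b; have := ler_norm (- a); rewrite normrN => l1 l2.
have := normr_ge0 a; have := normr_ge0 b => l3 l4.
move: (key n) hz; set z := n%:R * tau => kn hz.
have kb : bounded_variation (- pi - z) b g.
  by apply: (@bounded_variationl _ _ _ (pi + z)) kn; lra.
by apply: (@bounded_variationr _ (- pi - z)) kb; lra.
Qed.

End bounded_variation.

(** * Integrating products with periodic functions of bounded variation *)

Section periodic_BV.
Context {R : realType}.
Local Notation mu := (@lebesgue_measure R).
Local Notation tau := (pi *+ 2 : R).
Implicit Types (F G p v : R -> R) (g h : R -> R^o) (a b : R) (f : @functional R).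

Lemma Npi_le_pi : - pi <= pi :> R. Proof. by rewrite ge0_cp ?pi_ge0. Qed.

Lemma Npi_lt_pi : - pi < pi :> R. Proof. by rewrite gt0_cp ?pi_gt0. Qed.

Definition clamp a b (x : R) := Num.max a (Num.min x b).

Lemma clamp_ge a b x : a <= clamp a b x.
Proof. by rewrite /clamp le_max lexx. Qed.

Lemma clamp_le a b x : a <= b -> clamp a b x <= b.
Proof. by move=> ab; rewrite /clamp ge_max ab ge_min lexx orbT. Qed.

Lemma clamp_id a b x : a <= x -> x <= b -> clamp a b x = x.
Proof. by move=> ax xb; rewrite /clamp (min_idPl xb) (max_idPr ax). Qed.

Lemma clamp_mono a b : {homo clamp a b : x y / x <= y}.
Proof.
move=> x y xy; rewrite /clamp ge_max le_max lexx/= le_max; apply/orP; right.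
by rewrite le_min ge_min xy/= ge_min lexx orbT.
Qed.

(** The total variation of g from a on, frozen outside [a, b] so as to become a
bounded monotone function on the whole line. *)
Lemma BV_dominated g a b : BV g -> a <= b -> exists v : R -> R,
  [/\ {homo v : x y / x <= y}, bounded_on_line v, dominates v g a b &
      v b - v a = fine (total_variation a b g)].
Proof.
move=> Bg ab; have vg := total_variation_dominates g a b (BV_bounded_variation g a b Bg ab).
set w := fun x => fine _ in vg.
have wmono x y : a <= x -> x <= y -> y <= b -> w x <= w y.
  by move=> ax xy yb; have := le_trans (normr_ge0 _) (vg x y ax xy yb); rewrite subr_ge0.
have cla := clamp_ge a b : forall x, a <= clamp a b x.
have clb x : clamp a b x <= b := clamp_le a b x ab.
have clE := clamp_id a b; have clm := clamp_mono a b.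
exists (w \o clamp a b); split.
- by move=> x y xy /=; apply: wmono => //; exact: clm.
- exists (`|w a| + `|w b|) => x /=; rewrite ler_norml.
  have := wmono a (clamp a b x) (lexx _) (cla x) (clb x).
  have := wmono (clamp a b x) b (cla x) (clb x) (lexx _).
  have := ler_norm (w b); have := ler_norm (- w a); rewrite normrN.
  have := normr_ge0 (w b); have := normr_ge0 (w a).
  by move=> h1 h2 h3 h4 h5 h6; apply/andP; split; lra.
- move=> x y ax xy yb /=; rewrite !clE ?(le_trans ax xy) ?(le_trans xy yb)//.
  exact: vg.
- rewrite /= !clE// /w total_variationxx/= subr0.
  by [].
Qed.

Lemma BV_bounded g : BV g -> bounded_on_line g.
Proof.
move=> Bg; have pg := Bg.1.
have [v [vmono [M vM] vg _]] := BV_dominated g (- pi) pi Bg Npi_le_pi.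
exists (`|g (- pi)| + (M + M)) => x.
rewrite (periodic_turn _ pg x).
have /andP[h1 h2] := turnP x; set y := x - _ in h1 h2 *.
have -> : g y = g (- pi) + (g y - g (- pi)) by rewrite subrKC.
apply: le_trans (ler_normD _ _) _; rewrite lerD2l.
apply: le_trans (vg _ _ (lexx _) h1 (ltW h2)) _.
apply: le_trans (ler_norm _) _; apply: le_trans (ler_normB _ _) _.
by apply: lerD; exact: vM.
Qed.

(** On [a, b], g is the difference of the monotone functions v and v - g, hence
measurable; it is bounded as well. *)
Lemma BV_locint g : BV g -> locint g.
Proof.
move=> Bg; apply: integrable_locint => a b.
have [ab|ba] := leP a b; last first.
  by rewrite set_itv_ge -?ltNge//; exact: integrable_set0.
have [v [vmono vM vg _]] := BV_dominated g a b Bg ab.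
have cla := clamp_ge a b : forall x, a <= clamp a b x.
have clb x : clamp a b x <= b := clamp_le a b x ab.
have clm := clamp_mono a b.
pose gc x := g (clamp a b x).
have mgc : measurable_fun setT gc.
  have -> : gc = (fun x => v (clamp a b x)) \- (fun x => v (clamp a b x) - gc x).
    by apply/funext => x /=; rewrite subKr.
  apply: measurable_funB; apply: nondecreasing_measurable => // x y xy.
    by apply: vmono; exact: clm.
  have := vg _ _ (cla x) (clm _ _ xy) (clb y); rewrite -/(gc x) -/(gc y).
  by rewrite ler_norml => /andP[_]; lra.
have [M gM] := BV_bounded g Bg.
have lgc : locint gc by apply: bounded_locint => //; exists M => x; exact: gM.
have := locint_integrable _ a b lgc; apply: eq_integrable => // x.
rewrite inE/= in_itv/= => /andP[ax xb].
by rewrite /gc clamp_id.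
Qed.

Lemma BV_measurable g : BV g -> measurable_fun setT g.
Proof. by move=> /BV_locint/locint_measurable. Qed.

Lemma BV_intro (v : R -> R) g : periodic g tau -> dominates v g (- pi) pi -> BV g.
Proof.
by move=> pg vg; split=> //; case: (dominates_bounded_variation v g _ _ Npi_le_pi vg).
Qed.

(** Reflecting exchanges the ends of an increment, which explains the sign of the
dominating function. *)
Lemma BV_reflect g (x : R) : BV g -> BV (fun t => g (x - t)).
Proof.
move=> Bg; have pg := Bg.1.
have h : x - pi <= x + pi by have := @pi_ge0 R; lra.
have [v [_ _ vg _]] := BV_dominated g _ _ Bg h.
apply: (@BV_intro (fun t => - v (x - t))); first exact: periodic_reflect.
move=> s t h1 h2 h3; have -> : - v (x - t) - - v (x - s) = v (x - s) - v (x - t) by ring.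
rewrite distrC; apply: vg; lra.
Qed.

Lemma BV_shift g (y : R) : BV g -> BV (fun t => g (t - y)).
Proof.
move=> Bg; have pg := Bg.1.
have h : - pi - y <= pi - y by have := @pi_ge0 R; lra.
have [v [_ _ vg _]] := BV_dominated g _ _ Bg h.
apply: (@BV_intro (fun t => v (t - y))); first exact: periodic_shift.
move=> s t h1 h2 h3; apply: vg; lra.
Qed.

Lemma BV_comb (c : R) g h : BV g -> BV h -> BV (fun t => c * g t + h t).
Proof.
move=> Bg Bh; have pg := Bg.1; have ph := Bh.1.
have [v [_ _ vg _]] := BV_dominated g _ _ Bg Npi_le_pi.
have [w [_ _ wh _]] := BV_dominated h _ _ Bh Npi_le_pi.
apply: (@BV_intro (fun t => `|c| * v t + w t)).
  by move=> x; rewrite pg ph.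
move=> s t h1 h2 h3.
have -> : c * g t + h t - (c * g s + h s) = c * (g t - g s) + (h t - h s).
  rewrite mulrBr opprD addrACA; congr (_ + _).
apply: le_trans (ler_normD _ _) _; rewrite normrM.
have := ler_wpM2l (normr_ge0 c) (vg s t h1 h2 h3).
by have := wh s t h1 h2 h3; lra.
Qed.

Lemma uniform_norm_ub (u : R -> R^o) x : bounded_on_line u -> `|u x| <= uniform_norm u.
Proof.
by move=> [M uM]; apply: ub_le_sup; [exists M => _ [y _ <-]; exact: uM|exists x].
Qed.

Lemma uniform_norm_le (u : R -> R^o) (M : R) : (forall x, `|u x| <= M) ->
  uniform_norm u <= M.
Proof.
move=> uM; apply: ge_sup; first by exists `|u 0|, 0.
by move=> _ [x _ <-]; exact: uM.
Qed.

Lemma BV_norm_ge0 g : BV g -> 0 <= BV_norm g.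
Proof.
move=> Bg; rewrite addr_ge0//; last first.
  by apply: fine_ge0; apply: total_variation_ge0; exact: Npi_le_pi.
exact: le_trans (normr_ge0 _) (uniform_norm_ub g 0 (BV_bounded g Bg)).
Qed.

(** The integral of f g over one period, as a function of the primitive F of f. *)
Definition parts_integral F (g : R -> R) : R :=
  F pi * g pi - Riemann_Stieltjes F g (- pi) pi.

Lemma Bc_by_parts p g : continuous p -> periodic p tau -> BV g ->
  is_Riemann_Stieltjes (int_from p) g (- pi) pi
    (int_from p pi * g pi - \int[mu]_(t in `[- pi, pi]) (p t * g t)).
Proof.
move=> cp pp Bg; have lp := continuous_locint _ cp.
have Bp := int_from_Bc _ lp pp.
have [v [_ _ vg _]] := BV_dominated g _ _ Bg Npi_le_pi.
have [M0 pM0] := continuous_bounded_itv p (- pi) pi cp.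
have pM x : `|p x| <= M0.
  rewrite (periodic_turn _ pp x); apply: pM0.
  by have /andP[-> /ltW ->] := turnP x.
have -> : int_from p pi * g pi - \int[mu]_(t in `[- pi, pi]) (p t * g t) =
    int_from p pi * g pi - int_from p (- pi) * g (- pi) -
    \int[mu]_(t in `[- pi, pi]) (p t * g t).
  by rewrite (Bc_Npi _ Bp) mul0r subr0.
apply: (@rs_by_parts _ v _ _ p _ _ M0) => //.
- exact: Npi_lt_pi.
- exact: BV_locint.
- by apply: locintM => //; [exact: BV_measurable|exact: BV_bounded].
- by move=> x y h1 h2 h3; rewrite int_fromB.
Qed.

Lemma Bc_near_int_from F p (e : R) : Bc F -> locint p ->
  (forall a b, a <= b -> `|F b - F a - \int[mu]_(t in `[a, b]) p t| <= e) ->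
  forall x, - pi <= x <= pi -> `|F x - int_from p x| <= e.
Proof.
move=> BF lp Fp x /andP[h1 h2]; have := Fp _ _ h1.
by rewrite -(int_fromB _ _ _ lp h1) (Bc_Npi _ BF) /int_from lexx Rintegral_xx !subr0.
Qed.

(** Integrals of continuous functions are integrated by parts, and F is a uniform
limit of such integrals. *)
Lemma Riemann_StieltjesP F g : Bc F -> BV g ->
  is_Riemann_Stieltjes F g (- pi) pi (Riemann_Stieltjes F g (- pi) pi).
Proof.
move=> BF Bg; have [v [_ _ vg _]] := BV_dominated g _ _ Bg Npi_le_pi.
suff [I HI] : exists I, is_Riemann_Stieltjes F g (- pi) pi I.
  by rewrite (Riemann_StieltjesE _ _ _ _ _ Npi_lt_pi HI).
apply: (@rs_uniform_limit _ v _ _ _ _ Npi_lt_pi vg) => e e0.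
have [p [cp pp Fp]] := steklov_approximation F e BF e0.
exists (int_from p), (int_from p pi * g pi - \int[mu]_(t in `[- pi, pi]) (p t * g t)).
split; last exact: Bc_by_parts.
exact: Bc_near_int_from BF (continuous_locint _ cp) Fp.
Qed.

Lemma parts_integral_comb (c : R) F G g : Bc F -> Bc G -> BV g ->
  parts_integral (fun x => c * F x + G x) g =
  c * parts_integral F g + parts_integral G g.
Proof.
move=> BF BG Bg; rewrite /parts_integral.
have H := rs_comb c _ _ _ _ _ _ _ (Riemann_StieltjesP F g BF Bg) (Riemann_StieltjesP G g BG Bg).
by rewrite (Riemann_StieltjesE _ _ _ _ _ Npi_lt_pi H); ring.
Qed.

Lemma parts_integral_comb_r (c : R) F g h : Bc F -> BV g -> BV h ->
  parts_integral F (fun x => c * g x + h x) =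
  c * parts_integral F g + parts_integral F h.
Proof.
move=> BF Bg Bh; rewrite /parts_integral.
have H := rs_comb_r c _ _ _ _ _ _ _ (Riemann_StieltjesP F g BF Bg) (Riemann_StieltjesP F h BF Bh).
by rewrite (Riemann_StieltjesE _ _ _ _ _ Npi_lt_pi H); ring.
Qed.

Lemma parts_integral_int_from p g : continuous p -> periodic p tau -> BV g ->
  parts_integral (int_from p) g = \int[mu]_(t in `[- pi, pi]) (p t * g t).
Proof.
move=> cp pp Bg; rewrite /parts_integral.
by rewrite (Riemann_StieltjesE _ _ _ _ _ Npi_lt_pi (Bc_by_parts p g cp pp Bg)) subKr.
Qed.

Lemma parts_integral_le F g (M : R) : Bc F -> BV g ->
  (forall x, - pi <= x <= pi -> `|F x| <= M) ->
  `|parts_integral F g| <= M * BV_norm g.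
Proof.
move=> BF Bg FM; have [v [_ _ vg vE]] := BV_dominated g _ _ Bg Npi_le_pi.
have M0 : 0 <= M.
  by apply: le_trans (FM pi _) => //; rewrite lexx Npi_le_pi.
rewrite /parts_integral /BV_norm mulrDr -vE; apply: le_trans (ler_normB _ _) _.
apply: lerD; last exact: rs_le Npi_lt_pi vg (Riemann_StieltjesP F g BF Bg) FM.
rewrite normrM; apply: ler_pM => //; first by apply: FM; rewrite lexx Npi_le_pi.
exact: uniform_norm_ub (BV_bounded g Bg).
Qed.

(** Replacing f by a continuous function p whose primitive is e-close to F changes
the integral of f g by at most e times the norm of g. This is how identities
between Lebesgue integrals pass to distributions. *)
Lemma parts_integral_approx F p g (e : R) : Bc F -> continuous p -> periodic p tau ->
  (forall a b, a <= b -> `|F b - F a - \int[mu]_(t in `[a, b]) p t| <= e) ->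
  BV g ->
  `|parts_integral F g - \int[mu]_(t in `[- pi, pi]) (p t * g t)| <= e * BV_norm g.
Proof.
move=> BF cp pp Fp Bg; have lp := continuous_locint _ cp.
have Bp := int_from_Bc _ lp pp.
rewrite -(parts_integral_int_from p g cp pp Bg).
have -> : parts_integral F g - parts_integral (int_from p) g =
    parts_integral (fun x => -1 * int_from p x + F x) g.
  by rewrite parts_integral_comb// mulN1r addrC.
apply: parts_integral_le => //; first exact: Bc_comb.
move=> x xp; rewrite mulN1r addrC; exact: Bc_near_int_from BF lp Fp x xp.
Qed.

End periodic_BV.

(** * Classical convolution of periodic functions *)

Section classical_convolution.
Context {R : realType}.
Local Notation mu := (@lebesgue_measure R).
Local Notation mR := (measurableTypeR R).
Local Notation tau := (pi *+ 2 : R).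
Implicit Types (p g h u v : R -> R) (a b x : R).

Lemma measurable_difference p : measurable_fun setT p ->
  measurable_fun [set: mR * mR] (fun z : mR * mR => p (z.1 - z.2)).
Proof.
move=> mp; apply: (@measurableT_comp _ _ _ _ _ _ p) => //.
by apply: measurable_funB; [exact: measurable_fst|exact: measurable_snd].
Qed.

(** The substitution of x - t for t, over a full period. *)
Lemma L1_conv_comm p g x : periodic p tau -> periodic g tau ->
  locint (fun t => p (x - t) * g t) ->
  L1_conv p g x = \int[mu]_(t in `[- pi, pi]) (p t * g (x - t)).
Proof.
move=> pp pg lpg; rewrite /L1_conv.
have pw : periodic (fun t => p (x - t) * g t) tau.
  by move=> t; rewrite pg (periodic_reflect _ x pp t).
rewrite -(Rintegral_reflect_period _ x lpg pw).
by apply: eq_Rintegral => t _; rewrite subKr.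
Qed.

Lemma L1_conv_periodic p g : periodic p tau -> periodic (L1_conv p g) tau.
Proof.
by move=> pp x; apply: eq_Rintegral => t _; rewrite addrAC pp.
Qed.

(** Fubini's theorem: the integral over x of p (x - t) is an integral of p over a
translated segment. The primitive of a convolution is thus the convolution of the
primitive, up to constants. *)
Lemma integral_L1_conv p g a b : locint p -> locint g -> a <= b ->
  mu.-integrable `[a, b] (EFin \o L1_conv p g) /\
  \int[mu]_(x in `[a, b]) L1_conv p g x =
  \int[mu]_(t in `[- pi, pi]) ((\int[mu]_(y in `[a - t, b - t]) p y) * g t).
Proof.
move=> lp lg ab; pose B := \int[mu]_(y in `[a - pi, b + pi]) `|p y|.
have lp' := locint_norm _ lp; have lg' := locint_norm _ lg.
have [] := @Fubini_rectangle R (fun z => p (z.1 - z.2) * g z.2)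
  (fun t => B * `|g t|) a b (- pi) pi.
- apply: measurable_funM; first exact: measurable_difference (locint_measurable _ lp).
  exact: (measurableT_comp (locint_measurable _ lg)).
- exact: (locint_integrable _ _ _ (locintZ B _ lg')).
- move=> t /andP[t1 t2] /=.
  have lpt : locint (fun x => p (x - t)) by exact: locint_shift.
  have lpt' := locint_norm _ lpt.
  have -> : (\int[mu]_(x in `[a, b]) `|p (x - t) * g t|%:E =
      \int[mu]_(x in `[a, b]) (`|g t| * `|p (x - t)|)%:E)%E.
    by apply: eq_integral => x _; rewrite normrM mulrC.
  rewrite (locint_integralE (fun x => `|g t| * `|p (x - t)|)); last exact: locintZ.
  rewrite lee_fin (locint_RintegralZ `|g t| (fun x => `|p (x - t)|))// mulrC.
  apply: ler_wpM2r => //.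
  rewrite (Rintegral_shift (fun x => `|p x|) a b (- t) (locint_measurable _ lp')).
  by apply: le_Rintegral_sub => //; lra.
move=> ip E; split; first exact: ip.
apply: etrans E _; apply: eq_Rintegral_itv => t _.
have lpt : locint (fun x => p (x - t)) by exact: locint_shift.
rewrite /= (locint_RintegralZr (g t) (fun x => p (x - t)))//.
by rewrite (Rintegral_shift p a b (- t) (locint_measurable _ lp)).
Qed.

Lemma L1_conv_locint p g : locint p -> locint g -> locint (L1_conv p g).
Proof.
move=> lp lg; apply: integrable_locint => a b; have [ab|ba] := leP a b.
  exact: (integral_L1_conv _ _ _ _ lp lg ab).1.
by rewrite set_itv_ge -?ltNge//; exact: integrable_set0.
Qed.

Lemma L1_conv_le p g x (M : R) : locint p -> locint g -> (forall x, `|p x| <= M) ->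
  `|L1_conv p g x| <= M * \int[mu]_(t in `[- pi, pi]) `|g t|.
Proof.
move=> lp lg pM; have lg' := locint_norm _ lg.
rewrite -(locint_RintegralZ M (fun t => `|g t|) _ _ lg').
have lpx := locint_reflect _ x lp.
apply: norm_Rintegral_le; last 1 first.
- by move=> t _; rewrite normrM ler_wpM2r.
- by apply: locintMl => //; [exact: locint_measurable|exists M].
- exact: locintZ.
Qed.

(** Both sides are double integrals of p (x - t) g (t - s) h s; after exchanging the
order of integration, t is replaced by t + s. *)
Lemma L1_conv_assoc p g h : locint p -> periodic p tau -> bounded_on_line p ->
  locint g -> periodic g tau -> bounded_on_line g -> locint h ->
  L1_conv p (L1_conv g h) = L1_conv (L1_conv p g) h.
Proof.
move=> lp pp [P pP] lg pg [Q gQ] lh; apply/funext => x.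
have lh' := locint_norm _ lh.
have P0 : 0 <= P by exact: le_trans (pP 0).
have Q0 : 0 <= Q by exact: le_trans (gQ 0).
have lpx : locint (fun t => p (x - t)) by exact: locint_reflect.
have lgs s : locint (fun t => g (t - s)) by exact: locint_shift.
have lpg s : locint (fun t => p (x - t) * g (t - s)).
  by apply: locintM => //; [exact: locint_measurable (lgs s)|exists Q].
have [] := @Fubini_rectangle R (fun z => p (x - z.1) * (g (z.1 - z.2) * h z.2))
  (fun s => P * Q * (pi - - pi) * `|h s|) (- pi) pi (- pi) pi.
- apply: measurable_funM.
    exact: (measurableT_comp (locint_measurable _ lpx)).
  apply: measurable_funM; first exact: measurable_difference (locint_measurable _ lg).
  exact: (measurableT_comp (locint_measurable _ lh)).
- exact: (locint_integrable _ _ _ (locintZ _ _ lh')).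
- move=> s _ /=.
  have -> : P * Q * (pi - - pi) * `|h s| =
      \int[mu]_(t in `[- pi, pi]) (P * Q * `|h s|).
    by rewrite (RintegralM_cst _ _ _ Npi_le_pi) mulrAC.
  rewrite -(locint_integralE (fun=> P * Q * `|h s|) _ _ (locint_cst _)).
  apply: ge0_le_integral_any => t _; first by rewrite lee_fin.
  rewrite lee_fin !normrM mulrA; apply: ler_wpM2r => //.
  by apply: ler_pM.
move=> _ E.
have step1 : forall t, - pi <= t <= pi ->
    \int[mu]_(s in `[- pi, pi]) (p (x - t) * (g (t - s) * h s)) =
    p (x - t) * L1_conv g h t.
  move=> t _; apply: (locint_RintegralZ (p (x - t)) (fun s => g (t - s) * h s)).
  have lgt := locint_reflect _ t lg.
  by apply: locintMl => //; [exact: locint_measurable lgt|exists Q].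
have step2 : forall s, - pi <= s <= pi ->
    \int[mu]_(t in `[- pi, pi]) (p (x - t) * (g (t - s) * h s)) =
    L1_conv p g (x - s) * h s.
  move=> s _; transitivity (\int[mu]_(t in `[- pi, pi]) (p (x - t) * g (t - s) * h s)).
    by apply: eq_Rintegral => t _; rewrite mulrA.
  rewrite (locint_RintegralZr (h s) (fun t => p (x - t) * g (t - s)) _ _ (lpg s)).
  congr (_ * _); pose w (y : R) := p (x - s - y) * g y.
  have lw : locint w.
    have lps := locint_reflect _ (x - s) lp.
    by apply: locintM => //; [exact: locint_measurable lg|exists Q].
  have pw : periodic w tau.
    by move=> t; rewrite /w pg (periodic_reflect _ (x - s) pp t).
  apply: etrans (Rintegral_shift_period _ (- s) lw pw).
  by apply: eq_Rintegral => t _; rewrite /w; congr (p _ * _); ring.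
exact: etrans (etrans (esym (eq_Rintegral_itv _ _ _ _ step1)) E)
  (eq_Rintegral_itv _ _ _ _ step2).
Qed.

(** The increments of g * h are integrals of increments of g, so v * |h| dominates
g * h as soon as v dominates g on the values of x - t that occur. *)
Lemma L1_conv_BV (g : R -> R^o) h : BV g -> locint h -> BV (L1_conv g h).
Proof.
move=> Bg lh; have pg := Bg.1; have lh' := locint_norm _ lh.
have pi0 := @pi_ge0 R.
have [v [vmono bv vg _]] := BV_dominated g (- tau) tau Bg
  (ltac:(by rewrite ge0_cp// ltW// tau_gt0)).
have lv : locint v by apply: bounded_locint => //; exact: nondecreasing_measurable.
have lvx x : locint (fun t => v (x - t) * `|h t|).
  have lvx := locint_reflect _ x lv.
  apply: locintMl => //; first exact: locint_measurable lvx.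
  by have [M vM] := bv; exists M.
have lgx x : locint (fun t => g (x - t) * h t).
  have lgx := locint_reflect _ x (BV_locint g Bg).
  apply: locintMl => //; first exact: locint_measurable lgx.
  by have [M gM] := BV_bounded g Bg; exists M.
apply: (@BV_intro _ (fun x => \int[mu]_(t in `[- pi, pi]) (v (x - t) * `|h t|))).
  exact: L1_conv_periodic.
move=> x y px xy yp; rewrite /L1_conv.
rewrite -(locint_RintegralB (fun t => g (y - t) * h t) (fun t => g (x - t) * h t))//.
rewrite -(locint_RintegralB (fun t => v (y - t) * `|h t|) (fun t => v (x - t) * `|h t|))//.
apply: norm_Rintegral_le; [exact: locintB|exact: locintB|].
move=> t /andP[t1 t2]; rewrite -!mulrBl normrM; apply: ler_wpM2r => //.
by apply: vg; rewrite ?tauE; lra.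
Qed.

Lemma L1_conv_ae (u v u' v' : R -> R) :
  {ae mu, forall x, u x = u' x} -> {ae mu, forall x, v x = v' x} ->
  L1_conv u v = L1_conv u' v'.
Proof.
move=> uu vv; apply/funext => x; apply: ae_eq_Rintegral.
have uux := preserves_ae _ (fun y => u y = u' y) (reflect_preserves x) uu.
by apply: ae_imply (ae_and _ _ uux vv) => t [-> ->].
Qed.

Lemma locint_L1 u : locint u -> periodic u tau -> L1 u.
Proof.
move=> lu pu; split=> //; exists u; last first.
  by exists set0; split=> // x /= H; exfalso; exact: H.
split; [exact: locint_measurable|exact: openT|] => K _ cK.
have [M [Mr KM]] := compact_bounded cK.
pose N := `|M| + 1.
have KN : K `<=` `[- N, N].
  move=> x Kx /=; rewrite in_itv/= -ler_norml; apply: (KM N) => //.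
  by rewrite /N ltr_pwDr// ler_norm.
have /integrableP[_] := locint_integrable _ (- N) N lu.
apply: le_lt_trans.
apply: (@ge0_subset_integral _ mR R mu) => //.
- exact: compact_measurable.
- apply/measurable_EFinP/measurable_funTS.
  exact: locint_measurable (locint_norm _ lu).
Qed.

End classical_convolution.

(** * Convolution of a distribution with a function of bounded variation *)

Section convolution_with_distributions.
Context {R : realType}.
Local Notation mu := (@lebesgue_measure R).
Local Notation tau := (pi *+ 2 : R).
Implicit Types (F p v : R -> R) (g h : R -> R^o) (a b : R) (f : @functional R).

Definition integral_approximates p F (e : R) := forall a b, a <= b ->
  `|F b - F a - \int[mu]_(t in `[a, b]) p t| <= e.

(** The form in which approximation by continuous functions is concluded. *)
Lemma eq_up_to_epsilon (x y C : R) : 0 <= C ->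
  (forall e, 0 < e -> `|x - y| <= e * C) -> x = y.
Proof.
move=> C0 H; apply/eqP; rewrite -subr_eq0 -normr_eq0; apply/eqP/le_anti.
rewrite normr_ge0 andbT; apply/ler_addgt0Pr => e e0; rewrite add0r.
have C1 : 0 < C + 1 by rewrite ltr_wpDl.
have e1 : 0 < e / (C + 1) by rewrite divr_gt0.
apply: le_trans (H _ e1) _; rewrite -[leRHS](divfK (lt0r_neq0 C1)).
by rewrite ler_pM2l// lerDl.
Qed.

Lemma norm_sub_via (z x y e1 e2 : R) : `|x - z| <= e1 -> `|y - z| <= e2 ->
  `|x - y| <= e1 + e2.
Proof.
move=> h1 h2; have -> : x - y = (x - z) - (y - z) by ring.
by apply: le_trans (ler_normB _ _) _; exact: lerD.
Qed.

Lemma dist_convE f g x : has_primitive f -> dist_conv f g x =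
  parts_integral (fun t => - primitive f (x - t) + primitive f (x + pi)) g.
Proof. by move=> fP; rewrite /dist_conv /cp_integral_mul primitive_reflect. Qed.

Lemma reflect_approximates p F e x : locint p -> integral_approximates p F e ->
  integral_approximates (fun t => p (x - t)) (fun t => - F (x - t) + F (x + pi)) e.
Proof.
move=> lp Fp a b ab.
rewrite (Rintegral_reflect p a b x (locint_measurable _ lp)).
have := Fp (x - b) (x - a); rewrite lerD2l lerN2 => /(_ ab).
set I := \int[mu]_(t in _) _; set u := F (x - a); set w := F (x - b).
by have -> : u - w - I = - w + F (x + pi) - (- u + F (x + pi)) - I by ring.
Qed.

Lemma dist_conv_approx f g p e x : has_primitive f -> BV g -> continuous p ->
  periodic p tau -> integral_approximates p (primitive f) e ->
  `|dist_conv f g x - L1_conv p g x| <= e * BV_norm g.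
Proof.
move=> fP Bg cp pp Fp; rewrite (dist_convE f g x fP).
have lp := continuous_locint _ cp.
apply: (parts_integral_approx _ (fun t => p (x - t))) => //.
- by apply: Bc_reflect; exact: Bc_primitive.
- move=> t; apply: cvg_comp; last exact: cp.
  by apply: cvgB; [exact: cvg_cst|exact: cvg_id].
- exact: periodic_reflect.
- exact: reflect_approximates.
Qed.

Lemma conv_dist_approx f g p e x : has_primitive f -> BV g -> continuous p ->
  periodic p tau -> integral_approximates p (primitive f) e ->
  `|conv_dist g f x - L1_conv p g x| <= e * BV_norm (fun t => g (x - t) : R^o).
Proof.
move=> fP Bg cp pp Fp; have lp := continuous_locint _ cp; have lg := BV_locint g Bg.
have lpx := locint_reflect _ x lp.
rewrite (L1_conv_comm p g x pp Bg.1); last first.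
  by apply: locintM => //; [exact: BV_measurable|exact: BV_bounded].
apply: (parts_integral_approx _ p) => //; first exact: Bc_primitive.
exact: BV_reflect.
Qed.

Lemma approximant f e : has_primitive f -> 0 < e -> exists p,
  [/\ continuous p, periodic p tau & integral_approximates p (primitive f) e].
Proof. by move=> fP e0; apply: steklov_approximation => //; exact: Bc_primitive. Qed.

(** For continuous functions this is a change of variables, and both sides depend
continuously on f in the Alexiewicz norm. *)
Lemma dist_conv_comm f g : has_primitive f -> BV g -> dist_conv f g = conv_dist g f.
Proof.
move=> fP Bg; apply/funext => x.
have Bgx := BV_reflect g x Bg.
apply: (eq_up_to_epsilon _ _ (BV_norm g + BV_norm (fun t => g (x - t) : R^o))).
  by apply: addr_ge0; apply: BV_norm_ge0.
move=> e e0; have [p [cp pp Fp]] := approximant f e fP e0.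
have h1 := dist_conv_approx f g p e x fP Bg cp pp Fp.
have h2 := conv_dist_approx f g p e x fP Bg cp pp Fp.
by rewrite mulrDr; exact: norm_sub_via h1 h2.
Qed.

(** The primitive of t |-> f (x - t) takes the values F (x + pi) - F (x - t), which are
integrals of f over intervals of length at most 2 pi. *)
Lemma dist_conv_bound f g x : has_primitive f -> BV g ->
  `|dist_conv f g x| <= alexiewicz f * BV_norm g.
Proof.
move=> fP Bg; have BF := Bc_primitive f fP; rewrite dist_convE//.
apply: parts_integral_le => //; first exact: Bc_reflect.
move=> t /andP[t1 t2]; rewrite addrC; apply: alexiewicz_ub => //.
  by lra.
by rewrite tauE; lra.
Qed.

Lemma dist_conv_periodic f g : has_primitive f -> periodic (dist_conv f g) tau.
Proof.
move=> fP x; have BF := Bc_primitive f fP; rewrite !dist_convE//.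
congr parts_integral; apply/funext => t.
have -> : x + tau - t = x - t + tau by rewrite addrAC.
have -> : x + tau + pi = x + pi + tau by rewrite addrAC.
by rewrite !Bc_tau//; ring.
Qed.

(** The primitive of t |-> f (x - t) depends uniformly continuously on x. *)
Lemma dist_conv_continuous f g : has_primitive f -> BV g -> continuous (dist_conv f g).
Proof.
move=> fP Bg x; have BF := Bc_primitive f fP; set F := primitive f in BF.
apply/cvgrPdist_le => e e0.
have B0 := BV_norm_ge0 g Bg.
have B1 : 0 < 2 * (BV_norm g + 1) by rewrite mulr_gt0// ltr_wpDl.
have e1 : 0 < e / (2 * (BV_norm g + 1)) by rewrite divr_gt0.
set e' := e / _ in e1.
have [d d0 dF] := quasi_periodic_uniformly_continuous F e' (Bc_continuous _ BF)
  (fun x y n => Bc_increment_period F x y n BF) e1.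
have dF2 s t : `|s - t| <= d -> `|F s - F t| <= e'.
  have [st|ts] := leP s t.
    rewrite ler0_norm ?subr_le0// opprB distrC => h.
    have -> : t = s + (t - s) by rewrite subrKC.
    by apply: dF; rewrite subr_ge0 st.
  rewrite gtr0_norm ?subr_gt0// => h.
  have -> : s = t + (s - t) by rewrite subrKC.
  by apply: dF; rewrite subr_ge0 (ltW ts).
apply/nbhs_ballP; exists d => //= y; rewrite /ball/= => xyd.
have -> : dist_conv f g x - dist_conv f g y = parts_integral
    (fun t => -1 * (- F (y - t) + F (y + pi)) + (- F (x - t) + F (x + pi))) g.
  rewrite parts_integral_comb//; [|exact: Bc_reflect..].
  by rewrite -!dist_convE// mulN1r addrC.
have BK := Bc_comb _ _ (-1) (Bc_reflect F y BF) (Bc_reflect F x BF).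
apply: le_trans (parts_integral_le _ g (e' + e') BK Bg _) _.
  move=> t _.
  have -> : -1 * (- F (y - t) + F (y + pi)) + (- F (x - t) + F (x + pi)) =
      (F (x + pi) - F (y + pi)) - (F (x - t) - F (y - t)) by ring.
  apply: le_trans (ler_normB _ _) _; apply: lerD; apply: dF2.
    by have -> : x + pi - (y + pi) = x - y; [ring|exact: ltW].
  by have -> : x - t - (y - t) = x - y; [ring|exact: ltW].
have -> : e = e' * (2 * (BV_norm g + 1)) by rewrite /e' divfK// gt_eqF.
have -> : (e' + e') * BV_norm g = e' * (2 * BV_norm g) by ring.
by rewrite ler_pM2l// ler_pM2l// lerDl.
Qed.

Lemma dist_conv_C0 f g : has_primitive f -> BV g -> C0 (dist_conv f g).
Proof.
by move=> fP Bg; split; [exact: dist_conv_continuous|exact: dist_conv_periodic].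
Qed.

Lemma dist_conv_bounded f g : has_primitive f -> BV g ->
  bounded_on_line (dist_conv f g).
Proof.
by move=> fP Bg; exists (alexiewicz f * BV_norm g) => x; exact: dist_conv_bound.
Qed.

Lemma dist_conv_locint f g : has_primitive f -> BV g -> locint (dist_conv f g).
Proof. by move=> fP Bg; apply: continuous_locint; exact: dist_conv_continuous. Qed.

Lemma dist_conv_shift_l f g y : has_primitive f -> BV g ->
  has_primitive (dist_shift y f) /\
  shift_fun y (dist_conv f g) = dist_conv (dist_shift y f) g.
Proof.
move=> fP Bg; have [BG fG] := shift_primitive f y fP.
have sP : has_primitive (dist_shift y f) by eexists; [exact: BG|exact: fG].
split=> //; apply/funext => x; rewrite /shift_fun !dist_convE//.
rewrite (primitive_eq _ _ BG fG); congr parts_integral; apply/funext => t.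
have -> : x - y - t = x - t - y by rewrite addrAC.
have -> : x - y + pi = x + pi - y by rewrite addrAC.
by rewrite opprB; ring.
Qed.

(** By commutativity the translation may be moved to the variable of the
convolution. *)
Lemma dist_conv_shift_r f g y : has_primitive f -> BV g ->
  shift_fun y (dist_conv f g) = dist_conv f (shift_fun y g).
Proof.
move=> fP Bg; have Bs : BV (shift_fun y g : R -> R^o) by exact: BV_shift.
rewrite !dist_conv_comm//; apply/funext => x; rewrite /shift_fun /conv_dist.
by congr cp_integral_mul; apply/funext => t; rewrite addrAC.
Qed.

Lemma dist_conv_comb_r f g h (c : R) : has_primitive f -> BV g -> BV h ->
  dist_conv f (fun t => c * g t + h t) =
  (fun x => c * dist_conv f g x + dist_conv f h x).
Proof.
move=> fP Bg Bh; apply/funext => x; rewrite !dist_convE//.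
by rewrite parts_integral_comb_r//; apply: Bc_reflect; exact: Bc_primitive.
Qed.

Lemma dist_conv_comb_l f f' g (c : R) : has_primitive f -> has_primitive f' -> BV g ->
  dist_conv (c *: f + f') g =
  (fun x => c * dist_conv f g x + dist_conv f' g x).
Proof.
move=> fP fP' Bg; apply/funext => x.
have [BG fG] := comb_primitive f f' c fP fP'.
have sP : has_primitive (c *: f + f') by eexists; [exact: BG|exact: fG].
rewrite !dist_convE// -parts_integral_comb//; last 2 first.
- by apply: Bc_reflect; exact: Bc_primitive.
- by apply: Bc_reflect; exact: Bc_primitive.
rewrite (primitive_eq _ _ BG fG); congr parts_integral; apply/funext => t; ring.
Qed.

(** Associativity for continuous f is Fubini's theorem. The error made by replacing
f by a continuous p is controlled on the left by the norm of g * h, and on the right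
by the uniform bound on f * g - p * g and the L1 norm of h. *)
Lemma dist_conv_assoc f g (h : R -> R) : has_primitive f -> BV g -> locint h ->
  periodic h tau -> dist_conv f (L1_conv g h) = L1_conv (dist_conv f g) h.
Proof.
move=> fP Bg lh ph; apply/funext => x; have lg := BV_locint g Bg.
have Bgh := L1_conv_BV g h Bg lh; have lh' := locint_norm _ lh.
set H := \int[mu]_(t in `[- pi, pi]) `|h t|.
have H0 : 0 <= H by apply: Rintegral_ge0.
apply: (eq_up_to_epsilon _ _ (BV_norm (L1_conv g h) + BV_norm g * H)).
  by rewrite addr_ge0 ?mulr_ge0 ?BV_norm_ge0.
move=> e e0; have [p [cp pp Fp]] := approximant f e fP e0.
have lp := continuous_locint _ cp; have lfg := dist_conv_locint f g fP Bg.
have [M0 pM0] := continuous_bounded_itv p (- pi) pi cp.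
have bp : bounded_on_line p.
  exists M0 => z; rewrite (periodic_turn _ pp z); apply: pM0.
  by have /andP[-> /ltW ->] := turnP z.
have h1 := dist_conv_approx f (L1_conv g h) p e x fP Bgh cp pp Fp.
rewrite (L1_conv_assoc p g h lp pp bp lg Bg.1 (BV_bounded g Bg) lh) in h1.
have lpg := L1_conv_locint p g lp lg.
have h2 := L1_conv_le (fun z => dist_conv f g z - L1_conv p g z) h x (e * BV_norm g)
  (locintB _ _ lfg lpg) lh (fun z => dist_conv_approx f g p e z fP Bg cp pp Fp).
have E : L1_conv (fun z => dist_conv f g z - L1_conv p g z) h x =
    L1_conv (dist_conv f g) h x - L1_conv (L1_conv p g) h x.
  have l1 : locint (fun t => dist_conv f g (x - t) * h t).
    have lr := locint_reflect _ x lfg.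
    apply: locintMl; [exact: lh|exact: locint_measurable lr|].
    by have [M fM] := dist_conv_bounded f g fP Bg; exists M.
  have l2 : locint (fun t => L1_conv p g (x - t) * h t).
    have lr := locint_reflect _ x lpg.
    apply: locintMl; [exact: lh|exact: locint_measurable lr|].
    have [M pM] := bp; exists (M * \int[mu]_(t in `[- pi, pi]) `|g t|) => t.
    exact: L1_conv_le.
  apply: etrans (locint_RintegralB _ _ _ _ l1 l2).
  by apply: eq_Rintegral => t _; rewrite mulrBl.
rewrite E in h2; rewrite mulrDr mulrA; exact: norm_sub_via h1 h2.
Qed.

End convolution_with_distributions.

(** * Norm estimates *)

Section norm_inequalities.
Context {R : realType}.
Local Notation mu := (@lebesgue_measure R).
Local Notation tau := (pi *+ 2 : R).
Implicit Types (F p u v : R -> R) (g h : R -> R^o) (a b : R) (f : @functional R).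

Lemma L1_norm_ge0 (u : R -> R^o) : 0 <= L1_norm u.
Proof. exact: Rintegral_ge0. Qed.

(** The integral of p * v over [a, b] averages the integrals of p over [a - t, b - t]
with the weights v t. *)
Lemma integral_L1_conv_le p v a b (K : R) : locint p -> locint v -> a <= b ->
  (forall t, `|\int[mu]_(y in `[a - t, b - t]) p y| <= K) ->
  `|\int[mu]_(x in `[a, b]) L1_conv p v x| <= K * L1_norm v.
Proof.
move=> lp lv ab pK; rewrite (integral_L1_conv p v a b lp lv ab).2.
have lv' := locint_norm _ lv.
have E : (fun t => \int[mu]_(y in `[a - t, b - t]) p y) =
    (fun t => int_from p (b - t) - int_from p (a - t)).
  by apply/funext => t; rewrite int_fromB// lerD2r.
have cE : continuous (fun t => \int[mu]_(y in `[a - t, b - t]) p y).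
  rewrite E => t; apply: cvgB; apply: cvg_comp; do ?exact: int_from_continuous.
    by apply: cvgB; [exact: cvg_cst|exact: cvg_id].
  by apply: cvgB; [exact: cvg_cst|exact: cvg_id].
rewrite /L1_norm -(locint_RintegralZ K (fun t => `|v t|) _ _ lv').
apply: norm_Rintegral_le; last by move=> t _; rewrite normrM ler_wpM2r.
- by apply: locintMl; [exact: lv|exact: continuous_measurable_fun|exists K].
- exact: locintZ.
Qed.

Lemma primitive_regularB u a b : locint u -> periodic u tau -> a <= b ->
  primitive (regular u) b - primitive (regular u) a = \int[mu]_(t in `[a, b]) u t.
Proof. by move=> lu pu ab; rewrite primitive_regular// int_fromB. Qed.

Lemma alexiewicz_regular_ub u a b : locint u -> periodic u tau -> a <= b ->
  b - a <= tau -> `|\int[mu]_(t in `[a, b]) u t| <= alexiewicz (regular u).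
Proof.
move=> lu pu ab abt; rewrite -primitive_regularB//; apply: alexiewicz_ub => //.
by rewrite primitive_regular//; exact: int_from_Bc.
Qed.

Lemma alexiewicz_regular_le u (M : R) : locint u -> periodic u tau ->
  (forall a b, a <= b -> b - a <= tau -> `|\int[mu]_(t in `[a, b]) u t| <= M) ->
  alexiewicz (regular u) <= M.
Proof.
move=> lu pu H; apply: alexiewicz_le => a b ab abt.
by rewrite primitive_regularB//; exact: H.
Qed.

Lemma alexiewicz_le_L1 u : locint u -> periodic u tau ->
  alexiewicz (regular u) <= L1_norm u.
Proof.
move=> lu pu; apply: alexiewicz_regular_le => // a b ab abt.
have lu' := locint_norm _ lu.
have pu' : periodic (fun x => `|u x|) tau by move=> x; rewrite pu.
apply: le_trans (locint_norm_Rintegral _ _ _ lu) _.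
rewrite /L1_norm -(Rintegral_period _ a lu' pu').
by apply: le_Rintegral_sub => //; rewrite -lerBlDl.
Qed.

Lemma alexiewicz_L1_conv u v : locint u -> periodic u tau -> locint v ->
  periodic v tau ->
  alexiewicz (regular (L1_conv u v)) <= alexiewicz (regular u) * L1_norm v.
Proof.
move=> lu pu lv pv; apply: alexiewicz_regular_le => [| |a b ab abt].
- exact: L1_conv_locint.
- exact: L1_conv_periodic.
apply: integral_L1_conv_le => // t; apply: alexiewicz_regular_ub => //.
  by rewrite lerD2r.
by have -> : b - t - (a - t) = b - a by ring.
Qed.

(** For a continuous p close to f the estimate is [integral_L1_conv_le]; the error
terms are e times constants, and the length of [a, b] is bounded. *)
Lemma alexiewicz_dist_conv f g : has_primitive f -> BV g ->
  alexiewicz (regular (dist_conv f g)) <= alexiewicz f * L1_norm g.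
Proof.
move=> fP Bg; have lfg := dist_conv_locint f g fP Bg; have lg := BV_locint g Bg.
have BF := Bc_primitive f fP.
apply: alexiewicz_regular_le => //; first exact: dist_conv_periodic.
move=> a b ab abt; apply/ler_addgt0Pr => e e0.
have B0 := BV_norm_ge0 g Bg; have G0 := L1_norm_ge0 g; have t0 := ltW (@tau_gt0 R).
(* e' C collects the errors made on [a, b], on f * g and on the increments of F *)
pose C := BV_norm g * tau + L1_norm g + 1.
have C0 : 0 < C by rewrite ltr_wpDl// addr_ge0// mulr_ge0.
have e1 : 0 < e / C by rewrite divr_gt0.
set e' := e / C in e1; have eE : e = e' * C by rewrite /e' divfK// gt_eqF.
have [p [cp pp Fp]] := approximant f e' fP e1.
have lp := continuous_locint _ cp; have lpg := L1_conv_locint p g lp lg.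
have h1 : `|\int[mu]_(x in `[a, b]) (dist_conv f g x - L1_conv p g x)| <=
    e' * BV_norm g * (b - a).
  apply: norm_Rintegral_le_cst => //; first exact: locintB.
  by move=> x _; exact: dist_conv_approx.
rewrite (locint_RintegralB _ _ _ _ lfg lpg) in h1.
have h2 : `|\int[mu]_(x in `[a, b]) L1_conv p g x| <= (alexiewicz f + e') * L1_norm g.
  apply: integral_L1_conv_le => // t.
  have abt' : a - t <= b - t by rewrite lerD2r.
  have k1 := Fp _ _ abt'.
  have k2 : `|primitive f (b - t) - primitive f (a - t)| <= alexiewicz f.
    apply: alexiewicz_ub => //.
    by have -> : b - t - (a - t) = b - a by ring.
  move: k1 k2; set I := \int[mu]_(y in _) _; set X := primitive f (b - t) - primitive f (a - t) => k1 k2.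
  have -> : I = X - (X - I) by ring.
  by apply: le_trans (ler_normB _ _) _; exact: lerD.
have h3 : e' * BV_norm g * (b - a) <= e' * (BV_norm g * tau).
  by rewrite -mulrA; apply: ler_wpM2l; [exact: ltW|exact: ler_wpM2l].
move: h1 h2; set I := \int[mu]_(x in _) dist_conv f g x.
set J := \int[mu]_(x in _) _ => h1 h2.
have -> : I = (I - J) + J by rewrite subrK.
apply: le_trans (ler_normD _ _) _.
apply: le_trans (lerD (le_trans h1 h3) h2) _.
rewrite eE /C !mulrDr mulrDl mulr1; lra.
Qed.

(** The supremum over an empty set is 0, whence the hypothesis on the sign of C. *)
Lemma operator_norm_le (X Y : lmodType R) (V : set X) (nV : X -> R) (nW : Y -> R)
    (A : X -> Y) (C : R) : 0 <= C ->
  (forall x, V x -> nW (A x) <= C * nV x) -> operator_norm V nV nW A <= C.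
Proof.
move=> C0 H; rewrite /operator_norm.
set S := [set _ | _ in _]; have [->|/set0P S0] := eqVneq S set0; first by rewrite sup0.
apply: ge_sup => // _ [x [Vx x1] <-]; apply: le_trans (H x Vx) _.
by rewrite -[leRHS]mulr1; exact: ler_wpM2l.
Qed.

End norm_inequalities.

(** * Fourier coefficients *)

Section fourier_coefficients.
Context {R : realType}.
Local Notation mu := (@lebesgue_measure R).
Local Notation tau := (pi *+ 2 : R).
Implicit Types (g h : R -> R^o) (f : @functional R) (n : int).

Lemma lipschitz1_of_derive (k dk : R -> R) : (forall x, is_derive x (1 : R) k (dk x)) ->
  (forall x, `|dk x| <= 1) -> forall x y : R, `|k y - k x| <= `|y - x|.
Proof.
move=> dkE dk1 x y; wlog xy : x y / x <= y.
  by move=> H; have [/H//|/ltW/H] := leP x y; rewrite distrC [leRHS]distrC.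
have [|z _ ->] := @MVT_segment R k dk x y xy (fun z _ => dkE z).
  apply: continuous_subspaceT => z; apply: differentiable_continuous.
  by apply/derivable1_diffP; have [] := dkE z.
by rewrite normrM ler_piMl.
Qed.

(** A Lipschitz function is dominated by a linear one. *)
Lemma BV_frequency (k dk : R -> R) n : periodic k tau ->
  (forall x, is_derive x (1 : R) k (dk x)) -> (forall x, `|dk x| <= 1) ->
  BV (fun t => k (n%:~R * t) : R^o).
Proof.
move=> pk dkE dk1; apply: (@BV_intro _ (fun t => `|n%:~R| * t)).
  by move=> x; rewrite mulrDr periodicz.
move=> x y _ xy _; apply: le_trans (lipschitz1_of_derive _ _ dkE dk1 _ _) _.
by rewrite -!mulrBr normrM [`|y - x|]ger0_norm// subr_ge0.
Qed.

Definition cosn n (t : R) : R^o := cos (n%:~R * t).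
Definition sinn n (t : R) : R^o := sin (n%:~R * t).

Lemma BV_cosn n : BV (cosn n).
Proof.
apply: (BV_frequency _ (fun x => - sin x)); first exact: cosD2pi.
by move=> x; rewrite normrN; exact: sin_max.
Qed.

Lemma BV_sinn n : BV (sinn n).
Proof.
apply: (BV_frequency _ (fun x => cos x)); first exact: sinD2pi.
exact: cos_max.
Qed.

Lemma cosnB n (x t : R) : cosn n (x - t) = cosn n x * cosn n t + sinn n x * sinn n t.
Proof. by rewrite /cosn /sinn mulrBr cosB. Qed.

Lemma sinnB n (x t : R) : sinn n (x - t) = sinn n x * cosn n t - cosn n x * sinn n t.
Proof. by rewrite /cosn /sinn mulrBr sinB. Qed.

Lemma cosnN n (t : R) : cosn n (- t) = cosn n t.
Proof. by rewrite /cosn mulrN cosN. Qed.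

Lemma sinnN n (t : R) : sinn n (- t) = - sinn n t.
Proof. by rewrite /sinn mulrN sinN. Qed.

Lemma BV_mul_locint g h : BV g -> BV h -> locint (fun t => g t * h t).
Proof.
move=> Bg Bh; apply: locintM; first exact: BV_locint.
  exact: BV_measurable.
exact: BV_bounded.
Qed.

Local Notation C g n := (\int[mu]_(t in `[- pi, pi]) (g t * cosn n t)).
Local Notation S g n := (\int[mu]_(t in `[- pi, pi]) (g t * sinn n t)).

(** The addition formula: trigonometric functions of frequency n are reproduced by
convolution, with the Fourier coefficients of g as weights. *)
Lemma L1_conv_cosn g n : BV g ->
  L1_conv g (cosn n) = (fun x => C g n * cosn n x + S g n * sinn n x).
Proof.
move=> Bg; have Bc := BV_cosn n; have Bs := BV_sinn n; apply/funext => x.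
have lc := BV_mul_locint _ _ Bg Bc; have ls := BV_mul_locint _ _ Bg Bs.
rewrite L1_conv_comm; [|exact: Bg.1|exact: Bc.1|]; last first.
  exact: (BV_mul_locint _ _ (BV_reflect g x Bg) Bc).
rewrite [C g n * _]mulrC [S g n * _]mulrC.
rewrite -(locint_RintegralZ (cosn n x) _ _ _ lc) -(locint_RintegralZ (sinn n x) _ _ _ ls).
apply: etrans (locint_RintegralD _ _ _ _ (locintZ _ _ lc) (locintZ _ _ ls)).
by apply: eq_Rintegral => t _; rewrite cosnB mulrDr mulrCA [g t * (_ * _)]mulrCA.
Qed.

Lemma L1_conv_sinn g n : BV g ->
  L1_conv g (sinn n) = (fun x => C g n * sinn n x + (- S g n) * cosn n x).
Proof.
move=> Bg; have Bc := BV_cosn n; have Bs := BV_sinn n; apply/funext => x.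
have lc := BV_mul_locint _ _ Bg Bc; have ls := BV_mul_locint _ _ Bg Bs.
rewrite L1_conv_comm; [|exact: Bg.1|exact: Bs.1|]; last first.
  exact: (BV_mul_locint _ _ (BV_reflect g x Bg) Bs).
rewrite [C g n * _]mulrC mulNr [S g n * _]mulrC.
rewrite -(locint_RintegralZ (sinn n x) _ _ _ lc) -(locint_RintegralZ (cosn n x) _ _ _ ls).
apply: etrans (locint_RintegralB _ _ _ _ (locintZ _ _ lc) (locintZ _ _ ls)).
by apply: eq_Rintegral => t _; rewrite sinnB mulrBr mulrCA [g t * (_ * _)]mulrCA.
Qed.

Local Notation Tc f n := (parts_integral (primitive f) (cosn n)).
Local Notation Ts f n := (parts_integral (primitive f) (sinn n)).

Lemma dist_conv_cosn0 f n : has_primitive f -> dist_conv f (cosn n) 0 = Tc f n.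
Proof.
move=> fP; rewrite dist_conv_comm//; last exact: BV_cosn.
rewrite /conv_dist /cp_integral_mul -/(parts_integral _ _); congr parts_integral.
by apply/funext => t; rewrite sub0r cosnN.
Qed.

Lemma parts_integralN (F g : R -> R) : Bc F -> BV (g : R -> R^o) ->
  parts_integral F (fun t => - g t) = - parts_integral F g.
Proof.
move=> BF Bg; have := parts_integral_comb_r (-2) F g g BF Bg Bg.
(* - g as a combination of the form c g + g *)
have -> : (fun x => -2 * g x + g x) = (fun t => - g t) by apply/funext => t; ring.
by move=> ->; ring.
Qed.

Lemma dist_conv_sinn0 f n : has_primitive f -> dist_conv f (sinn n) 0 = - Ts f n.
Proof.
move=> fP; rewrite dist_conv_comm//; last exact: BV_sinn.
rewrite /conv_dist /cp_integral_mul -/(parts_integral _ _).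
rewrite -parts_integralN; [|exact: Bc_primitive|exact: BV_sinn].
by congr parts_integral; apply/funext => t; rewrite sub0r sinnN.
Qed.

Lemma dist_conv_two f g h (c d : R) : has_primitive f -> BV g -> BV h ->
  dist_conv f (fun t => c * g t + d * h t) =
  (fun x => c * dist_conv f g x + d * dist_conv f h x).
Proof.
move=> fP Bg Bh.
(* d h as a combination of the form c h + h *)
have dE (u : R -> R) : (fun t => d * u t) = (fun t => (d - 1) * u t + u t).
  by apply/funext => t; ring.
have Bdh : BV (fun t => d * h t : R^o) by rewrite dE; exact: BV_comb.
rewrite (dist_conv_comb_r f g (fun t => d * h t) c fP Bg Bdh).
apply/funext => x; rewrite dE (dist_conv_comb_r f h h (d - 1) fP Bh Bh); ring.
Qed.

(** The coefficient is the value at 0 of (f * g) * cos (n .), that is, of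
f * (g * cos (n .)), and g * cos (n .) is a combination of cos (n .) and sin (n .). *)
Lemma cos_coefficient f g n : has_primitive f -> BV g ->
  C (dist_conv f g) n = Tc f n * C g n - Ts f n * S g n.
Proof.
move=> fP Bg; have Bc := BV_cosn n; have Bs := BV_sinn n.
have lfg := dist_conv_locint f g fP Bg.
have E := congr1 (fun u : R -> R^o => u 0)
  (dist_conv_assoc f g (cosn n) fP Bg (BV_locint _ Bc) Bc.1).
have lfc : locint (fun t => dist_conv f g t * cosn n t).
  by apply: locintM; [|exact: BV_measurable|exact: BV_bounded].
have pfc : periodic (fun t => dist_conv f g t * cosn n t) tau.
  by move=> x; rewrite (dist_conv_periodic f g fP x) (Bc.1 x).
rewrite -(Rintegral_reflect_period _ 0 lfc pfc).
transitivity (L1_conv (dist_conv f g) (cosn n) 0).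
  by apply: eq_Rintegral => t _; rewrite sub0r cosnN.
rewrite -E (L1_conv_cosn g n Bg).
rewrite (dist_conv_two f _ _ (C g n) (S g n) fP Bc Bs).
by rewrite (dist_conv_cosn0 f n fP) (dist_conv_sinn0 f n fP); ring.
Qed.

Lemma sin_coefficient f g n : has_primitive f -> BV g ->
  S (dist_conv f g) n = Tc f n * S g n + Ts f n * C g n.
Proof.
move=> fP Bg; have Bc := BV_cosn n; have Bs := BV_sinn n.
have lfg := dist_conv_locint f g fP Bg.
have E := congr1 (fun u : R -> R^o => u 0)
  (dist_conv_assoc f g (sinn n) fP Bg (BV_locint _ Bs) Bs.1).
have lfs : locint (fun t => dist_conv f g t * sinn n t).
  by apply: locintM; [|exact: BV_measurable|exact: BV_bounded].
have pfs : periodic (fun t => dist_conv f g t * sinn n t) tau.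
  by move=> x; rewrite (dist_conv_periodic f g fP x) (Bs.1 x).
apply: oppr_inj; rewrite -(Rintegral_reflect_period _ 0 lfs pfs).
transitivity (L1_conv (dist_conv f g) (sinn n) 0).
  rewrite -mulN1r -(locint_RintegralZ _ _ _ _ (locint_reflect _ 0 lfs)).
  by apply: eq_Rintegral => t _; rewrite sub0r sinnN mulrN mulN1r opprK.
rewrite -E (L1_conv_sinn g n Bg).
rewrite (dist_conv_two f _ _ (C g n) (- S g n) fP Bs Bc).
by rewrite (dist_conv_cosn0 f n fP) (dist_conv_sinn0 f n fP); ring.
Qed.

Lemma fourier_dist_conv f g n : has_primitive f -> BV g ->
  fourier (dist_conv f g) n = dist_fourier f n * fourier g n.
Proof.
move=> fP Bg; have Bc := BV_cosn n; have Bs := BV_sinn n.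
have FC (u : R -> R) : locint (fun t => u t * sinn n t) ->
    fourier u n = Complex (C u n) (- S u n).
  move=> lu; rewrite /fourier; congr Complex.
    by apply: eq_Rintegral => t _; rewrite /= mul0r subr0.
  apply: etrans _ (mulN1r _); apply: etrans _ (locint_RintegralZ (-1) _ _ _ lu).
  by apply: eq_Rintegral => t _; rewrite /= mul0r addr0 mulrN mulN1r.
have lfg := dist_conv_locint f g fP Bg.
rewrite !FC; last 2 first.
- exact: BV_mul_locint.
- by apply: locintM; [|exact: BV_measurable|exact: BV_bounded].
have -> : dist_fourier f n = Complex (Tc f n) (- Ts f n).
  rewrite /dist_fourier; congr Complex.
  rewrite -parts_integralN; [|exact: Bc_primitive|exact: BV_sinn].
  by [].
rewrite (cos_coefficient f g n fP Bg) (sin_coefficient f g n fP Bg).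
rewrite -[RHS]/(Complex (_ * _ - _ * _) (_ * _ + _ * _)); congr Complex; ring.
Qed.

End fourier_coefficients.

(** * The convolution theorem *)

(** The functions are first replaced by periodic Borel representatives. *)
Lemma L1_conv_inequalities (R : realType) (f g : R -> R^o) : L1 f -> L1 g ->
  [/\ L1 (L1_conv f g),
      alexiewicz (regular (L1_conv f g)) <= alexiewicz (regular f) * L1_norm g
    & alexiewicz (regular f) * L1_norm g <= L1_norm f * L1_norm g].
Proof.
move=> /L1_borel[f' [lf pf ff']] /L1_borel[g' [lg pg gg']].
rewrite (L1_conv_ae _ _ _ _ ff' gg').
have -> : regular f = regular f'.
  apply/funext => phi; apply: ae_eq_Rintegral.
  by apply: ae_imply ff' => x ->.
have normE (u u' : R -> R^o) : {ae @lebesgue_measure R, forall x, u x = u' x} ->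
    L1_norm u = L1_norm u'.
  by move=> uu'; apply: ae_eq_Rintegral; apply: ae_imply uu' => x ->.
rewrite (normE f f' ff') (normE g g' gg'); split.
- by apply: locint_L1; [exact: L1_conv_locint|exact: L1_conv_periodic].
- exact: alexiewicz_L1_conv.
- by apply: ler_wpM2r; [exact: L1_norm_ge0|exact: alexiewicz_le_L1].
Qed.

Lemma dist_conv_L1_assoc (R : realType) (f : @functional R) (g h : R -> R^o) :
  has_primitive f -> BV g -> L1 h ->
  [/\ BV (L1_conv g h),
      dist_conv f (L1_conv g h) = L1_conv (dist_conv f g) h
    & C0 (L1_conv (dist_conv f g) h)].
Proof.
move=> fP Bg /L1_borel[h' [lh ph hh']].
have ae_refl (u : R -> R) : {ae @lebesgue_measure R, forall x, u x = u x}.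
  by exists set0; split=> // x /= H; exfalso; exact: H.
rewrite (L1_conv_ae g h g h' (ae_refl _) hh').
rewrite (L1_conv_ae (dist_conv f g) h (dist_conv f g) h' (ae_refl _) hh').
have Bgh := L1_conv_BV g h' Bg lh.
have E := dist_conv_assoc f g h' fP Bg lh ph.
by split=> //; rewrite -E; exact: dist_conv_C0.
Qed.

Theorem theorem4 (R : realType) :
  (forall (f : @functional R) (g : R -> R^o), Ac f -> BV g ->
     (* a *) C0 (dist_conv f g)
  /\ (* b *) dist_conv f g = conv_dist g f
  /\ (* c *) uniform_norm (dist_conv f g) <= alexiewicz f * BV_norm g
  /\ (* d *) (forall y : R,
        shift_fun y (dist_conv f g) = dist_conv (dist_shift y f) g
     /\ dist_conv (dist_shift y f) g = dist_conv f (shift_fun y g))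
  /\ (* e *) (forall h : R -> R^o, L1 h ->
     [/\ BV (L1_conv g h),
         dist_conv f (L1_conv g h) = L1_conv (dist_conv f g) h
       & C0 (L1_conv (dist_conv f g) h)])
  /\ (* f *) ((bounded_linear_operator BV BV_norm C0 uniform_norm
                 (fun g' : R -> R^o => dist_conv f g')
            /\ operator_norm BV BV_norm uniform_norm
                 (fun g' : R -> R^o => dist_conv f g') <= alexiewicz f)
         /\ (bounded_linear_operator Ac alexiewicz C0 uniform_norm
                 (fun f' : @functional R => dist_conv f' g)
            /\ operator_norm Ac alexiewicz uniform_norm
                 (fun f' : @functional R => dist_conv f' g) <= BV_norm g))
  /\ (* g *) (forall n : int,
        fourier (dist_conv f g) n = dist_fourier f n * fourier g n)
  /\ (* h *) alexiewicz (regular (dist_conv f g)) <= alexiewicz f * L1_norm g)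
  /\ (* i *) (forall f g : R -> R^o, L1 f -> L1 g ->
     [/\ L1 (L1_conv f g),
         alexiewicz (regular (L1_conv f g)) <= alexiewicz (regular f) * L1_norm g
       & alexiewicz (regular f) * L1_norm g <= L1_norm f * L1_norm g]).
Proof.
split; last exact: L1_conv_inequalities.
move=> f g /Ac_has_primitive fP Bg.
split; first exact: dist_conv_C0.
split; first exact: dist_conv_comm.
have normg : uniform_norm (dist_conv f g) <= alexiewicz f * BV_norm g.
  by apply: uniform_norm_le => x; exact: dist_conv_bound.
split; first exact: normg.
split.
  move=> y; have [_ E] := dist_conv_shift_l f g y fP Bg.
  by split; [exact: E|rewrite -E; exact: dist_conv_shift_r].
split; first by move=> h; exact: dist_conv_L1_assoc.
have A0 : 0 <= alexiewicz f by apply: alexiewicz_ge0; exact: Bc_primitive.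
have boundr (g' : R -> R^o) : BV g' ->
    uniform_norm (dist_conv f g') <= alexiewicz f * BV_norm g'.
  by move=> Bg'; apply: uniform_norm_le => x; exact: dist_conv_bound.
have boundl (f' : @functional R) : Ac f' ->
    uniform_norm (dist_conv f' g) <= BV_norm g * alexiewicz f'.
  move=> /Ac_has_primitive fP'; rewrite mulrC.
  by apply: uniform_norm_le => x; exact: dist_conv_bound.
split.
  split; split.
  - split.
    + by move=> g' Bg'; exact: dist_conv_C0.
    + by move=> a g1 g2 Bg1 Bg2; exact: dist_conv_comb_r.
    + by exists (alexiewicz f).
  - exact: operator_norm_le.
  - split.
    + by move=> f' /Ac_has_primitive fP'; exact: dist_conv_C0.
    + move=> a f1 f2 /Ac_has_primitive fP1 /Ac_has_primitive fP2.
      exact: dist_conv_comb_l.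
    + by exists (BV_norm g).
  - by apply: operator_norm_le => //; exact: BV_norm_ge0.
split; first by move=> n; exact: fourier_dist_conv.
exact: alexiewicz_dist_conv.
Qed.
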